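(* Let $n\ge2$, $A>0$ and $L>0$. Then $U_{A,L}$ is the unique solution of the limit problem; that is, for every $t>0$ the function $U_{A,L}(\cdot,t)$ is the unique function $w$ satisfying $$w\in\mathcal K_t,\qquad \int_{\mathbb{R}^n}Dw\cdot D\phi\,dx\ge-L\int_{\mathbb{R}^n}\phi\,dx\quad\forall\phi\in\mathcal V,\qquad \int_{\mathbb{R}^n}Dw\cdot D(\psi w)\,dx=-L\int_{\mathbb{R}^n}\psi w\,dx\quad\forall\psi\in\mathcal W.$$
   Context: For $A,L>0$ define on $(\mathbb{R}^n\setminus\{0\})\times[0,\infty)$: if $n\ge3$, $V_{A,L}(x,t)=A\big(|x|^{2-n}-\rho(t)^{2-n}\big)_+$ with $\rho(t)=(An(n-2)t/L)^{1/n}$; if $n=2$, $V_{A,L}(x,t)=A\big(\log\frac{\rho(t)}{|x|}\big)_+$ with $\rho(t)=(2At/L)^{1/2}$; $V_{A,L}(\cdot,0)=0$. Let $U_{A,L}(x,t)=\int_0^tV_{A,L}(x,s)\,ds$ be its Baiocchi transform. Explicitly $U_{A,L}(x,t)=0$ for $|x|\ge\rho(t)$, and for $0<|x|<\rho(t)$: $U_{A,L}(x,t)=At|x|^{2-n}+\frac{L}{2n}|x|^2-\frac12(Ant)^{2/n}\big(\frac{n-2}{L}\big)^{(2-n)/n}$ if $n\ge3$, and $U_{A,L}(x,t)=\frac A2t\log\frac{2At}{Le|x|^2}+\frac{L|x|^2}{4}$ if $n=2$. With $B_\varepsilon$ the open ball of radius $\varepsilon$ centered at $0$: $$\mathcal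 K_t=\Big\{\varphi\in\bigcap_{\varepsilon>0}H^1(\mathbb{R}^n\setminus B_\varepsilon)\cap C(\mathbb{R}^n\setminus B_\varepsilon):\ \varphi\ge0,\ \lim_{|x|\to0}\frac{\varphi(x)}{U_{A,L}(x,t)}=1\Big\},$$ $$\mathcal V=\{\phi\in H^1(\mathbb{R}^n):\ \phi\ge0,\ \phi=0\text{ on }B_\varepsilon\text{ for some }\varepsilon>0\},\qquad \mathcal W=\mathcal V\cap C^1(\mathbb{R}^n).$$ *)

(* Defs.v *)
From HB Require Import structures.
From mathcomp Require Import all_boot all_order all_algebra.
From mathcomp Require Import all_classical all_reals all_analysis.

Set Implicit Arguments.
Unset Strict Implicit.
Unset Printing Implicit Defensive.
Import Order.TTheory GRing.Theory Num.Theory.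
Import numFieldNormedType.Exports.

Local Open Scope classical_set_scope.
Local Open Scope ring_scope.

(* The product sigma-algebra on row vectors (the Borel sigma-algebra of R^n
   when T = R), built as the library does for n.-tuple T. *)
Definition measure_rV_display : measure_display -> measure_display.
Proof. exact. Qed.

Section measurable_rV.
Context {d} {T : sigmaRingType d} (n : nat).

Let coors : 'I_n -> 'rV[T]_n -> T := fun i x => x ord0 i.

Let rV_set0 : g_sigma_preimage coors set0.
Proof. exact: sigma_algebra0. Qed.

Let rV_setC A : g_sigma_preimage coors A -> g_sigma_preimage coors (~` A).
Proof. exact: sigma_algebraC. Qed.

Let rV_bigcup (F : _^nat) : (forall i, g_sigma_preimage coors (F i)) ->
  g_sigma_preimage coors (\bigcup_i (F i)).
Proof. exact: sigma_algebra_bigcup. Qed.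

HB.instance Definition _ := @isMeasurable.Build (measure_rV_display d)
  'rV[T]_n (g_sigma_preimage coors) rV_set0 rV_setC rV_bigcup.

End measurable_rV.

Lemma measurable_coord d (T : sigmaRingType d) n (i : 'I_n) :
  measurable_fun [set: 'rV[T]_n] (fun x : 'rV[T]_n => x ord0 i).
Proof.
move=> _ Y mY; rewrite setTI; apply: sub_sigma_algebra => /=.
rewrite -bigcup_seq/=; exists i => /=; first by rewrite mem_index_enum.
by exists Y => //; rewrite setTI.
Qed.

Lemma measurable_fun_rVP d1 d2 (T1 : measurableType d1) (T2 : measurableType d2)
    n (f : T1 -> 'rV[T2]_n) :
  (forall i, measurable_fun [set: T1] (fun x => f x ord0 i)) ->
  measurable_fun [set: T1] f.
Proof.
move=> mf _ A; rewrite setTI => mA.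
suff : g_sigma_preimage (fun (i : 'I_n) (x : 'rV[T2]_n) => x ord0 i) `<=`
    [set B | measurable (f @^-1` B)] by apply.
apply: smallest_sub.
  split => [|B mB|F mF] /=; first by rewrite preimage_set0.
  - by rewrite setTD preimage_setC; apply: measurableC.
  - by rewrite preimage_bigcup; apply: bigcup_measurable => k _; exact: mF.
move=> B; rewrite -bigcup_seq => -[i _ [C mC <-]] /=.
by rewrite setTI -[X in measurable X]setTI; exact: mf.
Qed.

Section lebesgue_rV.
Variable R : realType.

Definition consrV n (p : R * 'rV[R]_n) : 'rV[R]_n.+1 :=
  row_mx (p.1%:M : 'rV[R]_1) p.2.

Definition unconsrV n (x : 'rV[R]_n.+1) : R * 'rV[R]_n :=
  (x ord0 ord0, rsubmx (x : 'rV[R]_(1 + n))).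

Lemma consrVK n : cancel (@consrV n) (@unconsrV n).
Proof.
case=> a v; rewrite /unconsrV /consrV row_mxKr; congr pair => /=.
have -> : (ord0 : 'I_n.+1) = lshift n (ord0 : 'I_1) by exact: val_inj.
by rewrite (@row_mxEl R 1 1 n) mxE eqxx mulr1n.
Qed.

Lemma measurable_consrV n : measurable_fun setT (@consrV n).
Proof.
apply: measurable_fun_rVP => i.
have [k ->|k ->] := @split_ordP 1 n i.
  rewrite (_ : (fun _ => _) = fst); first exact: measurable_fst.
  apply/funext => x; rewrite /consrV (@row_mxEl R 1 1 n).
  by rewrite (ord1 k) mxE; exact: mulr1n.
rewrite (_ : (fun _ => _) = (fun x : 'rV[R]_n => x ord0 k) \o snd).
  by apply: measurableT_comp; [exact: measurable_coord|exact: measurable_snd].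
by apply/funext => x; rewrite /consrV (@row_mxEr R 1 1 n).
Qed.

Lemma measurable_unconsrV n : measurable_fun setT (@unconsrV n).
Proof.
apply: measurable_fun_pair => /=; first exact: measurable_coord.
apply: measurable_fun_rVP => i.
rewrite (_ : (fun _ => _) = fun x : 'rV[R]_n.+1 => x ord0 (rshift 1 i)).
  exact: measurable_coord.
by apply/funext => x; rewrite mxE.
Qed.

Section step.
Variables (n : nat) (mu : {sigma_finite_measure set 'rV[R]_n -> \bar R}).

Definition lebesgue_step : set 'rV[R]_n.+1 -> \bar R :=
  pushforward (@lebesgue_measure R \x mu)%E (@consrV n).

Let step0 : lebesgue_step set0 = 0%E.
Proof. by rewrite /lebesgue_step /pushforward preimage_set0 measure0. Qed.

Let step_ge0 A : (0 <= lebesgue_step A)%E.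
Proof. by apply: integral_ge0 => x _; exact: measure_ge0. Qed.

Let step_sigma_additive : semi_sigma_additive lebesgue_step.
Proof.
move=> F mF tF mUF; rewrite /lebesgue_step /pushforward preimage_bigcup.
apply: measure_semi_sigma_additive.
- by move=> k; rewrite -[X in measurable X]setTI; exact: measurable_consrV.
- apply/trivIsetP => /= i j _ _ ij; rewrite -preimage_setI.
  by move/trivIsetP : tF => /(_ _ _ _ _ ij) ->//; rewrite preimage_set0.
- by rewrite -preimage_bigcup -[X in measurable X]setTI;
    exact: measurable_consrV.
Qed.

HB.instance Definition _ := isMeasure.Build _ _ _ lebesgue_step
  step0 step_ge0 step_sigma_additive.

Let step_sigma_finite : sigma_finite setT lebesgue_step.
Proof.
have /sigma_finiteP[F [TF ndF Foo]] := sigma_finiteT (@lebesgue_measure R).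
have /sigma_finiteP[G [TG ndG Goo]] := sigma_finiteT mu.
exists (fun k => @unconsrV n @^-1` (F k `*` G k)).
  rewrite -preimage_bigcup (_ : \bigcup_k _ = setT) ?preimage_setT//.
  rewrite -subTset => -[a v] _.
  have [k _ Fka] : (\bigcup_k F k) a by rewrite -TF.
  have [l _ Glv] : (\bigcup_k G k) v by rewrite -TG.
  exists (maxn k l) => //; split.
  - by move: Fka; exact/subsetPset/ndF/leq_maxl.
  - by move: Glv; exact/subsetPset/ndG/leq_maxr.
move=> k; have [mF Fk] := Foo k; have [mG Gk] := Goo k; split.
  rewrite -[X in measurable X]setTI; apply: measurable_unconsrV => //.
  exact: measurableX.
rewrite /lebesgue_step /pushforward -comp_preimage.
rewrite (_ : _ \o _ = id); last by apply/funext => x /=; rewrite consrVK.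
by rewrite preimage_id product_measure1E// lte_mul_pinfty// ge0_fin_numE.
Qed.

HB.instance Definition _ := Measure_isSigmaFinite.Build _ _ _ lebesgue_step
  step_sigma_finite.

End step.

(* n-dimensional Lebesgue measure: the iterated product of n copies of the
   one-dimensional one (the one-point space R^0 carries a unit mass). *)
Fixpoint lebesgue_rV n : {sigma_finite_measure set 'rV[R]_n -> \bar R} :=
  match n with
  | 0 => \d_(0 : 'rV[R]_0)
  | m.+1 => lebesgue_step (lebesgue_rV m)
  end.

End lebesgue_rV.

Section sobolev.
Variables (R : realType) (n : nat).
Implicit Types (D : set 'rV[R]_n) (f g phi : 'rV[R]_n -> R) (i : 'I_n).

Local Notation mu := (@lebesgue_rV R n).

(* The library norm of 'rV[R]_n is the sup norm. *)
Definition enorm (x : 'rV[R]_n) : R := Num.sqrt (\sum_i x ord0 i ^+ 2).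

Definition eball (e : R) : set 'rV[R]_n := [set x | enorm x < e].

Definition pderiv i f : 'rV[R]_n -> R := 'D_(delta_mx ord0 i) f.

Definition C1 f := continuous f /\
  forall i, (forall x, derivable f x (delta_mx ord0 i)) /\
            continuous (pderiv i f).

Definition smooth f := forall s : seq 'I_n, C1 (foldr pderiv f s).

Definition test_function D phi := [/\ smooth phi,
  compact (closure [set x | phi x != 0]) &
  closure [set x | phi x != 0] `<=` D].

Definition L1loc D f := measurable_fun D f /\
  forall K, compact K -> K `<=` D -> mu.-integrable K (EFin \o f).

Definition L2 D f := measurable_fun D f /\
  mu.-integrable D (fun x => (f x ^+ 2)%:E).

Definition is_weak_pderiv D i f g := [/\ L1loc D f, L1loc D g &
  forall phi, test_function D phi ->
    (\int[mu]_(x in D) (f x * pderiv i phi x)%:E =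
     - \int[mu]_(x in D) (g x * phi x)%:E)%E].

(* A representative of the weak derivative, which is unique almost everywhere;
   the default value is only used when f has no weak derivative. *)
Definition wpderiv D i f : 'rV[R]_n -> R :=
  xget (fun=> 0) [set g | is_weak_pderiv D i f g].

(* The set D need not be open: derivatives are taken in its interior. *)
Definition H1 D f := L2 D f /\
  forall i, exists2 g, is_weak_pderiv D° i f g & L2 D g.

End sobolev.

Section baiocchi.
Variables (R : realType) (n : nat) (A L : R).
Implicit Types (x : 'rV[R]_n) (t : R).

Definition rho t : R :=
  if n == 2%N then (2 * A * t / L) `^ (2^-1)
  else (A * n%:R * (n%:R - 2) * t / L) `^ (n%:R^-1).

Definition V_AL x t : R :=
  if t == 0 then 0
  else if n == 2%N then A * Num.max 0 (ln (rho t / enorm x))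
  else A * Num.max 0 (enorm x ^ (2 - n%:Z) - rho t ^ (2 - n%:Z)).

Definition U_AL x t : R := \int[@lebesgue_measure R]_(s in `[0, t]) V_AL x s.

End baiocchi.

Section limit_problem.
Variables (R : realType) (n : nat) (A L : R).
Implicit Types (w phi psi : 'rV[R]_n -> R) (t : R).

Local Notation mu := (@lebesgue_rV R n).

(* Elements of K_t are functions on R^n \ {0}: their value at 0 is ignored. *)
Definition Kt t : set ('rV[R]_n -> R) := [set phi |
  [/\ forall e, 0 < e ->
        H1 (~` eball e) phi /\ {within ~` eball e, continuous phi},
      forall x, x != 0 -> 0 <= phi x &
      phi x / U_AL A L x t @[x --> (0 : 'rV[R]_n)^'] --> (1 : R)]].

Definition VV : set ('rV[R]_n -> R) := [set phi |
  [/\ H1 setT phi,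
      {ae mu, forall x, 0 <= phi x} &
      exists2 e, 0 < e & {ae mu, forall x, eball e x -> phi x = 0}]].

Definition WW : set ('rV[R]_n -> R) := VV `&` [set phi | C1 phi].

Definition gradw w i := wpderiv [set x | x != 0] i w.

Definition grad phi i := wpderiv setT i phi.

(* The integrals are extended-real valued: for phi in VV, which need not be
   integrable, the right-hand side of the inequality may be -oo; since the
   right-hand side of the equality is finite, the equality includes the
   integrability of its left-hand side. *)
Definition limit_solution t w := [/\ Kt t w,
  forall phi, VV phi ->
    (\int[mu]_x (\sum_i gradw w i x * grad phi i x)%:E >=
     - (L%:E * \int[mu]_x (phi x)%:E))%E &
  forall psi, WW psi ->
    (\int[mu]_x (\sum_i gradw w i x * grad (psi \* w)%R i x)%:E =
     - (L%:E * \int[mu]_x (psi x * w x)%:E))%E].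

End limit_problem.

(* Main.v *)
From HB Require Import structures.
Require Import Defs.
From mathcomp Require Import all_boot all_order all_algebra.
From mathcomp Require Import all_classical all_reals all_analysis.
From mathcomp Require Import measurable_realfun ring lra.
Import Order.TTheory GRing.Theory Num.Theory.
Import numFieldNormedType.Exports.

(** Why the theorem holds. Everything takes place away from the origin, where
the transform U = U_AL has an explicit radial profile u(r): with
c = A (n - 2), or c = A if n = 2, it satisfies u'(r) = - r s(r), where
s(r) is the positive part of c t r^(-n) - L / n, and this positive part is
nonzero exactly for r < rho(t). Hence the vector field with components
D_i U = - x_i s(|x|) has divergence L on the ball of radius rho(t) and 0
outside: Laplacian U = L 1_(|x| < rho(t)) away from 0.

Existence. The divergence identity is proved in weak form ([flux]) by
smoothing the positive part. For phi in the class VV it reads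
  int DU . Dphi = - L int_(|x| < rho(t)) phi,
which is at least - L int phi because phi is nonnegative; for phi = psi U
it is an equality with - L int psi U because U vanishes for |x| >= rho(t).

Uniqueness. Let w be a solution. Only smooth bumps eta supported in boxes
that avoid the origin are used to test it:
- phi = eta in the inequality gives Laplacian w <= L ([kern_w_le]);
- psi = eta in the equality, together with D(w^2) = 2 w Dw and w >= 0,
  shows that w^2 is subharmonic ([kern_w2_ge0]);
- if w >= m > 0 on the box, then phi = eta w / m - eta is admissible in the
  inequality, and combined with the equality for psi = eta it gives the
  converse Laplacian w >= L, so Laplacian w = L where w > 0 ([kern_w_eq]).
Since w is in L^2 at infinity and w^2 is subharmonic, w is bounded there
([w_bounded_out]). Then w is compared with the transforms for the
perturbed parameters A (1 -+ s) and L (1 +- s), which have the same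
singularity as (1 -+ s) U. The difference has the right sign near 0 and at
infinity, and at a positive interior maximum its Laplacian would be
strictly positive; a maximum principle excludes this
([strict_max_principle], [w_ge_baiocchi], [w_le_baiocchi]). Letting s tend
to 0 gives w = U.

The maximum principle is applied to convolutions with one explicit bump
kernel: at a maximum of a convolution the second differences along the axes
are nonpositive, and they converge to the distributional Laplacian tested
with the kernel ([moll_local_max]). The same kernel extends the definition
of the weak derivative from smooth test functions to C^1 ones ([ext_weak]). *)

Set Implicit Arguments.
Unset Strict Implicit.
Unset Printing Implicit Defensive.
Local Open Scope classical_set_scope.
Local Open Scope ring_scope.

(** * Lebesgue measure on row vectors *)

Local Notation pushm :=
  measure_function_pushforward__canonical__measure_function_Measure.

Section rV_measure.
Variable R : realType.

Lemma ball_rVE n (c : 'rV[R]_n) r : 0 < r ->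
  ball c r = [set x : 'rV[R]_n | forall i, ball (c ord0 i) r (x ord0 i)].
Proof.
move=> r0; apply/seteqP; split => x /=.
  by move=> [_ +] i; apply.
by move=> h; split=> // i j; rewrite ord1.
Qed.

Lemma measurable_ball_rV n (c : 'rV[R]_n) r : measurable (ball c r).
Proof.
have [r0|r0] := ltP 0 r; last first.
  rewrite (_ : ball c r = set0) //; apply/seteqP; split => // x [].
  by rewrite ltNge r0.
rewrite ball_rVE// (_ : [set x | _] = \bigcap_(i in [set: 'I_n])
    ((fun x : 'rV[R]_n => x ord0 i) @^-1` ball (c ord0 i) r)).
  apply: fin_bigcap_measurable => // i _.
  rewrite -[X in measurable X]setTI; apply: measurable_coord => //.
  by apply: open_measurable; exact: ball_open.
by apply/seteqP; split => x /= h i; [move=> _|]; exact: h.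
Qed.

(** The sigma-algebra is the product one; an open set is a countable union of
    sup-norm balls with rational centres and radii 1/(k+1), which are products. *)
Lemma open_measurable_rV n (O : set 'rV[R]_n) : open O -> measurable O.
Proof.
move=> oO.
pose I := [set p : 'rV[rat]_n * nat | ball (map_mx ratr p.1 : 'rV[R]_n) (p.2.+1%:R^-1) `<=` O].
rewrite (_ : O = \bigcup_(p in I) ball (map_mx ratr p.1 : 'rV[R]_n) (p.2.+1%:R^-1)); last first.
  apply/seteqP; split => [x Ox|x [p Ip] /Ip//].
  have /nbhs_ballP[e /= e0 xe] : nbhs x O by exact: open_nbhs_nbhs.
  have [k ke] : exists k : nat, (k.+1%:R^-1 : R) < e / 2.
    have e20 : (0 : R) < e / 2 by rewrite divr_gt0.
    by have [k] := ltr_add_invr e20; rewrite add0r; exists k.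
  have /choice[q Hq] : forall i, exists q : rat, ball (x ord0 i) (k.+1%:R^-1) (ratr q : R).
    move=> i.
    have : x ord0 i < x ord0 i + k.+1%:R^-1 by rewrite ltrDl.
    move=> /rat_in_itvoo[q]; rewrite in_itv/= => /andP[q1 q2]; exists q.
    by rewrite /ball/= ltr_distlC (lt_trans _ q1) ?q2// ltrBlDr ltrDl.
  have xq : ball (map_mx ratr (\row_i q i) : 'rV[R]_n) k.+1%:R^-1 x.
    split=> // i j; rewrite !mxE; apply: ball_sym.
    by rewrite (_ : i = ord0) ?ord1//; exact: Hq.
  exists (\row_i q i, k) => //= y yb; apply: xe.
  rewrite (splitr e).
  apply: ball_triangle (le_ball (ltW ke) (ball_sym xq)) _.
  exact: le_ball (ltW ke) _ yb.
rewrite bigcup_mkcond; apply: countable_bigcupT_measurable => [|p].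
  exact: countableP.
by case: ifPn => // _; exact: measurable_ball_rV.
Qed.

Lemma continuous_measurable_rV n (D : set 'rV[R]_n) (f : 'rV[R]_n -> R) :
  open D -> (forall x, D x -> {for x, continuous f}) -> measurable_fun D f.
Proof.
move=> oD cf; apply: (measurability _ (RGenOpens.measurableE R)).
move=> X [B [a [b Bab]] <-]; apply: open_measurable_rV.
rewrite openE => x [Dx Bx]; rewrite /interior.
apply: filterI; first exact: open_nbhs_nbhs.
have Bf : nbhs (f x) B by apply: open_nbhs_nbhs; split => //; rewrite Bab; exact: itv_open.
exact: (cf _ Dx).
Qed.

Lemma lebesgue_rVE n (A : set 'rV[R]_n.+1) :
  lebesgue_rV R n.+1 A = (@lebesgue_measure R \x lebesgue_rV R n)%E (@consrV R n @^-1` A).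
Proof. by []. Qed.

Lemma lebesgue_rV_ball n (c : 'rV[R]_n) r : 0 < r ->
  lebesgue_rV R n (ball c r) = ((2 * r) ^+ n)%:E.
Proof.
move=> r0; elim: n c => [|n IH] c.
  rewrite expr0 /= diracE mem_set// ball_rVE//= => -[]//.
rewrite lebesgue_rVE.
pose c' : 'rV[R]_n := \row_i c ord0 (rshift 1 i).
rewrite (_ : _ @^-1` _ = ball (c ord0 ord0) r `*` ball c' r).
  rewrite product_measure1E//; [|by apply: open_measurable; exact: ball_open|exact: measurable_ball_rV].
  transitivity ((r *+ 2)%:E * ((2 * r) ^+ n)%:E)%E.
    by congr (_ * _)%E; [exact: lebesgue_measure_ball (ltW r0)|exact: IH].
  by rewrite -EFinM exprS mulr_natl.
rewrite !ball_rVE//; apply/seteqP; split=> -[a v] /=; rewrite /consrV.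
- move=> h; split => [|i].
    have := h ord0; have -> : (ord0 : 'I_n.+1) = lshift n (ord0 : 'I_1) by exact: val_inj.
    by rewrite (@row_mxEl R 1 1 n) mxE eqxx mulr1n.
  by have := h (rshift 1 i); rewrite (@row_mxEr R 1 1 n) /c' mxE.
- move=> [ha hv] i; have [k ->|k ->] := @split_ordP 1 n i.
    rewrite (ord1 k) (@row_mxEl R 1 1 n) mxE eqxx mulr1n.
    by have <- : (ord0 : 'I_n.+1) = lshift n (ord0 : 'I_1) by exact: val_inj.
  by rewrite (@row_mxEr R 1 1 n); have := hv k; rewrite /c' mxE.
Qed.

Lemma lebesgue_measure_shift (a : R) (A : set R) : measurable A ->
  lebesgue_measure ((fun x => x + a) @^-1` A) = lebesgue_measure A.
Proof.
move=> mA.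
have mf : @measurable_fun _ _ (measurableTypeR R) (measurableTypeR R) setT
  (fun x : R => x + a) by exact: measurable_funD.
rewrite [RHS](@lebesgue_measure_unique R (pushm lebesgue_measure mf))//.
move=> _ [[x y] /= _ <-].
rewrite /pushforward/= (_ : _ @^-1` _ = `]x - a, y - a]%classic); last first.
  by apply/seteqP; split=> z /=; rewrite !in_itv/= ltrBlDr lerBrDr.
rewrite !lebesgue_measure_itv/= !lte_fin ltrD2r; case: ifPn => // _.
by rewrite !EFinN -!EFinD; congr EFin; rewrite opprB addrA subrK.
Qed.

Lemma measurable_shift_rV n (v : 'rV[R]_n) :
  measurable_fun setT (fun x : 'rV[R]_n => x + v).
Proof.
apply: measurable_fun_rVP => i; rewrite (_ : (fun _ => _) = fun x : 'rV[R]_n => x ord0 i + v ord0 i).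
  by apply: measurable_funD => //; exact: measurable_coord.
by apply/funext => x; rewrite mxE.
Qed.

(** By induction on the dimension: the shifted product measure agrees with the
    product measure on rectangles. *)
Lemma lebesgue_rV_shift n (v : 'rV[R]_n) (A : set 'rV[R]_n) : measurable A ->
  lebesgue_rV R n ((fun x => x + v) @^-1` A) = lebesgue_rV R n A.
Proof.
elim: n v A => [|n IH] v A mA.
  by rewrite (_ : _ @^-1` _ = A)//; apply/seteqP; split => x /=;
    have -> : x + v = x by apply/matrixP => i [].
rewrite !lebesgue_rVE.
pose v0 := v ord0 ord0; pose v' : 'rV[R]_n := \row_i v ord0 (rshift 1 i).
pose s (p : R * 'rV[R]_n) := (p.1 + v0, p.2 + v').
have ms : @measurable_fun _ _ (measurableTypeR R * 'rV[R]_n)%type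
  (measurableTypeR R * 'rV[R]_n)%type setT s.
  apply: measurable_fun_pair => /=.
    by apply: measurable_funD => //; exact: measurable_fst.
  apply: (@measurableT_comp _ _ _ _ _ _ (fun x : 'rV[R]_n => x + v')).
    exact: measurable_shift_rV.
  exact: measurable_snd.
rewrite (_ : _ @^-1` _ = s @^-1` (@consrV R n @^-1` A)); last first.
  have E (p : R * 'rV[R]_n) : consrV p + v = consrV (s p).
    case: p => a x; rewrite /consrV /s /=.
    apply/rowP => i; rewrite !mxE; case: split_ordP => k ->; rewrite !mxE //.
    by rewrite (ord1 k) !eqxx !mulr1n; congr (_ + v _ _); exact: val_inj.
  by apply/seteqP; split=> p /=; rewrite E.
rewrite [RHS](@product_measure_unique _ _ _ _ R (@lebesgue_measure R) (lebesgue_rV R n)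
  (pushm (lebesgue_measure \x lebesgue_rV R n)%E ms))//=.
  move=> B C mB mC; rewrite /pushforward /=.
  rewrite (_ : _ @^-1` _ = ((fun x => x + v0) @^-1` B) `*` ((fun x => x + v') @^-1` C)).
    rewrite product_measure1E ?IH//.
    - by congr (_ * _)%E; exact: lebesgue_measure_shift.
    - by rewrite -[X in measurable X]setTI; apply: measurable_funD.
    - by rewrite -[X in measurable X]setTI; exact: measurable_shift_rV.
  by [].
by rewrite -[X in measurable X]setTI; exact: measurable_consrV.
Qed.

Section shift.
Variables (n : nat) (v : 'rV[R]_n).
Local Notation mu := (@lebesgue_rV R n).

Lemma ge0_integral_rV_shift (f : 'rV[R]_n -> \bar R) :
  measurable_fun setT f -> (forall x, 0 <= f x)%E ->
  (\int[mu]_x f (x + v)%R = \int[mu]_x f x)%E.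
Proof.
move=> mf f0; have ms := measurable_shift_rV v.
have := @ge0_integral_pushforward _ _ _ _ R _ ms mu setT f measurableT mf (fun x _ => f0 x).
rewrite preimage_setT => <-.
by apply: (@eq_measure_integral _ _ _ _ mu (pushm mu ms)) => A mA _;
  exact: lebesgue_rV_shift.
Qed.

Lemma integrable_rV_shift (f : 'rV[R]_n -> \bar R) :
  mu.-integrable setT f -> mu.-integrable setT (fun x => f (x + v)).
Proof.
move=> /integrableP[mf intf]; apply/integrableP; split.
  by apply: (measurableT_comp mf); exact: measurable_shift_rV.
rewrite (ge0_integral_rV_shift (f := fun x => `|f x|%E))//.
exact: measurableT_comp.
Qed.

Lemma integral_rV_shift (f : 'rV[R]_n -> \bar R) :
  mu.-integrable setT f -> (\int[mu]_x f (x + v)%R = \int[mu]_x f x)%E.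
Proof.
move=> intf; have ms := measurable_shift_rV v.
have [mf _] := integrableP _ _ _ intf.
have := @integral_pushforward _ _ _ _ R _ ms mu setT f mf.
rewrite preimage_setT => /(_ (integrable_rV_shift intf) measurableT) <-.
by apply: (@eq_measure_integral _ _ _ _ mu (pushm mu ms)) => A mA _;
  exact: lebesgue_rV_shift.
Qed.

Lemma Rintegral_rV_shift (f : 'rV[R]_n -> R) :
  mu.-integrable setT (EFin \o f) -> \int[mu]_x f (x + v)%R = \int[mu]_x f x.
Proof. by move=> intf; rewrite /Rintegral (integral_rV_shift (f := EFin \o f)). Qed.

End shift.

End rV_measure.

(** * One-variable calculus and a smooth bump *)

Section calculus1.
Variable R : realType.
Implicit Types f g : R -> R.

Lemma is_derive1_continuous f df : (forall x : R, is_derive x 1 f (df x)) -> continuous f.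
Proof.
by move=> fd x; apply/differentiable_continuous/derivable1_diffP; have [] := fd x.
Qed.

Lemma MVT_any f df a b : (forall x : R, is_derive x 1 f (df x)) ->
  exists2 c, Num.min a b <= c <= Num.max a b & f b - f a = df c * (b - a).
Proof.
move=> fd; have cf := is_derive1_continuous fd.
wlog ab : a b / a <= b.
  move=> W; have [ab|/ltW ba] := leP a b; first by have := W _ _ ab; rewrite min_l ?max_r.
  have [c cab E] := W _ _ ba; exists c; first by rewrite minC maxC in cab; rewrite min_r ?max_l// in cab.
  by rewrite -opprB E -mulrN opprB.
have [c /[!in_itv]/= cab E] := MVT_segment ab (fun x _ => fd x) (continuous_subspaceT cf).
by exists c => //; rewrite min_l// max_r.
Qed.

(** Used at the origin for exp(-1/s), which is bounded by a multiple of s^2. *)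
Lemma is_derive1_quad0 f (x C : R) :
  (\forall z \near x, `|f z - f x| <= C * (z - x) ^+ 2) -> is_derive x 1 f 0.
Proof.
move=> H; apply/is_derive1_caratheodory.
exists (fun z => (f z - f x) / (z - x)); split.
- move=> z; have [->|zx] := eqVneq z x; first by rewrite !subrr mulr0.
  by rewrite divfK// subr_eq0.
- apply/cvgrPdist_lt => e e0 /=.
  rewrite subrr mul0r.
  have C0 : 0 < `|C| + 1 by rewrite ltr_pwDr.
  near=> z; rewrite sub0r normrN normrM normfV.
  have [->|zx] := eqVneq z x; first by rewrite subrr normr0 mul0r.
  rewrite ltr_pdivrMr ?normr_gt0 ?subr_eq0//.
  have h1 : `|f z - f x| <= C * (z - x) ^+ 2 by near: z.
  apply: le_lt_trans h1 _.
  rewrite -real_normK ?num_real// expr2 mulrA ltr_pM2r ?normr_gt0 ?subr_eq0//.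
  apply: (@le_lt_trans _ _ ((`|C| + 1) * `|z - x|)).
    rewrite ler_wpM2r// (le_trans (ler_norm _))// lerDl//.
  rewrite mulrC -ltr_pdivlMr// distrC; near: z.
  by apply: cvgr_dist_lt; [exact: cvg_id|exact: divr_gt0].
- by rewrite subrr mul0r.
Unshelve. all: by end_near. Qed.

Lemma is_derive1_glue f g (a d : R) : f a = g a -> is_derive a 1 f d ->
  is_derive a 1 g d -> is_derive a 1 (fun x => if x < a then f x else g x) d.
Proof.
move=> fg /is_derive1_caratheodory[f1 [f1E cf1 f1a]].
move=> /is_derive1_caratheodory[g1 [g1E cg1 g1a]].
apply/is_derive1_caratheodory; exists (fun x => if x < a then f1 x else g1 x); split.
- by move=> z; rewrite ltxx; case: ifPn => _; rewrite -?fg; [exact: f1E|rewrite fg; exact: g1E].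
- apply/cvgrPdist_lt => e e0 /=; rewrite ltxx.
  have N1 : \forall z \near a, `|f1 a - f1 z| < e by move/cvgrPdist_lt : cf1; apply.
  have N2 : \forall z \near a, `|g1 a - g1 z| < e by move/cvgrPdist_lt : cg1; apply.
  near=> z; case: ifPn => _.
    by rewrite g1a -f1a; near: z.
  by near: z.
- by rewrite ltxx.
Unshelve. all: by end_near. Qed.

(** Directional derivatives are ordinary derivatives along lines; all the
    partial derivatives below are computed this way. *)
Lemma is_derive_lineP (V : normedModType R) (f : V -> R) (x v : V) (df : R) :
  is_derive x v f df <-> is_derive (0 : R) 1 (fun h => f (h *: v + x)) df.
Proof.
have E : 'D_v f x = 'D_1 (fun h : R => f (h *: v + x)) 0.
  rewrite /derive; set g1 := fun h => h^-1 *: _; set g2 := fun h => h^-1 *: _.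
  suff -> : g1 = g2 by [].
  by apply/funext => h; rewrite /g1 /g2 /= addr0 scale0r add0r [_%:A]mulr1.
split=> -[fd <-].
  by rewrite E; apply: derivableP; exact: (derivable1P f x v).1.
by rewrite -E; apply: derivableP; exact: (derivable1P f x v).2.
Qed.

Lemma is_derive_comp1 (V : normedModType R) (q : V -> R) (g : R -> R) (x v : V) (dq dg : R) :
  is_derive x v q dq -> is_derive (q x) 1 g dg -> is_derive x v (g \o q) (dg * dq).
Proof.
move=> /is_derive_lineP qd gd; apply/is_derive_lineP.
apply: (@is_derive1_comp R g (fun h : R => q (h *: v + x))) => //.
by rewrite scale0r add0r.
Qed.

End calculus1.

Section bump.
Variable R : realType.

(** The functions s^(-k) exp(-1/s), extended by 0 to s <= 0, form a family that
    is closed under differentiation. *)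
Definition expk (k : nat) (s : R) : R := if 0 < s then s^-1 ^+ k * expR (- s^-1) else 0.

Lemma expk_ge0 k s : 0 <= expk k s.
Proof.
rewrite /expk; case: ifPn => // s0.
by rewrite mulr_ge0 ?expR_ge0// exprn_ge0// invr_ge0 ltW.
Qed.

(** Flatness at 0: from (u/(k+2))^(k+2) <= exp u with u = 1/s. *)
Lemma expk_le k s : expk k s <= k.+2%:R ^+ k.+2 * s ^+ 2.
Proof.
rewrite /expk; case: ifPn => s0; last by rewrite mulr_ge0 ?sqr_ge0// exprn_ge0.
set u := s^-1; have u0 : 0 < u by rewrite invr_gt0.
have h : (u / k.+2%:R) ^+ k.+2 <= expR u.
  have -> : expR u = expR (u / k.+2%:R) ^+ k.+2.
    by rewrite -expRM_natl mulrC divfK.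
  apply: lerXn2r; rewrite ?nnegrE ?expR_ge0 ?divr_ge0 ?(ltW u0)//.
  by rewrite (le_trans _ (expR_ge1Dx _))// lerDr.
rewrite expRN -lter_pdivlMr ?expR_gt0// ?invr_gt0 ?expR_gt0// invrK.
have -> : u ^+ k = u ^+ k.+2 * s ^+ 2.
  by rewrite -addn2 exprD -mulrA -exprMn mulVf ?gt_eqF// expr1n mulr1.
rewrite [leRHS]mulrAC ler_wpM2r ?sqr_ge0//.
by rewrite mulrC -ler_pdivrMr ?exprn_gt0// -expr_div_n.
Qed.

Lemma expkS k s : expk k s = s * expk k.+1 s.
Proof.
rewrite /expk; case: ifPn => s0; last by rewrite mulr0.
by rewrite exprS !mulrA mulfV ?gt_eqF// mul1r.
Qed.

Lemma is_derive_expk k (s : R) :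
  is_derive s 1 (expk k) (expk k.+2 s - k%:R * expk k.+1 s).
Proof.
have [s0|s0|s0] := ltgtP 0 s.
- apply: (@near_eq_is_derive _ _ _ (fun y : R => y^-1 ^+ k * expR (- y^-1))).
    near=> y; rewrite /expk ifT//; near: y; exact: lt_nbhsr.
  have dV : is_derive s 1 (fun y : R => y^-1) (- s^-1 ^+ 2).
    have -> : - s^-1 ^+ 2 = - s ^- 2 *: (1 : R) by rewrite [_ *: _]mulr1 exprVn.
    by apply: is_deriveV; rewrite gt_eqF.
  have dX : is_derive s 1 (fun y : R => y^-1 ^+ k) (k%:R * s^-1 ^+ k.-1 * - s^-1 ^+ 2).
    by have := is_deriveX k dV; rewrite exprfctE.
  have dE : is_derive s 1 (fun y : R => expR (- y^-1)) (expR (- s^-1) * s^-1 ^+ 2).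
    rewrite -[s^-1 ^+ 2]opprK.
    apply: (@is_derive1_comp _ expR (fun y : R => - y^-1)).
  apply: (is_derive_eq (is_deriveM dX dE)).
  rewrite /expk s0 /GRing.scale /=.
  set u := s^-1; set e := expR (- u); move: u e => u e.
  by case: k {dX} => [|k] /=; rewrite ?exprS; ring.
- apply: (@near_eq_is_derive _ _ _ (cst 0)).
    near=> y; rewrite /expk ifF//; apply/negbTE; rewrite -leNgt.
    rewrite ltW//; near: y; exact: lt_nbhsl.
  by rewrite /expk !ifF ?(lt_gtF s0)// mulr0 subr0; exact: is_derive_cst.
- rewrite -s0 /expk ltxx mulr0 subr0.
  apply: (@is_derive1_quad0 _ _ _ (k.+2%:R ^+ k.+2)).
  near=> z; rewrite /= ltxx !subr0 ger0_norm ?expk_le//; exact: expk_ge0.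
Unshelve. all: by end_near. Qed.

Variable m : R.
(** With m growing, exp(-1/(m (1 - x^2))) increases to the indicator function
    of ]-1, 1[; this makes bumps dense enough to detect boxes. *)
Definition bump_arg (x : R) : R := m * (1 - x ^+ 2).
Definition bump_arg_poly : {poly R} := m *: (1 - 'X ^+ 2).

(** The k-th derivative of the bump is a polynomial times expk (2k) of
    m (1 - x^2); this recursion for the polynomial is the product rule, with
    the identity s * expk (k+1) s = expk k s used to reach a common exponent. *)
Fixpoint bump_poly (k : nat) : {poly R} := if k is k'.+1 then
  (bump_poly k')^`() * bump_arg_poly ^+ 2
    - (2 * m) *: ('X * bump_poly k' * (1 - (2 * k')%:R *: bump_arg_poly)) else 1.

Definition bumpD k (x : R) : R := (bump_poly k).[x] * expk (2 * k) (bump_arg x).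

Lemma is_derive_bumpD k (x : R) : is_derive x 1 (bumpD k) (bumpD k.+1 x).
Proof.
have dp : is_derive x 1 (fun x => (bump_poly k).[x]) (bump_poly k)^`().[x] by exact: is_derive_poly.
have ds : is_derive x 1 bump_arg (- (2 * m * x)).
  have -> : bump_arg = horner bump_arg_poly by apply/funext => y; rewrite /bump_arg /bump_arg_poly !hornerE.
  apply: (is_derive_eq (is_derive_poly bump_arg_poly x)).
  rewrite /bump_arg_poly derivZ derivB derivXn -polyC1 derivC !hornerE/=.
  ring.
apply: (is_derive_eq (is_deriveM dp (is_derive1_comp (is_derive_expk (2 * k) (bump_arg x)) ds))); rewrite /bumpD /= /GRing.scale /=.
have -> : (bump_arg x) = bump_arg_poly.[x] by rewrite /bump_arg /bump_arg_poly !hornerE.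
rewrite !hornerE mulnS.
rewrite [expk (2 * k) _]expkS [expk (2 * k).+1 _]expkS.
have -> : (2 + 2 * k)%N = (2 * k).+2 by [].
rewrite /=; ring.
Qed.

Hypothesis m0 : 0 < m.

Lemma bumpD_out k x : 1 <= `|x| -> bumpD k x = 0.
Proof.
move=> x1; rewrite /bumpD /expk ifF ?mulr0//; apply/negbTE; rewrite -leNgt.
rewrite /bump_arg pmulr_rle0// subr_le0 -[x ^+ 2]real_normK ?num_real//.
by rewrite -[1](expr1n _ 2) lerXn2r ?nnegrE.
Qed.

Lemma bump_ge0 x : 0 <= bumpD 0 x.
Proof. by rewrite /bumpD /= hornerC mul1r expk_ge0. Qed.

Lemma bump_le1 x : bumpD 0 x <= 1.
Proof.
rewrite /bumpD /= hornerC mul1r /expk; case: ifPn => // h.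
by rewrite mul1r -[leRHS]expR0 ler_expR oppr_le0 invr_ge0 ltW.
Qed.

Lemma bump_gt0 x : `|x| < 1 -> 0 < bumpD 0 x.
Proof.
move=> x1; rewrite /bumpD /= hornerC mul1r /expk ifT ?mul1r ?expR_gt0//.
rewrite /bump_arg pmulr_rgt0// subr_gt0 -[x ^+ 2]real_normK ?num_real//.
by rewrite -[ltRHS](expr1n _ 2) ltrXn2r.
Qed.

Lemma bumpN x : bumpD 0 (- x) = bumpD 0 x.
Proof. by rewrite /bumpD /= !hornerC /bump_arg sqrrN. Qed.

Lemma bump1N x : bumpD 1 (- x) = - bumpD 1 x.
Proof.
rewrite /bumpD (_ : bump_poly 1 = - (2 * m) *: 'X); last first.
  by rewrite /= -polyC1 derivC muln0 scale0r subr0 polyC1 !mulr1 mul0r sub0r scaleNr.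
by rewrite /bump_arg sqrrN !hornerE; ring.
Qed.

End bump.

Lemma bump_cvg (R : realType) (x : R) :
  (fun m : nat => bumpD m.+1%:R 0 x) @ \oo --> (\1_(ball (0:R) 1) x : R).
Proof.
rewrite indicE; have [x1|x1] := ltP `|x| 1; last first.
  rewrite memNset ?ball_normE /=; last by rewrite /ball /= sub0r normrN; apply/negP; rewrite -leNgt.
  apply: cvg_near_cst; near=> m; rewrite bumpD_out//.
rewrite mem_set; last by rewrite /ball /= sub0r normrN.
have s0 : 0 < 1 - x ^+ 2.
  by rewrite subr_gt0 -[x ^+ 2]real_normK ?num_real// -[ltRHS](expr1n _ 2) ltrXn2r.
have -> : (fun m : nat => bumpD m.+1%:R 0 x) =
   expR \o (fun m : nat => - (m.+1%:R^-1 * (1 - x ^+ 2)^-1)).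
  apply/funext => m; rewrite /bumpD /= hornerC mul1r /expk ifT ?mul1r.
    by rewrite /bump_arg invfM.
  by rewrite /bump_arg pmulr_rgt0.
rewrite -[X in _ --> X](@expR0 R).
apply: continuous_cvg; first exact: continuous_expR.
rewrite -[X in _ --> X]oppr0; apply: cvgN.
rewrite -[X in _ --> X](mul0r (1 - x ^+ 2)^-1).
by apply: cvgMl; exact: cvg_harmonic.
Unshelve. all: by end_near. Qed.

(** * Compact supports and tensor products of bumps *)

Section compact_support.
Variables (R : realType) (n : nat).
Local Notation mu := (@lebesgue_rV R n).
Implicit Types (f : 'rV[R]_n -> R) (K : set 'rV[R]_n).

Lemma rV_hausdorff : hausdorff_space 'rV[R]_n.
Proof. exact: norm_hausdorff. Qed.

Lemma compact_measurable_rV K : compact K -> measurable K.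
Proof.
move=> /(compact_closed rV_hausdorff) /closed_openC/open_measurable_rV/measurableC.
by rewrite setCK.
Qed.

Lemma compact_sub_ball K : compact K -> exists2 r : R, 0 < r & K `<=` ball (0 : 'rV[R]_n) r.
Proof.
move=> /compact_bounded [M [_ HM]].
exists (`|M| + 2) => [|x Kx]; first by rewrite ltr_wpDl.
rewrite -ball_normE /= sub0r normrN.
apply: (@le_lt_trans _ _ (`|M| + 1)); last by rewrite ltrD2l ltrDr.
by apply: HM => //; rewrite ltr_pwDr// ler_norm.
Qed.

Lemma cs_bounded f K : compact K -> continuous f -> (forall x, ~ K x -> f x = 0) ->
  exists2 M, 0 <= M & forall x, `|f x| <= M.
Proof.
move=> cK cf f0; have [K0|/set0P K0] := eqVneq K set0.
  by exists 0 => // x; rewrite f0 ?normr0// K0.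
have [|x /[!inE] Kx H] := @compact_EVT_max _ R (fun x => `|f x|) K K0 cK.
  by apply: continuous_subspaceT => x; exact: (cvg_norm (cf x)).
exists `|f x| => // y; have [Ky|nKy] := pselect (K y); last by rewrite f0 ?normr0.
by apply: H; rewrite inE.
Qed.

Lemma lty_ball c r : (mu (ball c r) < +oo)%E.
Proof.
have [r0|r0] := ltP 0 r; first by rewrite lebesgue_rV_ball// ltry.
rewrite (_ : ball c r = set0) ?measure0//.
by apply/seteqP; split => // x [] /=; rewrite ltNge r0.
Qed.

Lemma lty_compact K : compact K -> (mu K < +oo)%E.
Proof.
move=> cK; have [r r0 Kr] := compact_sub_ball cK.
apply: le_lt_trans (lty_ball 0 r); apply: le_measure => //; rewrite inE.
  exact: compact_measurable_rV.
exact: measurable_ball_rV.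
Qed.

Lemma bs_integrable f (D : set 'rV[R]_n) M : measurable D -> (mu D < +oo)%E ->
  measurable_fun setT f -> (forall x, `|f x| <= M) -> (forall x, ~ D x -> f x = 0) ->
  mu.-integrable setT (EFin \o f).
Proof.
move=> mD finD mf fM f0.
have : mu.-integrable D (EFin \o f).
  apply: measurable_bounded_integrable => //; first exact: measurable_funTS.
  by exists M; split; [exact: num_real|move=> r Mr x _; exact: le_trans (fM x) (ltW Mr)].
rewrite integrable_mkcond//; apply: eq_integrable => // x _.
rewrite patchE; case: ifPn => //; rewrite notin_setE => /f0/= ->//.
Qed.

Lemma continuous_measurableT f : continuous f -> measurable_fun setT f.
Proof. by move=> cf; apply: continuous_measurable_rV => [|x _]; [exact: openT|exact: cf]. Qed.

Lemma cs_integrable f K : compact K -> continuous f -> (forall x, ~ K x -> f x = 0) ->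
  mu.-integrable setT (EFin \o f).
Proof.
move=> cK cf f0; have [M M0 fM] := cs_bounded cK cf f0.
apply: (@bs_integrable f K M) => //.
- exact: compact_measurable_rV.
- exact: lty_compact.
- exact: continuous_measurableT.
Qed.

(** Uniform continuity near K, where the second point may leave K: this is
    what convolution at scale d requires. *)
Lemma compact_unif (f : 'rV[R]_n -> R) K e : compact K ->
  (forall x, K x -> {for x, continuous f}) -> 0 < e ->
  exists2 d, 0 < d & forall x y, K x -> ball x d y -> `|f x - f y| <= e.
Proof.
move=> cK cf e0.
have /compact_near_coveringP/(_ _ (0:R)^'+ (fun d x => forall y, ball x d y -> `|f x - f y| <= e)) := cK.
have H x : K x -> \forall x' \near x & i \near (0:R)^'+, forall y, ball x' i y -> `|f x' - f y| <= e.
  move=> Kx; have /nbhs_ballP[r /= r0 Hr] : \forall y \near x, `|f x - f y| < e / 2.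
    have e20 : 0 < e / 2 by rewrite divr_gt0.
    by have /cvgrPdist_lt/(_ _ e20) := cf _ Kx.
  exists (ball x (r / 2), [set d | d < r / 2]) => /=.
    split; first by apply/nbhs_ballP; exists (r / 2) => //=; rewrite divr_gt0.
    by apply: nbhs_right_lt; rewrite divr_gt0.
  move=> [x' d] [/= xx' dr] y xy.
  rewrite (splitr e) -(subrKA (f x)) (le_trans (ler_normD _ _))// lerD//.
    rewrite distrC ltW//; apply: Hr; apply: le_ball xx'.
    by rewrite ler_pdivrMr// ler_pMr// ler1n.
  apply/ltW/Hr; rewrite (splitr r); apply: ball_triangle xx' _.
  exact: le_ball (ltW dr) _ xy.
move=> /(_ _ H); rewrite /= => K'.
have [d [/= d0 Hd]] := filter_ex (filterI (nbhs_right_gt (0:R)) K').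
by exists d => // x y Kx; exact: Hd.
Qed.

End compact_support.

Section tensor.
Variables (R : realType) (n : nat).
Local Notation mu := (@lebesgue_rV R n).

Definition cbox (c d : 'rV[R]_n) : set 'rV[R]_n :=
  [set y | forall j, `|y ord0 j - c ord0 j| <= d ord0 j].
Definition obox (c d : 'rV[R]_n) : set 'rV[R]_n :=
  [set y | forall j, `|y ord0 j - c ord0 j| < d ord0 j].

Lemma cbox_compact c d : compact (cbox c d).
Proof.
have -> : cbox c d = [set v : 'rV[R]_n | forall j, `[c ord0 j - d ord0 j, c ord0 j + d ord0 j]%classic (v ord0 j)].
  by apply/seteqP; split=> y /= h j; have := h j; rewrite in_itv/= ler_distl.
apply: (@rV_compact _ _ (fun j => `[c ord0 j - d ord0 j, c ord0 j + d ord0 j]%classic)).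
by move=> j; exact: segment_compact.
Qed.

(** Raises the order of differentiation in direction i by one. *)
Definition incr (i : 'I_n) (k : 'I_n -> nat) : 'I_n -> nat := fun j => (k j + (j == i))%N.

Variable m : R.
Variables (c d : 'rV[R]_n).

(** The mixed derivative of multi-index k of the tensor product bump on the box
    with centre c and half-widths d. *)
Definition etaD (k : 'I_n -> nat) (y : 'rV[R]_n) : R :=
  \prod_j ((d ord0 j)^-1 ^+ k j * bumpD m (k j) ((y ord0 j - c ord0 j) / d ord0 j)).

Let F j k (x : R) := (d ord0 j)^-1 ^+ k * bumpD m k ((x - c ord0 j) / d ord0 j).

Lemma is_derive_scaled_bump j k (x : R) : is_derive x 1 (F j k) (F j k.+1 x).
Proof.
have dl : is_derive x 1 (fun x => (x - c ord0 j) / d ord0 j) (d ord0 j)^-1.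
  have -> : (fun x => (x - c ord0 j) / d ord0 j) = horner ((d ord0 j)^-1 *: ('X - (c ord0 j)%:P)).
    by apply/funext => z; rewrite !hornerE mulrC.
  apply: (is_derive_eq (is_derive_poly _ _)).
  by rewrite derivZ derivB derivX derivC subr0 hornerZ -polyC1 hornerC mulr1.
have := is_deriveZ ((d ord0 j)^-1 ^+ k) (@is_derive1_comp _ (bumpD m k) (fun x => (x - c ord0 j) / d ord0 j) x _ _
  (is_derive_bumpD m k ((x - c ord0 j) / d ord0 j)) dl).
move=> H; apply: (is_derive_eq H); rewrite /F /GRing.scale/= exprSr; ring.
Qed.

Lemma is_derive_etaD i k y :
  is_derive y (delta_mx ord0 i) (etaD k) (etaD (incr i k) y).
Proof.
apply/is_derive_lineP.
pose C := \prod_(j | j != i) F j (k j) (y ord0 j).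
have -> : (fun h => etaD k (h *: delta_mx ord0 i + y)) = (fun h => C * F i (k i) (h + y ord0 i)).
  apply/funext => h; rewrite /etaD (bigD1 i)//= mulrC !mxE !eqxx mulr1; congr (_ * _).
  by apply: eq_bigr => j ji; rewrite !mxE (negbTE ji) mulr0 add0r.
have dl : is_derive (0:R) 1 (fun h : R => h + y ord0 i) 1.
  exact: is_derive_shift.
have H0 : is_derive ((fun h : R => h + y ord0 i) 0) 1 (F i (k i)) (F i (k i).+1 (y ord0 i)).
  by rewrite /= add0r; exact: is_derive_scaled_bump.
have := is_deriveZ C (@is_derive1_comp _ (F i (k i)) (fun h : R => h + y ord0 i) 0 _ _ H0 dl) => H; apply: (is_derive_eq H).
rewrite /GRing.scale /= mulr1 /etaD [RHS](bigD1 i)//= mulrC.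
rewrite /incr eqxx addn1; congr (_ * _).
by apply: eq_bigr => j ji; rewrite (negbTE ji) addn0.
Qed.

Lemma pderiv_etaD i k : pderiv i (etaD k) = etaD (incr i k).
Proof. by apply/funext => y; have [_] := is_derive_etaD i k y. Qed.

Lemma continuous_etaD k : continuous (etaD k).
Proof.
rewrite /etaD; have : forall s : seq 'I_n, continuous (fun y : 'rV[R]_n =>
   \prod_(j <- s) F j (k j) (y ord0 j)).
  elim=> [|j s IH] y.
    rewrite [X in continuous_at _ X](_ : _ = cst 1); first exact: cst_continuous.
    by apply/funext => z; rewrite big_nil.
  rewrite [X in continuous_at _ X](_ : _ = fun y : 'rV[R]_n => F j (k j) (y ord0 j) * \prod_(j <- s) F j (k j) (y ord0 j)); last first.
    by apply/funext => z; rewrite big_cons.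
  have cj : {for y, continuous (fun y : 'rV[R]_n => y ord0 j)} by exact: coord_continuous.
  have cF : continuous (F j (k j)) := is_derive1_continuous (is_derive_scaled_bump j (k j)).
  have c1 := continuous_comp cj (cF _).
  exact: (cvgM c1 (IH y)).
by apply.
Qed.

Lemma C1_etaD k : C1 (etaD k).
Proof.
split; first exact: continuous_etaD.
move=> i; split; last by rewrite pderiv_etaD; exact: continuous_etaD.
by move=> x; have [] := is_derive_etaD i k x.
Qed.

Lemma foldr_pderiv_etaD k s : foldr (@pderiv R n) (etaD k) s = etaD (foldr incr k s).
Proof. by elim: s => //= i s ->; rewrite pderiv_etaD. Qed.

Lemma smooth_etaD k : smooth (etaD k).
Proof. by move=> s; rewrite foldr_pderiv_etaD; exact: C1_etaD. Qed.

Hypothesis m0 : 0 < m.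
Hypothesis d0 : forall j, 0 < d ord0 j.

Lemma etaD_out k y : ~ obox c d y -> etaD k y = 0.
Proof.
move=> /existsNP[j /negP]; rewrite -leNgt => h.
rewrite /etaD (bigD1 j)//= bumpD_out ?mulr0 ?mul0r//.
by rewrite normrM normfV (gtr0_norm (d0 j)) ler_pdivlMr// mul1r.
Qed.

Lemma etaD_outc k y : ~ cbox c d y -> etaD k y = 0.
Proof. by move=> h; apply: etaD_out => h'; apply: h => j; exact/ltW/h'. Qed.

(** The derivatives of the tensor bump are again test functions, so they may be
    inserted in the definition of the weak derivative. *)
Lemma test_etaD D k : cbox c d `<=` D -> test_function D (etaD k).
Proof.
move=> bD; have S : closure [set x | etaD k x != 0] `<=` cbox c d.
  have /closure_id -> : closed (cbox c d).
    by apply: compact_closed; [exact: rV_hausdorff|exact: cbox_compact].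
  apply: closure_subset => y /= /eqP yn0; by apply: contrapT => /(etaD_outc k).
split; first exact: smooth_etaD.
- by apply: subclosed_compact S; [exact: closed_closure|exact: cbox_compact].
- exact: subset_trans bD.
Qed.

Lemma integrable_etaD k : mu.-integrable setT (EFin \o etaD k).
Proof.
apply: (@cs_integrable _ _ _ (cbox c d)); [exact: cbox_compact|exact: continuous_etaD|].
by move=> y; exact: etaD_outc.
Qed.

Lemma etaD_bounded k : exists2 M, 0 <= M & forall x, `|etaD k x| <= M.
Proof.
apply: (@cs_bounded _ _ _ (cbox c d)); [exact: cbox_compact|exact: continuous_etaD|].
by move=> y; exact: etaD_outc.
Qed.

Definition eta := etaD (fun=> 0%N).

Lemma eta_ge0 y : 0 <= eta y.
Proof. by apply: prodr_ge0 => j _; rewrite expr0 mul1r bump_ge0. Qed.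

Lemma eta_le1 y : eta y <= 1.
Proof.
apply: (@le_trans _ _ (\prod_(j < n) 1)); last by rewrite big1.
by apply: ler_prod => j _; rewrite expr0 mul1r bump_ge0 bump_le1.
Qed.

Lemma eta_gt0 y : obox c d y -> 0 < eta y.
Proof.
move=> h; apply: prodr_gt0 => j _; rewrite expr0 mul1r bump_gt0//.
by rewrite normrM normfV (gtr0_norm (d0 j)) ltr_pdivrMr// mul1r.
Qed.

End tensor.

Lemma eta_cvg (R : realType) n (c d y : 'rV[R]_n) : (forall j, 0 < d ord0 j) ->
  (fun m : nat => eta m.+1%:R c d y) @ \oo --> (\1_(obox c d) y : R).
Proof.
move=> d0; rewrite [X in _ --> X](_ : _ = \prod_(j < n) \1_(ball (0:R) 1) ((y ord0 j - c ord0 j) / d ord0 j)); last first.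
  have E j : ball (0:R) 1 ((y ord0 j - c ord0 j) / d ord0 j) = (`|y ord0 j - c ord0 j| < d ord0 j) :> Prop.
    by rewrite /ball/= sub0r normrN normrM normfV (gtr0_norm (d0 j)) ltr_pdivrMr// mul1r.
  rewrite indicE; have [h|/existsNP[j h]] := pselect (obox c d y).
    by rewrite mem_set// big1// => j _; rewrite indicE mem_set// E.
  rewrite memNset; last by move/(_ j).
  by rewrite (bigD1 j)//= indicE memNset ?mul0r// E.
rewrite /eta /etaD.
elim: (index_enum _) => [|j s IH].
  rewrite big_nil [X in X @ _](_ : _ = cst 1); first exact: cvg_cst.
  by apply/funext => k; rewrite big_nil.
rewrite big_cons [X in X @ _](_ : _ = fun k : nat => bumpD k.+1%:R 0 ((y ord0 j - c ord0 j) / d ord0 j) *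
  \prod_(j <- s) ((d ord0 j)^-1 ^+ 0 * bumpD k.+1%:R 0 ((y ord0 j - c ord0 j) / d ord0 j))); last first.
  by apply/funext => k; rewrite big_cons expr0 mul1r.
by apply: cvgM => //; exact: bump_cvg.
Qed.

(** * Integrals of real functions and the fundamental lemma *)

Section real_integral.
Context d (T : measurableType d) (R : realType) (mu : {measure set T -> \bar R}).
Implicit Types f g h : T -> R.

(** The lemmas on intg, and those whose names contain J for the integral,
    restate the integral calculus for real functions on the whole space. *)
Definition intg f := mu.-integrable setT (EFin \o f).

Lemma intg_measurable f : intg f -> measurable_fun setT f.
Proof. by move=> /integrableP[/measurable_EFinP]. Qed.

Lemma intgD f g : intg f -> intg g -> intg (fun x => f x + g x).
Proof. by move=> fi gi; exact: (integrableD measurableT fi gi). Qed.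

Lemma intgB f g : intg f -> intg g -> intg (fun x => f x - g x).
Proof. by move=> fi gi; exact: (integrableB measurableT fi gi). Qed.

Lemma intgZ k f : intg f -> intg (fun x => k * f x).
Proof. by move=> fi; exact: (integrableZl measurableT k fi). Qed.

Lemma intgN f : intg f -> intg (fun x => - f x).
Proof. by move=> fi; exact: (integrableN fi). Qed.

Lemma intg0 : intg (fun=> 0).
Proof. exact: integrable0. Qed.

Lemma eq_intg f g : f =1 g -> intg f -> intg g.
Proof. by move=> /funext ->. Qed.

Lemma intg_sum (I : Type) (s : seq I) (F : I -> T -> R) :
  (forall i, intg (F i)) -> intg (fun x => \sum_(i <- s) F i x).
Proof.
move=> Fi; elim: s => [|i s IH].
  by apply: eq_intg intg0 => x; rewrite big_nil.
by apply: eq_intg (intgD (Fi i) IH) => x; rewrite big_cons.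
Qed.

Lemma le_intg f g : measurable_fun setT f -> (forall x, `|f x| <= g x) -> intg g -> intg f.
Proof.
move=> mf fg gi; apply: (le_integrable measurableT _ _ gi).
  exact/measurable_EFinP.
by move=> x _ /=; rewrite lee_fin (le_trans (fg x))// ler_norm.
Qed.

Lemma intg_norm f : intg f -> intg (fun x => `|f x|).
Proof. by move=> fi; exact: integrable_norm fi. Qed.

Lemma intgMb f h M : intg f -> measurable_fun setT h -> (forall x, `|h x| <= M) ->
  intg (fun x => f x * h x).
Proof.
move=> fi mh hM; apply: (@le_intg _ (fun x => M * `|f x|)).
- by apply: measurable_funM => //; exact: intg_measurable.
- by move=> x; rewrite normrM mulrC ler_wpM2r.
- by apply: intgZ; exact: intg_norm.
Qed.

Lemma intg_restrict f (D : set T) : measurable D -> intg f -> intg (f \_ D).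
Proof.
move=> mD fi; have : mu.-integrable D (EFin \o f) by exact: integrableS fi.
by rewrite integrable_mkcond// restrict_EFin.
Qed.

Lemma JD f g : intg f -> intg g ->
  \int[mu]_x (f x + g x) = \int[mu]_x f x + \int[mu]_x g x.
Proof. by move=> fi gi; exact: RintegralD. Qed.

Lemma JB f g : intg f -> intg g ->
  \int[mu]_x (f x - g x) = \int[mu]_x f x - \int[mu]_x g x.
Proof. by move=> fi gi; exact: RintegralB. Qed.

Lemma JZ k f : intg f -> \int[mu]_x (k * f x) = k * \int[mu]_x f x.
Proof. by move=> fi; exact: RintegralZl. Qed.

Lemma JN f : intg f -> \int[mu]_x (- f x) = - \int[mu]_x f x.
Proof.
by move=> fi; rewrite -mulN1r -JZ//; apply: eq_Rintegral => x _; rewrite mulN1r.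
Qed.

Lemma eqJ f g : f =1 g -> \int[mu]_x f x = \int[mu]_x g x.
Proof. by move=> fg; apply: eq_Rintegral => x _. Qed.

Lemma J0 : \int[mu]_x (0 : R) = 0.
Proof. by rewrite /Rintegral integral0. Qed.

Lemma J_sum (I : Type) (s : seq I) (F : I -> T -> R) : (forall i, intg (F i)) ->
  \int[mu]_x (\sum_(i <- s) F i x) = \sum_(i <- s) \int[mu]_x F i x.
Proof.
move=> Fi; elim: s => [|i s IH].
  by rewrite big_nil -[RHS]J0; apply: eqJ => x; rewrite big_nil.
rewrite big_cons -IH -JD//; last exact: intg_sum.
by apply: eqJ => x; rewrite big_cons.
Qed.

Lemma le_J f g : intg f -> intg g -> (forall x, f x <= g x) ->
  \int[mu]_x f x <= \int[mu]_x g x.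
Proof. by move=> fi gi fg; exact: le_Rintegral. Qed.

Lemma le_normJ f : intg f -> `|\int[mu]_x f x| <= \int[mu]_x `|f x|.
Proof. by move=> fi; exact: le_normr_Rintegral. Qed.

Lemma J_ge0 f : (forall x, 0 <= f x) -> 0 <= \int[mu]_x f x.
Proof. by move=> f0; apply: Rintegral_ge0. Qed.

Lemma EFinJ f : intg f -> (\int[mu]_x (f x)%:E)%E = (\int[mu]_x f x)%:E.
Proof. by move=> fi; rewrite /Rintegral fineK//; exact: integrable_fin_num. Qed.

Lemma ae_intg f g : {ae mu, forall x, f x = g x} -> measurable_fun setT g -> intg f -> intg g.
Proof.
move=> fg mg fi; apply/integrableP; split; first exact/measurable_EFinP.
have /integrableP[mf] := fi; congr (_ < _)%E; apply: ae_eq_integral => //.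
- exact: measurableT_comp.
- by apply: measurableT_comp => //; exact/measurable_EFinP.
- by apply: filterS fg => x /= ->.
Qed.

Lemma ae_eqJ f g : {ae mu, forall x, f x = g x} -> measurable_fun setT f -> measurable_fun setT g ->
  \int[mu]_x f x = \int[mu]_x g x.
Proof.
move=> fg mf mg; congr fine; apply: ae_eq_integral => //; [exact/measurable_EFinP|exact/measurable_EFinP|].
by apply: filterS fg => x /= ->.
Qed.

(** Dominated convergence for real functions with pointwise everywhere limits. *)
Lemma dctJ (f_ : nat -> T -> R) f g : (forall n, measurable_fun setT (f_ n)) ->
  (forall x, f_ ^~ x @ \oo --> f x) -> (forall n x, `|f_ n x| <= g x) -> intg g ->
  intg f /\ (fun n => \int[mu]_x f_ n x) @ \oo --> \int[mu]_x f x.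
Proof.
move=> mf_ ff fg gi.
have mf : measurable_fun setT f by apply: (measurable_fun_cvg mf_) => x _; exact: ff.
have [] := @dominated_convergence _ _ _ mu setT measurableT (fun n => EFin \o f_ n)
   (EFin \o f) (EFin \o g).
- by move=> n; exact/measurable_EFinP.
- exact/measurable_EFinP.
- by apply: aeW => x _; apply: cvg_EFin; [exact: nearW|exact: ff].
- exact: gi.
- by apply: aeW => x n _ /=; rewrite lee_fin.
move=> fi _ H; split => //.
have E : \int[mu]_x f x = fine (\int[mu]_x (EFin \o f) x)%E by [].
rewrite E; apply: (@fine_cvg _ _ _ _ (fun n => \int[mu]_x (EFin \o f_ n) x)%E).
by rewrite fineK//; exact: integrable_fin_num.
Qed.

End real_integral.

Section fundamental_lemma.
Variables (R : realType) (n : nat).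
Local Notation mu := (@lebesgue_rV R n).
Implicit Types (f g : 'rV[R]_n -> R) (D K : set 'rV[R]_n).

Definition ibox (a b : 'rV[R]_n) : set 'rV[R]_n :=
  [set y | forall j, a ord0 j < y ord0 j < b ord0 j].

Lemma oboxE (c d : 'rV[R]_n) : obox c d = ibox (c - d) (c + d).
Proof. by apply/seteqP; split => y /= h j; have := h j; rewrite !mxE ltr_distl. Qed.

Lemma iboxE a b : ibox a b = obox (2^-1 *: (a + b)) (2^-1 *: (b - a)).
Proof.
rewrite oboxE; congr ibox; apply/rowP => j; rewrite !mxE; lra.
Qed.

Lemma obox_subset (c d : 'rV[R]_n) : obox c d `<=` cbox c d.
Proof. by move=> y h j; exact/ltW/h. Qed.

Lemma obox_measurable (c d : 'rV[R]_n) : measurable (obox c d).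
Proof.
rewrite (_ : obox c d = \bigcap_(j in [set: 'I_n])
    ((fun x : 'rV[R]_n => x ord0 j) @^-1` `]c ord0 j - d ord0 j, c ord0 j + d ord0 j[%classic)).
  apply: fin_bigcap_measurable => // i _.
  by rewrite -[X in measurable X]setTI; apply: measurable_coord.
apply/seteqP; split => x /= h i; first by move=> _; rewrite /= in_itv/= -ltr_distl; exact: h.
by have := h i Logic.I; rewrite /= in_itv/= -ltr_distl.
Qed.

Lemma cbox_measurable (c d : 'rV[R]_n) : measurable (cbox c d).
Proof. by apply: compact_measurable_rV; exact: cbox_compact. Qed.

Lemma coord_le_norm (v : 'rV[R]_n) j : `|v ord0 j| <= `|v|.
Proof.
by rewrite [leRHS]/Num.norm /= mx_normrE; apply/bigmax_geP; right; exists (ord0, j).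
Qed.

Lemma measurable_ibox_gen :
  (@measurable _ 'rV[R]_n) `<=` <<s [set X | exists a b, X = ibox a b] >>.
Proof.
set G := [set X | _].
apply: smallest_sub; first exact: smallest_sigma_algebra.
move=> X; rewrite -bigcup_seq/= => -[i _ [B mB <-]]; rewrite setTI.
suff : measurable `<=` [set B : set R | <<s G >> ((fun x : 'rV[R]_n => x ord0 i) @^-1` B)] by apply.
rewrite (_ : measurable = <<s @RGenOpens.G R >>); last exact: RGenOpens.measurableE.
apply: smallest_sub.
  have [s0 sC sU] := smallest_sigma_algebra setT G; split => [|A mA|F mF] /=.
  - by rewrite preimage_set0.
  - by have := sC _ mA; rewrite !setTD.
  - by rewrite preimage_bigcup; exact: sU.
move=> _ [x [y ->]] /=.
have -> : (fun v : 'rV[R]_n => v ord0 i) @^-1` `]x, y[%classic =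
  \bigcup_N ibox (\row_j (if j == i then x else - N%:R)) (\row_j (if j == i then y else N%:R)).
  apply/seteqP; split => [v /=|v [N _]/=].
    rewrite in_itv/= => vxy.
    exists (Num.trunc `|v|).+1 => // j; rewrite !mxE; case: eqVneq => [-> //|_].
    rewrite -ltr_norml; apply: (@le_lt_trans _ _ `|v|).
      exact: coord_le_norm.
    by rewrite truncnS_gt.
  by move=> /(_ i); rewrite !mxE eqxx in_itv.
have [s0 sC sU] := smallest_sigma_algebra setT G.
by apply: sU => N; apply: sub_sigma_algebra; eexists; eexists.
Qed.

(** Open boxes form a pi-system generating the Borel sets, and the sets on
    which the integral vanishes form a lambda-system. *)
Lemma int_ibox_ae0 h : intg mu h -> (forall a b, \int[mu]_(x in ibox a b) h x = 0) ->
  \int[mu]_x h x = 0 ->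
  {ae mu, forall x, h x = 0}.
Proof.
move=> hi hb hT.
pose G := [set X | exists a b, X = ibox a b].
pose H := [set X | measurable X /\ \int[mu]_(x in X) h x = 0].
have mib a b : measurable (ibox a b) by rewrite iboxE; exact: obox_measurable.
have GH : G `<=` H by move=> _ [a [b ->]]; split => //; exact: hb.
have hiX X : measurable X -> mu.-integrable X (EFin \o h).
  by move=> mX; apply: integrableS hi.
have lH : lambda_system setT H.
  split => //.
  - move=> A B BA [mA A0] [mB B0]; split; first exact: measurableD.
    have := @Rintegral_setU _ _ _ mu (A `\` B) B h (measurableD mA mB) mB.
    rewrite [in X in X -> _]setUC setDUK// A0 B0 addr0 => /(_ (hiX _ mA)) <- //.
    by apply/disj_setPS => x [[]].
  - move=> F ndF HF; have mF k : measurable (F k) by have [] := HF k.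
    have mU : measurable (\bigcup_k F k) by exact: bigcupT_measurable.
    split => //.
    have C1 x : (fun k => (h \_ (F k)) x) @ \oo --> (h \_ (\bigcup_k F k)) x.
      rewrite patchE; case: ifPn => [|xU].
        rewrite inE => -[k _ Fkx]; apply: cvg_near_cst; near=> l.
        rewrite patchE ifT// inE; move: Fkx; apply/subsetPset/ndF.
        by near: l; exists k.
      apply: cvg_near_cst; near=> l; rewrite patchE ifF//; apply: contraNF xU.
      by rewrite !inE => Fx; exists l.
    have C2 k x : `|(h \_ (F k)) x| <= `|h x|.
      by rewrite patchE; case: ifPn => // _; rewrite normr0.
    have [_ C] := dctJ (fun k => intg_measurable (intg_restrict (mF k) hi)) C1 C2 (intg_norm hi).
    rewrite Rintegral_mkcond.
    apply: (@cvg_unique _ (@norm_hausdorff _ _) ((fun k => \int[mu]_x (h \_ (F k)) x) @ \oo)) => //.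
    apply: cvg_near_cst; near=> k; rewrite -Rintegral_mkcond; by have [] := HF k.
have sub : <<s G >> `<=` H.
  apply: (@lambda_system_subset _ G _ setT H lH GH).
    move=> _ _ [a [b ->]] [a' [b' ->]].
    exists (\row_j Num.max (a ord0 j) (a' ord0 j)), (\row_j Num.min (b ord0 j) (b' ord0 j)).
    apply/seteqP; split => y /=.
      by move=> [h1 h2] j; have := h1 j; have := h2 j; rewrite !mxE gt_max lt_min => /andP[-> ->] /andP[-> ->].
    by move=> h1; split => j; have := h1 j; rewrite !mxE gt_max lt_min => /andP[/andP[h2 h3] /andP[h4 h5]]; apply/andP; split.
  by [].
have : ae_eq mu setT (EFin \o h) (cst 0)%E.
  apply: integral_ae_eq => // E _ mE.
  rewrite integral0; have [_] := sub _ (measurable_ibox_gen mE).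
  by rewrite /Rintegral => h0; rewrite -[LHS]fineK ?h0//; apply: integrable_fin_num => //; exact: hiX.
by apply: filterS => x /(_ Logic.I) /= [].
Unshelve. all: by end_near. Qed.

(** A countable family of boxes that covers every open set from inside. *)
Definition rat_box (p : 'rV[rat]_n * nat) : 'rV[R]_n * 'rV[R]_n :=
  (map_mx ratr p.1, const_mx p.2.+1%:R^-1).

Lemma rat_box_gt0 p j : 0 < (rat_box p).2 ord0 j.
Proof. by rewrite mxE invr_gt0. Qed.

Lemma open_bigcup_box D : open D -> forall x, D x ->
  exists p : 'rV[rat]_n * nat, cbox (rat_box p).1 (rat_box p).2 `<=` D /\ obox (rat_box p).1 (rat_box p).2 x.
Proof.
move=> oD x Dx.
have /nbhs_ballP[e /= e0 xe] : nbhs x D by exact: open_nbhs_nbhs.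
have [k ke] : exists k : nat, (k.+1%:R^-1 : R) < e / 2.
  have e20 : (0 : R) < e / 2 by rewrite divr_gt0.
  by have [k] := ltr_add_invr e20; rewrite add0r; exists k.
have /choice[q Hq] : forall i, exists q : rat, ball (x ord0 i) (k.+1%:R^-1) (ratr q : R).
  move=> i.
  have : x ord0 i < x ord0 i + k.+1%:R^-1 by rewrite ltrDl.
  move=> /rat_in_itvoo[q]; rewrite in_itv/= => /andP[q1 q2]; exists q.
  by rewrite /ball/= ltr_distlC (lt_trans _ q1) ?q2// ltrBlDr ltrDl.
exists (\row_i q i, k); split => [y yb|j]; last first.
  by rewrite /= !mxE; exact: Hq.
apply: xe; rewrite ball_rVE// => i; rewrite /ball /=.
rewrite (splitr e) -(subrKA (ratr (q i))) (le_lt_trans (ler_normD _ _))// ltrD//.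
  by apply: lt_trans ke; exact: Hq.
rewrite distrC; apply: le_lt_trans ke.
by have := yb i; rewrite /= !mxE.
Qed.

(** The bumps on a box increase to its indicator function, so the integral of g
    over every small box vanishes; countably many boxes cover D. *)
Lemma fund_lemma D g : open D -> L1loc D g ->
  (forall (c d : 'rV[R]_n) (m : R), 0 < m -> (forall j, 0 < d ord0 j) -> cbox c d `<=` D ->
    \int[mu]_x (g x * eta m c d x) = 0) ->
  {ae mu, forall x, D x -> g x = 0}.
Proof.
move=> oD [mg gK] H.
have A (c d : 'rV[R]_n) : (forall j, 0 < d ord0 j) -> cbox c d `<=` D -> \int[mu]_(x in obox c d) g x = 0.
  move=> d0 cD.
  have gi : intg mu (g \_ (cbox c d)).
    have := gK _ (cbox_compact (c := c) (d := d)) cD.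
    by rewrite integrable_mkcond ?restrict_EFin//; exact: cbox_measurable.
  have gE : g \_ (obox c d) = fun x => (g \_ (cbox c d)) x * \1_(obox c d) x.
    apply/funext => x; rewrite !patchE indicE.
    case: ifPn => [xo|_]; last by rewrite mulr0.
    by rewrite ifT ?mulr1// inE; apply: obox_subset; rewrite -inE.
  rewrite Rintegral_mkcond gE.
  have C0 m : measurable_fun setT (fun x => (g \_ (cbox c d)) x * eta m.+1%:R c d x).
    apply: measurable_funM; first exact: intg_measurable gi.
    by apply: continuous_measurableT; exact: continuous_etaD.
  have C1 x : (fun m => (g \_ (cbox c d)) x * eta m.+1%:R c d x) @ \oo -->
      (g \_ (cbox c d)) x * \1_(obox c d) x.
    by apply: cvgMr; exact: eta_cvg.
  have C2 (m : nat) x : `|(g \_ (cbox c d)) x * eta m.+1%:R c d x| <= `|(g \_ (cbox c d)) x|.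
    by rewrite normrM ler_piMr// ger0_norm ?eta_ge0 ?eta_le1.
  have [_ C] := dctJ C0 C1 C2 (intg_norm gi).
  apply: (@cvg_unique _ (@norm_hausdorff _ _) ((fun m => \int[mu]_x ((g \_ (cbox c d)) x * eta m.+1%:R c d x)) @ \oo)) => //.
  apply: cvg_near_cst; near=> m.
  rewrite -[RHS](H c d m.+1%:R)//; apply: eqJ => x.
  rewrite patchE; case: ifPn => //; rewrite notin_setE => xn.
  by rewrite /eta etaD_outc ?mulr0.
have B (c d : 'rV[R]_n) : (forall j, 0 < d ord0 j) -> cbox c d `<=` D ->
    {ae mu, forall x, obox c d x -> g x = 0}.
  move=> d0 cD.
  have gi : intg mu (g \_ (obox c d)).
    have := gK _ (cbox_compact (c := c) (d := d)) cD.
    move=> /(integrableS (cbox_measurable c d) (obox_measurable c d) (@obox_subset c d)).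
    by rewrite integrable_mkcond ?restrict_EFin//; exact: obox_measurable.
  have : {ae mu, forall x, (g \_ (obox c d)) x = 0}.
    apply: int_ibox_ae0 => //; last by rewrite -Rintegral_mkcond A.
    move=> a b; rewrite -Rintegral_mkcondr.
    pose a' := \row_j Num.max (a ord0 j) ((c - d) ord0 j).
    pose b' := \row_j Num.min (b ord0 j) ((c + d) ord0 j).
    have -> : ibox a b `&` obox c d = ibox a' b'.
      rewrite oboxE; apply/seteqP; split => y /=.
        by move=> [h1 h2] j; have := h1 j; have := h2 j; rewrite !mxE gt_max lt_min => /andP[-> ->] /andP[-> ->].
      by move=> h1; split => j; have := h1 j; rewrite !mxE gt_max lt_min => /andP[/andP[h2 h3] /andP[h4 h5]]; apply/andP; split.
    have [ab|/existsNP[j /negP]] := pselect (forall j, a' ord0 j < b' ord0 j); last first.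
      rewrite -leNgt => ba.
      rewrite (_ : ibox a' b' = set0) ?Rintegral_set0//.
      apply/seteqP; split => // y /(_ j) /andP[h1 h2].
      by have := lt_trans h1 h2; rewrite ltNge ba.
    rewrite iboxE A//.
      by move=> j; rewrite !mxE; have := ab j; rewrite !mxE; lra.
    move=> y hy; apply: cD => j; have := hy j.
    rewrite !mxE !ler_distl => /andP[h1 h2].
    have m1 : a' ord0 j <= y ord0 j by move: h1; rewrite /a' /b' !mxE; lra.
    have m2 : y ord0 j <= b' ord0 j by move: h2; rewrite /a' /b' !mxE; lra.
    by move: m1 m2; rewrite !mxE ge_max le_min => /andP[_ ->] /andP[_ ->].
  by apply: filterS => x + xo; rewrite patchE ifT// inE.
have : {ae mu, forall x k, D x -> forall p : 'rV[rat]_n * nat, unpickle k = Some p ->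
    cbox (rat_box p).1 (rat_box p).2 `<=` D -> obox (rat_box p).1 (rat_box p).2 x -> g x = 0}.
  apply: ae_foralln => k; case E : (unpickle k) => [p|]; last exact: aeW.
  have [pD|pD] := pselect (cbox (rat_box p).1 (rat_box p).2 `<=` D).
    by apply: filterS (B _ _ (rat_box_gt0 p) pD) => x h _ q [<-] _.
  by apply: aeW => x _ q [<-].
apply: filterS => x h Dx; have [p [h1 h2]] := open_bigcup_box oD Dx.
by apply: (h (pickle p) Dx p) => //; exact: pickleK.
Unshelve. all: by end_near. Qed.

End fundamental_lemma.

(** * Weak derivatives *)

Section weak.
Variables (R : realType) (n : nat).
Local Notation mu := (@lebesgue_rV R n).
Local Notation e_ i := (delta_mx ord0 i : 'rV[R]_n).
Implicit Types (f g phi : 'rV[R]_n -> R) (D K : set 'rV[R]_n) (i : 'I_n).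

Lemma is_derive_pderiv i f x df : is_derive x (e_ i) f df -> pderiv i f x = df.
Proof. by case. Qed.

Lemma pderiv_out_is K f i x : closed K -> (forall x, ~ K x -> f x = 0) -> ~ K x ->
  is_derive x (e_ i) f 0.
Proof.
move=> clK f0 Kx; apply: (@near_eq_is_derive _ _ _ (cst (0:R)) f x (e_ i) 0).
have : nbhs x (~` K) by apply: open_nbhs_nbhs; split => //; exact: closed_openC.
by apply: filterS => y /f0 ->.
Qed.

Lemma pderiv_out K f i x : closed K -> (forall x, ~ K x -> f x = 0) -> ~ K x ->
  pderiv i f x = 0.
Proof. by move=> clK f0 Kx; apply: is_derive_pderiv; exact: pderiv_out_is Kx. Qed.

Lemma compact_closed_rV K : compact K -> closed K.
Proof. exact: compact_closed (@rV_hausdorff R n). Qed.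

Lemma is_derive_line f i x : (forall x, derivable f x (e_ i)) ->
  forall h : R, is_derive h 1 (fun h => f (h *: e_ i + x)) (pderiv i f (h *: e_ i + x)).
Proof.
move=> df h; have := derivableP (df (h *: e_ i + x)).
move=> /is_derive_lineP H; apply/is_derive_lineP.
rewrite [X in is_derive _ _ X _](_ : _ = fun h0 : R => f (h0 *: e_ i + (h *: e_ i + x)))//.
by apply/funext => h0; rewrite scalerDl -addrA [_%:A]mulr1.
Qed.

(** By translation invariance the difference quotients have integral 0, and
    they converge boundedly to the derivative. This replaces Fubini and the
    fundamental theorem of calculus. *)
Lemma int_pderiv0 f i K : compact K -> continuous f -> (forall x, derivable f x (e_ i)) ->
  continuous (pderiv i f) -> (forall x, ~ K x -> f x = 0) ->
  \int[mu]_x pderiv i f x = 0.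
Proof.
move=> cK cf df cdf f0.
have [r r0 Kr] := compact_sub_ball cK.
have [M M0 fM] := cs_bounded cK cdf (fun x => @pderiv_out K f i x (compact_closed_rV cK) f0).
have fi : intg mu f := cs_integrable cK cf f0.
pose h k : R := k.+1%:R^-1.
have h0 k : 0 < h k by rewrite invr_gt0.
have h1 k : h k <= 1 by rewrite invf_le1// ler1n.
pose B : set 'rV[R]_n := ball (0 : 'rV[R]_n) (r + 1).
(* difference quotients with step h k, all supported in the ball B *)
pose q k x := (h k)^-1 * (f (x + h k *: e_ i) - f x).
have fsi k : intg mu (fun x => f (x + h k *: e_ i)) by exact: (@integrable_rV_shift R n (h k *: e_ i) (EFin \o f) fi).
have qi k : intg mu (q k) by apply: intgZ; exact: intgB.
have q0 k : \int[mu]_x q k x = 0.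
  by rewrite JZ ?JB//; [rewrite (@Rintegral_rV_shift R n _ f)// subrr mulr0|exact: intgB].
have ne : `|e_ i| <= 1.
  rewrite [leLHS]/Num.norm /= mx_normrE; apply/bigmax_leP; split => // -[a b] _ /=.
  by rewrite mxE ord1 eqxx /=; case: eqP; rewrite ?normr1 ?normr0.
have qM k x : `|q k x| <= M * \1_B x.
  rewrite indicE; have [xr|xr] := pselect (B x).
    rewrite mem_set// mulr1.
    have [c _] := MVT_any 0 (h k) (@is_derive_line f i x df).
    rewrite scale0r add0r subr0 /q [x + _]addrC => ->.
    by rewrite mulrC mulfK ?gt_eqF.
  rewrite memNset// mulr0.
  have xn (y : 'rV[R]_n) : `|y| <= 1 -> ~ K (x + y).
    move=> y1 /Kr xy; apply: xr; rewrite /B.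
    move: xy; rewrite -!ball_normE /= !sub0r !normrN => xy.
    rewrite -(addrK y x) (le_lt_trans (ler_normB _ _))// ltr_leD//.
  rewrite /q f0; last first.
    by apply: xn; rewrite normrZ gtr0_norm// mulr_ile1// ltW.
  have := xn 0; rewrite normr0 addr0 => /(_ ler01)/f0 ->.
  by rewrite subrr !mulr0 normr0.
have qc x : q ^~ x @ \oo --> pderiv i f x.
  have := df x; rewrite /derivable /pderiv /derive.
  set g := (X in cvg (X @ _)) => cg.
  have hc : h @ \oo --> (0:R)^'.
    have c0 : h @ \oo --> (0:R) := cvg_harmonic.
    move=> A HA; have := c0 _ HA; rewrite /= /nbhs /=.
    by apply: filterS => k /=; apply; rewrite gt_eqF.
  rewrite [X in X @ _](_ : _ = g \o h); first exact: cvg_comp hc cg.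
  by apply/funext => k; rewrite /q /g /= [_ + x]addrC.
have gi : intg mu (fun x => M * \1_B x).
  have mB : measurable B by exact: measurable_ball_rV.
  apply: intgZ; apply: (@bs_integrable _ _ _ B 1) => //; first exact: lty_ball.
    by move=> y; rewrite indicE; case: (_ \in _); rewrite ?normr1 ?normr0.
  by move=> y yB; rewrite indicE memNset.
have [_ C] := dctJ (fun k => intg_measurable (qi k)) qc qM gi.
apply: (@cvg_unique _ (@norm_hausdorff _ _) ((fun k => \int[mu]_x q k x) @ \oo)) => //.
by apply: cvg_near_cst; apply: nearW => k; rewrite q0.
Qed.

Lemma C1M_is f g i x : C1 f -> C1 g ->
  is_derive x (e_ i) (fun x => f x * g x) (f x * pderiv i g x + g x * pderiv i f x).
Proof.
move=> [_ /(_ i)[df _]] [_ /(_ i)[dg _]].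
exact: (is_deriveM (derivableP (df x)) (derivableP (dg x))).
Qed.

Lemma C1M f g : C1 f -> C1 g -> C1 (fun x => f x * g x).
Proof.
move=> cf cg; have [kf df] := cf; have [kg dg] := cg; split.
  by move=> x; exact: (cvgM (kf x) (kg x)).
move=> i; split => [x|]; first by have [] := C1M_is i x cf cg.
rewrite (_ : pderiv i _ = fun x => f x * pderiv i g x + g x * pderiv i f x).
  move=> x; apply: (cvgD (cvgM (kf x) _) (cvgM (kg x) _)).
    exact: (dg i).2.
  exact: (df i).2.
by apply/funext => x; apply: is_derive_pderiv; exact: C1M_is.
Qed.

Lemma test_C1 D phi : test_function D phi -> C1 phi.
Proof. by move=> [/(_ [::])]. Qed.

Lemma test_supp D phi : test_function D phi ->
  exists K, [/\ compact K, K `<=` D, (forall x, ~ K x -> phi x = 0) &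
     forall i x, ~ K x -> pderiv i phi x = 0].
Proof.
move=> [_ cK KD]; exists (closure [set x | phi x != 0]).
have p0 x : ~ closure [set x | phi x != 0] x -> phi x = 0.
  move=> nx; apply: contrapT => /eqP px; apply: nx; exact: subset_closure.
split => // i x; apply: pderiv_out p0; exact: closed_closure.
Qed.

Lemma L1loc_mul D f z K : L1loc D f -> compact K -> K `<=` D -> continuous z ->
  (forall x, ~ K x -> z x = 0) -> intg mu (fun x => f x * z x).
Proof.
move=> [mf fK] cK KD cz z0; have [M M0 zM] := cs_bounded cK cz z0.
have fi : intg mu (f \_ K).
  have := fK _ cK KD.
  by rewrite integrable_mkcond ?restrict_EFin//; exact: compact_measurable_rV.
apply: (@eq_intg _ _ _ _ (fun x => (f \_ K) x * z x)).
  move=> x; rewrite patchE; case: ifPn => //; rewrite notin_setE => /z0 ->.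
  by rewrite !mulr0.
by apply: intgMb zM => //; exact: continuous_measurableT.
Qed.

Lemma int_D_T D (u : 'rV[R]_n -> R) : (forall x, ~ D x -> u x = 0) ->
  (\int[mu]_(x in D) (u x)%:E = \int[mu]_x (u x)%:E)%E.
Proof.
move=> u0; rewrite integral_mkcond; apply: eq_integral => x _.
by rewrite patchE; case: ifPn => //; rewrite notin_setE => /u0 ->.
Qed.

(** The definition of a weak derivative read as an identity between real
    integrals over the whole space. *)
Lemma weakR D i f g phi : is_weak_pderiv D i f g -> test_function D phi ->
  [/\ intg mu (fun x => f x * pderiv i phi x), intg mu (fun x => g x * phi x) &
  \int[mu]_x (f x * pderiv i phi x) = - \int[mu]_x (g x * phi x)].
Proof.
move=> [lf lg H] tp; have [K [cK KD p0 dp0]] := test_supp tp.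
have [cp cdp] := test_C1 tp.
have fi := L1loc_mul lf cK KD (cdp i).2 (dp0 i).
have gi := L1loc_mul lg cK KD cp p0.
split => //; have := H _ tp.
rewrite (@int_D_T D (fun x => f x * pderiv i phi x)); last first.
  by move=> x nx; rewrite dp0 ?mulr0//; move/KD.
rewrite (@int_D_T D (fun x => g x * phi x)); last first.
  by move=> x nx; rewrite p0 ?mulr0//; move/KD.
by rewrite (EFinJ fi) (EFinJ gi) -EFinN => -[].
Qed.

Lemma weakI D i f g : L1loc D f -> L1loc D g ->
  (forall phi, test_function D phi ->
  \int[mu]_x (f x * pderiv i phi x) = - \int[mu]_x (g x * phi x)) ->
  is_weak_pderiv D i f g.
Proof.
move=> lf lg H; split => // phi tp; have [K [cK KD p0 dp0]] := test_supp tp.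
have [cp cdp] := test_C1 tp.
have fi := L1loc_mul lf cK KD (cdp i).2 (dp0 i).
have gi := L1loc_mul lg cK KD cp p0.
rewrite (@int_D_T D (fun x => f x * pderiv i phi x)); last first.
  by move=> x nx; rewrite dp0 ?mulr0//; move/KD.
rewrite (@int_D_T D (fun x => g x * phi x)); last first.
  by move=> x nx; rewrite p0 ?mulr0//; move/KD.
by rewrite (EFinJ fi) (EFinJ gi) H.
Qed.

Lemma L1locD D f g : L1loc D f -> L1loc D g -> L1loc D (fun x => f x + g x).
Proof.
move=> [mf fK] [mg gK]; split; first exact: measurable_funD.
move=> K cK KD; have mK := compact_measurable_rV cK.
exact: (integrableD mK (fK _ cK KD) (gK _ cK KD)).
Qed.

Lemma L1locZ D k f : L1loc D f -> L1loc D (fun x => k * f x).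
Proof.
move=> [mf fK]; split; first exact: measurable_funM.
move=> K cK KD; have mK := compact_measurable_rV cK.
exact: (integrableZl mK k (fK _ cK KD)).
Qed.

Lemma L1loc_continuous D f : open D -> (forall x, D x -> {for x, continuous f}) -> L1loc D f.
Proof.
move=> oD cf; split; first exact: continuous_measurable_rV.
move=> K cK KD; have mK := compact_measurable_rV cK.
apply: measurable_bounded_integrable => //.
- exact: lty_compact.
- by apply: measurable_funS (continuous_measurable_rV oD cf) => //; exact: open_measurable_rV.
- have : compact (f @` K).
    apply: continuous_compact => //; apply: continuous_in_subspaceT => x /[!inE] Kx.
    exact/cf/KD.
  move=> /compact_bounded [M [Mr HM]]; exists M; split => // z Mz x Kx.
  by apply: (HM z Mz); exists x.
Qed.

Lemma L1loc_sub D D' f : D' `<=` D -> measurable D' -> measurable D -> L1loc D f -> L1loc D' f.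
Proof.
move=> DD mD' mD [mf fK]; split; first exact: measurable_funS mf.
by move=> K cK KD; apply: fK => //; exact: subset_trans DD.
Qed.

Lemma test_sub D D' phi : D' `<=` D -> test_function D' phi -> test_function D phi.
Proof. by move=> DD [s c h]; split => //; exact: subset_trans DD. Qed.

Lemma weak_sub D D' i f g : D' `<=` D -> open D' -> open D -> is_weak_pderiv D i f g ->
  is_weak_pderiv D' i f g.
Proof.
move=> DD oD' oD wk; have [lf lg _] := wk; apply: weakI.
- by apply: L1loc_sub lf => //; exact: open_measurable_rV.
- by apply: L1loc_sub lg => //; exact: open_measurable_rV.
- by move=> phi tp; have [] := weakR wk (test_sub DD tp).
Qed.

Lemma weakD D i f g f' g' : is_weak_pderiv D i f g -> is_weak_pderiv D i f' g' ->
  is_weak_pderiv D i (fun x => f x + f' x) (fun x => g x + g' x).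
Proof.
move=> wk wk'; have [lf lg _] := wk; have [lf' lg' _] := wk'; apply: weakI; [exact: L1locD|exact: L1locD|].
move=> phi tp; have [i1 i2 E] := weakR wk tp; have [i1' i2' E'] := weakR wk' tp.
rewrite (@eqJ _ _ _ mu _ (fun x => f x * pderiv i phi x + f' x * pderiv i phi x)); last by move=> x; rewrite mulrDl.
rewrite [in RHS](@eqJ _ _ _ mu _ (fun x => g x * phi x + g' x * phi x)); last by move=> x; rewrite mulrDl.
by rewrite !JD// E E' opprD.
Qed.

Lemma weakZ D i k f g : is_weak_pderiv D i f g ->
  is_weak_pderiv D i (fun x => k * f x) (fun x => k * g x).
Proof.
move=> wk; have [lf lg _] := wk; apply: weakI; [exact: L1locZ|exact: L1locZ|].
move=> phi tp; have [i1 i2 E] := weakR wk tp.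
rewrite (@eqJ _ _ _ mu _ (fun x => k * (f x * pderiv i phi x))); last by move=> x; rewrite mulrA.
rewrite [in RHS](@eqJ _ _ _ mu _ (fun x => k * (g x * phi x))); last by move=> x; rewrite mulrA.
by rewrite !JZ// E mulrN.
Qed.

Lemma weakB D i f g f' g' : is_weak_pderiv D i f g -> is_weak_pderiv D i f' g' ->
  is_weak_pderiv D i (fun x => f x - f' x) (fun x => g x - g' x).
Proof.
move=> wk wk'; have := weakD wk (weakZ (-1) wk').
by congr is_weak_pderiv; apply/funext => x; rewrite mulN1r.
Qed.

Lemma ae_D_mul0 D (f z : 'rV[R]_n -> R) : measurable_fun setT (fun x => f x * z x) ->
  {ae mu, forall x, D x -> f x = 0} ->
  (forall x, ~ D x -> z x = 0) -> \int[mu]_x (f x * z x) = 0.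
Proof.
move=> mfz f0 z0; rewrite -[RHS](@J0 _ _ _ mu); apply: ae_eqJ => //.
apply: filterS f0 => x fx; have [/fx ->|/z0 ->] := pselect (D x); by rewrite ?mul0r ?mulr0.
Qed.

(** Uniqueness of weak derivatives, from the fundamental lemma. *)
Lemma weak_ae0 D i f g : open D -> is_weak_pderiv D i f g ->
  {ae mu, forall x, D x -> f x = 0} -> {ae mu, forall x, D x -> g x = 0}.
Proof.
move=> oD wk f0; have [lf lg _] := wk.
apply: fund_lemma => // c d m m0 d0 cD.
have te : test_function D (eta m c d) by exact: test_etaD.
have [i1 i2 E] := weakR wk te; apply: oppr_inj; rewrite -E oppr0.
have [K [cK KD p0 dp0]] := test_supp te.
apply: (@ae_D_mul0 D) => //; first exact: intg_measurable i1.
by move=> x nx; apply: dp0 => /KD.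
Qed.

Lemma weak_unique D i f f' g g' : open D -> is_weak_pderiv D i f g -> is_weak_pderiv D i f' g' ->
  {ae mu, forall x, D x -> f x = f' x} -> {ae mu, forall x, D x -> g x = g' x}.
Proof.
move=> oD wk wk' ff'.
have : {ae mu, forall x, D x -> g x - g' x = 0}.
  apply: (weak_ae0 oD (weakB wk wk')).
  by apply: filterS ff' => x h /h ->; rewrite subrr.
by apply: filterS => x h /h /subr0_eq.
Qed.

Lemma weak_C1_test D f phi i : C1 f -> test_function D phi ->
  \int[mu]_x (f x * pderiv i phi x) = - \int[mu]_x (pderiv i f x * phi x).
Proof.
move=> cf tp; have [K [cK KD p0 dp0]] := test_supp tp.
have cp := test_C1 tp; have [kp kdp] := cp; have [kf kdf] := cf.
have [kfp kdfp] := C1M cf cp.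
have fp0 x : ~ K x -> f x * phi x = 0 by move=> /p0 ->; rewrite mulr0.
have H := int_pderiv0 cK kfp (kdfp i).1 (kdfp i).2 fp0.
have i1 : intg mu (fun x => f x * pderiv i phi x).
  apply: cs_integrable cK _ _ => [x|x /dp0 ->]; last by rewrite mulr0.
  exact: (cvgM (kf x) ((kdp i).2 x)).
have i2 : intg mu (fun x => pderiv i f x * phi x).
  apply: cs_integrable cK _ _ => [x|x /p0 ->]; last by rewrite mulr0.
  exact: (cvgM ((kdf i).2 x) (kp x)).
apply/eqP; rewrite -subr_eq0 opprK -JD// -H; apply/eqP; apply: eqJ => x.
by rewrite (is_derive_pderiv (C1M_is i x cf cp)) [phi x * _]mulrC.
Qed.

Lemma C1_weak D f i : open D -> C1 f -> is_weak_pderiv D i f (pderiv i f).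
Proof.
move=> oD cf; have [kf kdf] := cf; apply: weakI.
- by apply: L1loc_continuous => // x _; exact: kf.
- by apply: L1loc_continuous => // x _; exact: (kdf i).2.
- by move=> phi; exact: weak_C1_test.
Qed.

Lemma weak_ext D i f g f' g' : open D -> is_weak_pderiv D i f g ->
  (forall x, D x -> f x = f' x) -> (forall x, D x -> g x = g' x) -> is_weak_pderiv D i f' g'.
Proof.
move=> oD wk ff gg; have [lf lg H] := wk.
have ext u u' : (forall x, D x -> u x = u' x) -> L1loc D u -> L1loc D u'.
  move=> uu [mu_ iu]; split.
    by apply: (eq_measurable_fun u) => // x /[!inE]; exact: uu.
  move=> K cK KD; apply: eq_integrable (iu _ cK KD); first exact: compact_measurable_rV.
  by move=> x /[!inE] /KD/uu /= ->.
split; [exact: ext lf|exact: ext lg|].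
move=> phi tp.
transitivity (\int[mu]_(x in D) (f x * pderiv i phi x)%:E)%E.
  by apply: eq_integral => x /[!inE] /ff ->.
rewrite (H _ tp); congr (- _)%E.
by apply: eq_integral => x /[!inE] /gg ->.
Qed.

End weak.

(** * Convolution with the bump kernel *)

Section mollify.
Variables (R : realType) (n : nat).
Local Notation mu := (@lebesgue_rV R n).
Local Notation e_ i := (delta_mx ord0 i : 'rV[R]_n).
Implicit Types (f g u : 'rV[R]_n -> R) (D K : set 'rV[R]_n) (i : 'I_n) (x y : 'rV[R]_n).

(** The bump of half-width d centred at x, and its derivatives in y. It depends
    on y - x only, but keeping both variables makes the symmetries in x and y
    visible. *)
Definition kern (k : 'I_n -> nat) (d : R) x y := etaD 1 x (const_mx d) k y.
Local Notation k0 := (fun=> 0%N).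
Local Notation k1 i := (incr i k0).

Lemma const_gt0 (d : R) : 0 < d -> forall j, 0 < (const_mx d : 'rV[R]_n) ord0 j.
Proof. by move=> d0 j; rewrite mxE. Qed.

Lemma kern_shift k d x y : kern k d x y = kern k d 0 (y - x).
Proof. by apply: eq_bigr => j _; rewrite !mxE subr0. Qed.

Lemma kern_sym d x y : kern k0 d x y = kern k0 d y x.
Proof. by apply: eq_bigr => j _; rewrite -opprB mulNr bumpN. Qed.

Lemma kern1_sym i d x y : kern (k1 i) d x y = - kern (k1 i) d y x.
Proof.
rewrite /kern /etaD (bigD1 i)//= [in RHS](bigD1 i)//= -mulNr; congr (_ * _).
  by rewrite /incr eqxx add0n -opprB mulNr bump1N mulrN.
by apply: eq_bigr => j ji; rewrite /incr (negbTE ji) addn0 -opprB mulNr bumpN.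
Qed.

Lemma kern_continuous k d x : continuous (kern k d x).
Proof. exact: continuous_etaD. Qed.

Lemma kern_measurable k d x : measurable_fun setT (kern k d x).
Proof. by apply: continuous_measurableT; exact: kern_continuous. Qed.

Lemma kern_bounded k d : 0 < d -> exists2 M, 0 <= M & forall x y, `|kern k d x y| <= M.
Proof.
move=> d0; have [M M0 H] := @etaD_bounded R n 1 0 _ ltr01 (const_gt0 d0) k.
by exists M => // x y; rewrite kern_shift; exact: H.
Qed.

Lemma kern_out k d x y : 0 < d -> ~ ball x d y -> kern k d x y = 0.
Proof.
move=> d0 nb; apply: etaD_out => // [|h]; first exact: const_gt0.
apply: nb; rewrite ball_rVE// => j; rewrite /ball /= distrC.
by have := h j; rewrite mxE.
Qed.

Lemma integrable_kern k d x : 0 < d -> intg mu (kern k d x).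
Proof. by move=> d0; apply: integrable_etaD => //; exact: const_gt0. Qed.

Lemma kern_ge0 d x y : 0 <= kern k0 d x y.
Proof. exact: eta_ge0. Qed.

(** The kernel is not normalized; its mass is carried along instead. *)
Definition kmass (d : R) := \int[mu]_y kern k0 d 0 y.

Lemma int_kern k d x : 0 < d -> \int[mu]_y kern k d x y = \int[mu]_y kern k d 0 y.
Proof.
move=> d0; rewrite -(@Rintegral_rV_shift R n (- x) (kern k d 0)); last exact: integrable_kern.
by apply: eqJ => y; rewrite kern_shift.
Qed.

Lemma kmass_gt0 d : 0 < d -> 0 < kmass d.
Proof.
move=> d0; rewrite lt_neqAle J_ge0 ?andbT; last exact: kern_ge0.
apply/eqP => /esym m0.
have ki := @integrable_kern k0 d 0 d0.
have E : (\int[mu]_y `|(kern k0 d 0 y)%:E| = 0)%E.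
  transitivity (\int[mu]_y (kern k0 d 0 y)%:E)%E; last by rewrite (EFinJ ki); congr EFin.
  by apply: eq_integral => y _; rewrite gee0_abs// lee_fin kern_ge0.
have mk : measurable_fun setT (EFin \o kern k0 d 0).
  by apply/measurable_EFinP; exact: kern_measurable.
have [N [mN N0 HN]] := (ae_eq_integral_abs mu measurableT mk).1 E.
pose B : set 'rV[R]_n := ball (0 : 'rV[R]_n) d.
have : (mu B <= mu N)%E.
  apply: le_measure; rewrite ?inE//; first exact: measurable_ball_rV.
  move=> y yb; apply: HN => /= /(_ Logic.I) [].
  apply/eqP; rewrite gt_eqF//; apply: eta_gt0 => //; first exact: const_gt0.
  move: yb; rewrite /B ball_rVE// => h j; have := h j; rewrite /ball /= mxE.
  by rewrite distrC mxE.
by rewrite N0 /B lebesgue_rV_ball// lee_fin leNgt exprn_gt0// mulr_gt0.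
Qed.

Lemma cs_unif f K e : compact K -> continuous f -> (forall x, ~ K x -> f x = 0) -> 0 < e ->
  exists2 d, 0 < d & forall x y, ball x d y -> `|f x - f y| <= e.
Proof.
move=> cK cf f0 e0; have [d d0 H] := compact_unif cK (fun x _ => cf x) e0.
exists d => // x y xy; have [Kx|nKx] := pselect (K x); first exact: H.
have [Ky|nKy] := pselect (K y); first by rewrite distrC H//; exact: ball_sym.
by rewrite !f0 ?subrr ?normr0// ltW.
Qed.

(** Convolution with the kernel and its derivatives. Each derivative that moves
    from the function moll k d f of x to the kernel in y changes the sign, so
    second derivatives correspond to incr i (incr i k) without sign. *)
Definition moll k d f x := \int[mu]_y (f y * kern k d x y).

Lemma intg_moll k d f x : 0 < d -> intg mu f -> intg mu (fun y => f y * kern k d x y).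
Proof.
move=> d0 fi; have [M M0 kM] := kern_bounded k d0.
by apply: intgMb fi _ (kM x); exact: kern_measurable.
Qed.

Lemma moll_bounded k d f : 0 < d -> intg mu f -> exists M, forall x, `|moll k d f x| <= M.
Proof.
move=> d0 fi; have [M M0 kM] := kern_bounded k d0.
exists (M * \int[mu]_y `|f y|) => x.
rewrite (le_trans (le_normJ (intg_moll _ _ d0 fi)))// -JZ; last exact: intg_norm.
apply: le_J; [exact/intg_norm/intg_moll|by apply: intgZ; exact: intg_norm|].
by move=> y; rewrite normrM mulrC ler_wpM2r//.
Qed.

Lemma moll_continuous k d f : 0 < d -> intg mu f -> continuous (moll k d f).
Proof.
move=> d0 fi x; apply/(@cvgrPdist_le _ _ _ (nbhs x) _ (moll k d f) (moll k d f x)) => e e0.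
pose C := 1 + \int[mu]_y `|f y|.
have C0 : 0 < C by rewrite ltr_pwDl// J_ge0.
have [r r0 H] := @cs_unif (kern k d 0) _ (e / C)
  (@cbox_compact R n 0 (const_mx d)) (@kern_continuous k d 0)
  (fun y => etaD_outc (m:=1) ltr01 (const_gt0 d0) k (y:=y)) (divr_gt0 e0 C0).
near=> z; rewrite /moll -JB; try exact: intg_moll.
have i1 : intg mu (fun y => f y * kern k d x y - f y * kern k d z y).
  by apply: intgB; exact: intg_moll.
rewrite (le_trans (le_normJ i1))//.
apply: (@le_trans _ _ (\int[mu]_y (e / C * `|f y|))).
  apply: le_J; [exact: intg_norm|by apply: intgZ; exact: intg_norm|].
  move=> y; rewrite -mulrBr normrM mulrC ler_wpM2r//.
  rewrite kern_shift [kern _ _ z _]kern_shift; apply: H.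
  have zr : ball x r z by near: z; exact: nbhsx_ballx.
  by move: zr; rewrite -!ball_normE /= opprB addrAC addrCA subrr addr0 distrC.
rewrite JZ; last exact: intg_norm.
rewrite mulrAC -mulrA ler_piMr ?(ltW e0)// ler_pdivrMr// mul1r /C lerDr//.
Unshelve. all: by end_near. Qed.

Lemma moll_close d f x v e : 0 < d -> intg mu f ->
  (forall y, ball x d y -> `|f y - v| <= e) ->
  `|moll k0 d f x - kmass d * v| <= e * kmass d.
Proof.
move=> d0 fi H; have ki := @integrable_kern k0 d x d0.
have mi := @intg_moll k0 d f x d0 fi.
have kv : kmass d * v = \int[mu]_y (v * kern k0 d x y) by rewrite JZ// int_kern// mulrC.
have i1 : intg mu (fun y => f y * kern k0 d x y - v * kern k0 d x y).
  by apply: intgB => //; exact: intgZ.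
rewrite kv /moll -JB//; last exact: intgZ.
rewrite (le_trans (le_normJ i1))//.
rewrite /kmass -(int_kern _ x)// -JZ//.
apply: le_J; [exact: intg_norm|exact: intgZ|move=> y].
rewrite -mulrBl normrM [X in _ * X]ger0_norm ?kern_ge0//.
have [yb|ny] := pselect (ball x d y); first by rewrite ler_wpM2r ?kern_ge0// H.
by rewrite kern_out// !mulr0.
Qed.

Lemma moll_le d f x c : 0 < d -> intg mu f ->
  (forall y, ball x d y -> f y <= c) -> moll k0 d f x <= c * kmass d.
Proof.
move=> d0 fi H; have ki := @integrable_kern k0 d x d0.
rewrite /kmass -(int_kern _ x)// -JZ//.
apply: le_J; [exact: intg_moll|exact: intgZ|move=> y].
have [yb|ny] := pselect (ball x d y); first by rewrite ler_wpM2r ?kern_ge0// H.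
by rewrite kern_out// !mulr0.
Qed.

Lemma kern2_measurable k d : measurable_fun setT (fun p : 'rV[R]_n * 'rV[R]_n => kern k d p.1 p.2).
Proof.
rewrite /kern /etaD; apply: measurable_prod => j _.
apply: measurable_funM => //.
apply: (@measurableT_comp _ _ _ _ _ _ (bumpD 1 (k j))).
  apply: continuous_measurable_fun; exact: (is_derive1_continuous (is_derive_bumpD 1 (k j))).
have -> : (fun p : 'rV[R]_n * 'rV[R]_n => (p.2 ord0 j - p.1 ord0 j) / (const_mx d : 'rV[R]_n) ord0 j) =
  (fun p : 'rV[R]_n * 'rV[R]_n => (p.2 ord0 j - p.1 ord0 j) * d^-1).
  by apply/funext => p; rewrite mxE.
apply: measurable_funM => //; apply: measurable_funB.
  by apply: (@measurableT_comp _ _ _ _ _ _ (fun x : 'rV[R]_n => x ord0 j) _ snd) => //; exact: measurable_coord.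
by apply: (@measurableT_comp _ _ _ _ _ _ (fun x : 'rV[R]_n => x ord0 j) _ fst) => //; exact: measurable_coord.
Qed.

(** Fubini for a bounded kernel. It makes convolution with the even kernel
    symmetric and convolution with its first derivative antisymmetric. *)
Lemma fubini_moll k d f g : 0 < d -> intg mu f -> intg mu g ->
  \int[mu]_x (f x * \int[mu]_y (g y * kern k d x y)) =
  \int[mu]_y (g y * \int[mu]_x (f x * kern k d x y)).
Proof.
move=> d0 fi gi; have [M M0 kM] := kern_bounded k d0.
pose h (p : 'rV[R]_n * 'rV[R]_n) : R := f p.1 * g p.2 * kern k d p.1 p.2.
have mh : measurable_fun setT (EFin \o h).
  apply/measurable_EFinP; apply: measurable_funM; last exact: kern2_measurable.
  apply: measurable_funM.
    by apply: (@measurableT_comp _ _ _ _ _ _ f _ fst) => //; exact: intg_measurable fi.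
  by apply: (@measurableT_comp _ _ _ _ _ _ g _ snd) => //; exact: intg_measurable gi.
have fk y : intg mu (fun x => f x * kern k d x y).
  apply: intgMb fi _ (fun x => kM x y).
  rewrite (_ : (fun x => _) = (fun p : 'rV[R]_n * 'rV[R]_n => kern k d p.1 p.2) \o (fun x => (x, y)))//.
  apply: measurableT_comp; first exact: kern2_measurable.
  by apply: measurable_fun_pair.
have ih : (mu \x mu)%E.-integrable setT (EFin \o h).
  apply/(integrable12ltyP mu mu mh).
  have B x : (\int[mu]_y `|(EFin \o h) (x, y)| <= (`|f x| * (M * \int[mu]_y `|g y|))%:E)%E.
    rewrite -JZ; last exact: intg_norm.
    rewrite -JZ; last by apply: intgZ; exact: intg_norm.
    rewrite -EFinJ; last by do 2 apply: intgZ; exact: intg_norm.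
    apply: ge0_le_integral => //.
    - apply: measurableT_comp => //; apply: (measurableT_comp mh).
      exact: measurable_fun_pair.
    - apply/measurable_EFinP; apply: measurable_funM => //; apply: measurable_funM => //.
      by apply: measurableT_comp => //; exact: intg_measurable gi.
    - move=> y _; rewrite lee_fin /h /= !normrM -mulrA ler_wpM2l// mulrC ler_wpM2r//.
  apply: (@le_lt_trans _ _ (\int[mu]_x ((`|f x| * (M * \int[mu]_y `|g y|))%:E))%E).
    apply: ge0_le_integral => //.
    - by move=> x _; exact: integral_ge0.
    - apply: (measurable_fun_fubini_tonelli_F (abse \o (EFin \o h))) => //=.
      exact: measurableT_comp.
    - apply/measurable_EFinP; apply: measurable_funM => //.
      by apply: measurableT_comp => //; exact: intg_measurable fi.
  have i1 : intg mu (fun x => `|f x| * (M * \int[mu]_y `|g y|)).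
    by apply: (eq_intg (f:=fun x => (M * \int[mu]_y `|g y|) * `|f x|)) => [x|];
      [rewrite mulrC|apply: intgZ; exact: intg_norm].
  by rewrite (EFinJ i1) ltry.
have := Fubini ih => F; rewrite /Rintegral.
transitivity (fine (\int[mu]_x \int[mu]_y (h (x, y))%:E)%E).
  congr fine; apply: eq_integral => x _.
  rewrite -/(Rintegral mu setT (fun y => g y * kern k d x y)) -JZ; last exact: intg_moll.
  rewrite -EFinJ; last by apply: intgZ; exact: intg_moll.
  by apply: eq_integral => y _; rewrite /h /= mulrA.
rewrite F; congr fine; apply: eq_integral => y _.
have /= E1 := @JZ _ _ _ mu (g y) (fun x => f x * kern k d x y) (fk y).
have /= E2 := @EFinJ _ _ _ mu (fun x => g y * (f x * kern k d x y)) (intgZ (g y) (fk y)).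
rewrite -[in RHS]E1 -[RHS]E2.
by apply: eq_integral => x _; rewrite /h /= mulrA [f x * g y]mulrC.
Qed.

Lemma moll_sym d f g : 0 < d -> intg mu f -> intg mu g ->
  \int[mu]_x (f x * moll k0 d g x) = \int[mu]_x (g x * moll k0 d f x).
Proof.
move=> d0 fi gi; rewrite [LHS](fubini_moll k0 d0 fi gi).
have E x y : f x * kern k0 d x y = f x * kern k0 d y x by rewrite [in RHS]kern_sym.
apply: eqJ => y; have -> // : \int[mu]_x (f x * kern k0 d x y) = moll k0 d f y.
by apply: eqJ => x; exact: E.
Qed.

Lemma moll1_sym i d f g : 0 < d -> intg mu f -> intg mu g ->
  \int[mu]_x (f x * moll (k1 i) d g x) = - \int[mu]_x (g x * moll (k1 i) d f x).
Proof.
move=> d0 fi gi; rewrite [LHS](fubini_moll (k1 i) d0 fi gi) -JN; last first.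
  have [M HM] := moll_bounded (k1 i) d0 fi.
  by apply: intgMb gi _ HM; apply: continuous_measurableT; exact: moll_continuous.
apply: eqJ => y; rewrite -mulrN; congr (_ * _).
rewrite -[RHS]JN; last exact: intg_moll.
apply: eqJ => x; rewrite -mulrN; congr (_ * _); exact: kern1_sym.
Qed.

End mollify.

(** * Testing weak derivatives against rougher functions *)

Section extension.
Variables (R : realType) (n : nat).
Local Notation mu := (@lebesgue_rV R n).
Local Notation e_ i := (delta_mx ord0 i : 'rV[R]_n).
Local Notation k0 := (fun=> 0%N).
Local Notation k1 i := (incr i k0).
Implicit Types (f g G u : 'rV[R]_n -> R) (D K : set 'rV[R]_n) (i : 'I_n) (x y : 'rV[R]_n).

Lemma compact_open_dist D K : compact K -> open D -> K `<=` D ->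
  exists2 d : R, 0 < d & forall x, K x -> ball x d `<=` D.
Proof.
move=> cK oD KD.
have /compact_near_coveringP/(_ _ (0:R)^'+ (fun d x => ball x d `<=` D)) := cK.
have H x : K x -> \forall x' \near x & i \near (0:R)^'+, ball x' i `<=` D.
  move=> Kx; have /nbhs_ballP[r /= r0 Hr] : nbhs x D.
    by apply: open_nbhs_nbhs; split => //; exact: KD.
  exists (ball x (r / 2), [set d | d < r / 2]) => /=.
    split; first by apply/nbhs_ballP; exists (r / 2) => //=; rewrite divr_gt0.
    by apply: nbhs_right_lt; rewrite divr_gt0.
  move=> [x' d] [/= xx' dr] y xy.
  apply/Hr; rewrite (splitr r); apply: ball_triangle xx' _.
  exact: le_ball (ltW dr) _ xy.
move=> /(_ _ H) K'.
have [d [/= d0 Hd]] := filter_ex (filterI (nbhs_right_gt (0:R)) K').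
by exists d.
Qed.

(** Room around a compact subset of D for convolution at scale d. *)
Lemma compact_nbhd D K : compact K -> open D -> K `<=` D ->
  exists (d : R) K1, [/\ 0 < d, compact K1, K1 `<=` D & forall x y : 'rV[R]_n, K x -> ball x d y -> K1 y].
Proof.
move=> cK oD KD; have [d d0 H] := compact_open_dist cK oD KD.
have [r r0 Kr] := compact_sub_ball cK.
have d20 : 0 < d / 2 by rewrite divr_gt0.
exists (d / 2), (closure [set y | exists2 x, K x & ball x (d / 2) y]); split => //.
- apply: bounded_closed_compact; last exact: closed_closure.
  exists (r + d); split; first exact: num_real.
  move=> M rM z zc.
  have [y [[x Kx xy] yz]] := zc _ (@nbhsx_ballx _ _ z _ d20).
  have : ball (0 : 'rV[R]_n) (r + d) z.
    rewrite (splitr d) addrA; apply: ball_triangle (ball_sym yz).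
    by apply: ball_triangle xy; exact: Kr.
  by rewrite -ball_normE /= sub0r normrN => /ltW/le_trans; apply; exact: ltW.
- move=> z zc; have [y [[x Kx xy] yz]] := zc _ (@nbhsx_ballx _ _ z _ d20).
  by apply: (H x Kx); rewrite (splitr d); apply: ball_triangle xy (ball_sym yz).
- by move=> x y Kx xy; apply: subset_closure; exists x.
Qed.

Lemma L1loc_restrict D f K : L1loc D f -> compact K -> K `<=` D -> intg mu (f \_ K).
Proof.
move=> [_ fK] cK KD; have := fK _ cK KD.
by rewrite integrable_mkcond ?restrict_EFin//; exact: compact_measurable_rV.
Qed.

(** Replacing W by N V costs e N times the L^1 norm of u; here W is a
    convolution of V and N the mass of the kernel. *)
Lemma cvg_approx (u W V : 'rV[R]_n -> R) N e : intg mu (fun x => u x * W x) -> intg mu (fun x => u x * V x) ->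
  intg mu u -> (forall x, u x != 0 -> `|W x - N * V x| <= e * N) ->
  `|\int[mu]_x (u x * W x) - N * \int[mu]_x (u x * V x)| <= e * N * \int[mu]_x `|u x|.
Proof.
move=> i1 i2 ui H; have i3 := intg_norm ui.
rewrite -JZ// -JB//; last exact: intgZ.
have i4 : intg mu (fun x => u x * W x - N * (u x * V x)) by apply: intgB => //; exact: intgZ.
rewrite (le_trans (le_normJ i4))// -JZ//; apply: le_J; [exact: intg_norm|exact: intgZ|].
move=> x; rewrite mulrCA -mulrBr normrM mulrC.
have [->|u0] := eqVneq (u x) 0; first by rewrite normr0 !mulr0.
by rewrite ler_wpM2r// H.
Qed.

(** If G' is the weak derivative of G and both live on a compact subset of D,
    then G may be used to test the weak derivative of f. Indeed
    int f (eta * G') = - int f (D_i eta * G), up to sign, = - int g (eta * G)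
    by symmetry of convolution, since the kernels centred on K are smooth test
    functions; letting the scale tend to 0 gives the claim. The left-hand side
    converges as soon as one of the factors f and G' is continuous. *)
Lemma ext_weak D i f g G (G' : 'rV[R]_n -> R) K : open D -> is_weak_pderiv D i f g ->
  compact K -> K `<=` D -> continuous G -> intg mu G' ->
  (forall x, ~ K x -> G x = 0) -> (forall x, ~ K x -> G' x = 0) ->
  (forall x d, 0 < d -> moll (k1 i) d G x = - moll k0 d G' x) ->
  (continuous G' \/ forall x, D x -> {for x, continuous f}) ->
  intg mu (fun x => f x * G' x) -> intg mu (fun x => g x * G x) ->
  \int[mu]_x (f x * G' x) = - \int[mu]_x (g x * G x).
Proof.
move=> oD wk cK KD cG G'i G0 G'0 GG' C fG'i gGi.
have [lf lg _] := wk.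
have [d1 [K1 [d10 cK1 K1D KK1]]] := compact_nbhd cK oD KD.
have Gi : intg mu G := cs_integrable cK cG G0.
pose f1 := f \_ K1; pose g1 := g \_ K1.
have f1i : intg mu f1 by exact: L1loc_restrict lf _ _.
have g1i : intg mu g1 by exact: L1loc_restrict lg _ _.
have f1E x : K1 x -> f1 x = f x by move=> Kx; rewrite /f1 patchE ifT// inE.
have g1E x : K1 x -> g1 x = g x by move=> Kx; rewrite /g1 patchE ifT// inE.
have KK x : K x -> K1 x by move=> Kx; apply: (KK1 x) => //; exact: ballxx.
have f1G' : (fun x => f1 x * G' x) = (fun x => f x * G' x).
  by apply/funext => x; have [/KK/f1E -> //|/G'0 ->] := pselect (K x); rewrite !mulr0.
have g1G : (fun x => g1 x * G x) = (fun x => g x * G x).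
  by apply/funext => x; have [/KK/g1E -> //|/G0 ->] := pselect (K x); rewrite !mulr0.
(* the identity at scale d: the kernels centred on K are test functions on D *)
have key d : 0 < d -> d < d1 ->
    \int[mu]_x (f1 x * moll k0 d G' x) = - \int[mu]_x (g1 x * moll k0 d G x).
  move=> d0 dd1; have dp := @const_gt0 R n d d0.
  have inn y z : K y -> cbox y (const_mx d) z -> K1 z.
    move=> Ky yz; apply: (KK1 y) => //; rewrite ball_rVE// => j.
    rewrite /ball /= distrC; apply: le_lt_trans dd1.
    by have := yz j; rewrite mxE.
  have sw y : K y -> \int[mu]_x (f1 x * kern (k1 i) d y x) = - \int[mu]_x (g1 x * kern k0 d y x).
    move=> Ky; have te : test_function D (kern k0 d y).
      by apply: test_etaD => // z /(inn _ _ Ky)/K1D.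
    have [_ _] := weakR wk te; rewrite pderiv_etaD => E.
    transitivity (\int[mu]_x (f x * kern (k1 i) d y x)).
      apply: eqJ => x; have [/(inn _ _ Ky)/f1E ->//|nx] := pselect (cbox y (const_mx d) x).
      by rewrite /kern etaD_outc// !mulr0.
    rewrite E; congr (- _).
    apply: eqJ => x; have [/(inn _ _ Ky)/g1E ->//|nx] := pselect (cbox y (const_mx d) x).
    by rewrite /kern etaD_outc// !mulr0.
  transitivity (- \int[mu]_x (f1 x * moll (k1 i) d G x)).
    rewrite -JN.
      by apply: eqJ => x; rewrite GG'// mulrN opprK.
    have [M HM] := moll_bounded (k1 i) d0 Gi.
    by apply: intgMb f1i _ HM; apply: continuous_measurableT; exact: moll_continuous.
  rewrite (moll1_sym i d0 f1i Gi) (moll_sym d0 g1i Gi) opprK -JN; last first.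
    have [M HM] := moll_bounded k0 d0 g1i.
    by apply: intgMb Gi _ HM; apply: continuous_measurableT; exact: moll_continuous.
  apply: eqJ => y; have [Ky|nK] := pselect (K y); last by rewrite G0// !mul0r oppr0.
  rewrite -mulrN; congr (_ * _); exact: sw.
(* the two sides of key, divided by the mass of the kernel, tend to the two
   sides of the claim as d tends to 0 *)
have A1 e : 0 < e -> exists2 d2, 0 < d2 & forall d, 0 < d -> d < d2 ->
    `|\int[mu]_x (g1 x * moll k0 d G x) - @kmass R n d * \int[mu]_x (g x * G x)|
      <= e * @kmass R n d * \int[mu]_x `|g1 x|.
  move=> e0; have [d2 d20 H] := cs_unif cK cG G0 e0.
  exists d2 => // d d0 dd2; rewrite -g1G; apply: cvg_approx => //.
  - have [M HM] := moll_bounded k0 d0 Gi.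
    by apply: intgMb g1i _ HM; apply: continuous_measurableT; exact: moll_continuous.
  - by rewrite g1G.
  - move=> x _; apply: moll_close => // y xy.
    by rewrite distrC; apply: H; exact: le_ball (ltW dd2) _ xy.
have A2 : exists2 B, 0 <= B & forall e, 0 < e -> exists2 d2, 0 < d2 & forall d, 0 < d -> d < d2 ->
    `|\int[mu]_x (f1 x * moll k0 d G' x) - @kmass R n d * \int[mu]_x (f x * G' x)|
      <= e * @kmass R n d * B.
  case: C => [cG'|cf].
    exists (\int[mu]_x `|f1 x|); first exact: J_ge0.
    move=> e e0; have [d2 d20 H] := cs_unif cK cG' G'0 e0.
    exists d2 => // d d0 dd2; rewrite -f1G'; apply: cvg_approx => //.
    - have [M HM] := moll_bounded k0 d0 G'i.
      by apply: intgMb f1i _ HM; apply: continuous_measurableT; exact: moll_continuous.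
    - by rewrite f1G'.
    - move=> x _; apply: moll_close => // y xy.
      by rewrite distrC; apply: H; exact: le_ball (ltW dd2) _ xy.
  exists (\int[mu]_x `|G' x|); first exact: J_ge0.
  move=> e e0; have [d2 d20 H] := compact_unif cK (fun x Kx => cf x (KD x Kx)) e0.
  exists (Num.min d1 d2); first by rewrite lt_min d10.
  move=> d d0; rewrite lt_min => /andP[dd1 dd2].
  rewrite (moll_sym d0 f1i G'i) -f1G'.
  rewrite (@eqJ _ _ _ mu (fun x => f1 x * G' x) (fun x => G' x * f1 x)); last by move=> x; rewrite mulrC.
  apply: cvg_approx => //.
  - have [M HM] := moll_bounded k0 d0 f1i.
    by apply: intgMb G'i _ HM; apply: continuous_measurableT; exact: moll_continuous.
  - by apply: eq_intg fG'i => x; rewrite -[LHS]/((fun x => f x * G' x) x) -f1G' mulrC.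
  - move=> x G'x; have Kx : K x by apply: contrapT => /G'0 G'x0; rewrite G'x0 eqxx in G'x.
    apply: moll_close => // y xy; rewrite (f1E x) ?(f1E y)//; last exact: KK.
      by rewrite distrC; apply: H => //; exact: le_ball (ltW dd2) _ xy.
    by apply: (KK1 x) => //; exact: le_ball (ltW dd1) _ xy.
have [B B0 {}A2] := A2.
set B1 := \int[mu]_x `|g1 x| in A1; have B10 : 0 <= B1 by exact: J_ge0.
apply/eqP; rewrite -subr_eq0 opprK; apply/eqP/normr0_eq0/eqP; rewrite eq_le normr_ge0 andbT.
apply/ler_addgt0Pr => e e0; rewrite add0r.
pose e' := e / (1 + B + B1); have C0 : 0 < 1 + B + B1 by rewrite ltr_pwDl// ltr_pwDl.
have e'0 : 0 < e' by rewrite divr_gt0.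
have [d2 d20 {}A1] := A1 _ e'0; have [d3 d30 {}A2] := A2 _ e'0.
pose d := Num.min d1 (Num.min d2 d3) / 2.
have m0 : 0 < Num.min d1 (Num.min d2 d3) by rewrite !lt_min d10 d20.
have d0 : 0 < d by rewrite divr_gt0.
have : d < Num.min d1 (Num.min d2 d3) by rewrite ltr_pdivrMr// ltr_pMr// ltr1n.
rewrite !lt_min => /and3P[dd1 dd2 dd3].
have N0 := @kmass_gt0 R n d d0.
rewrite -(ler_pM2l N0); set N := @kmass R n d.
have := A1 d d0 dd2; have := A2 d d0 dd3; rewrite (key d d0 dd1) -/N.
set X := \int[mu]_x (g1 x * _); set Y := \int[mu]_x (f x * _); set Z := \int[mu]_x (g x * _).
move=> h1 h2.
rewrite -[X in X * _](gtr0_norm N0) -normrM.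
have -> : N * (Y + Z) = - (- X - N * Y) - (X - N * Z) by ring.
rewrite (le_trans (ler_normB _ _))// normrN (le_trans (lerD h1 h2))//.
rewrite -mulrDr mulrAC -/N [N * e]mulrC ler_wpM2r ?(ltW N0)// /e' mulrAC ler_pdivrMr//.
by rewrite ler_wpM2l ?(ltW e0)// -addrA lerDr.
Qed.

End extension.

(** * A maximum principle without second derivatives *)

Section maxprinciple.
Variables (R : realType) (n : nat).
Local Notation mu := (@lebesgue_rV R n).
Local Notation e_ i := (delta_mx ord0 i : 'rV[R]_n).
Local Notation k0 := (fun=> 0%N).
Local Notation k1 i := (incr i k0).
Local Notation k2 i := (incr i (incr i k0)).
Local Notation km := (@kmass R n).
Implicit Types (f g u v : 'rV[R]_n -> R) (D K : set 'rV[R]_n) (i : 'I_n) (a x y : 'rV[R]_n).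

Definition qd (a x : 'rV[R]_n) : R := \sum_j (x ord0 j - a ord0 j) ^+ 2.

Lemma continuous_scale f (c : R) x : {for x, continuous f} ->
  {for x, continuous (fun y => c * f y)}.
Proof. by move=> cf; exact: (cvgM (cvg_cst c) cf). Qed.

(** Two applications of the mean value theorem. *)
Lemma second_diff (p p1 p2 : R -> R) (h : R) : (forall s : R, is_derive s 1 p (p1 s)) ->
  (forall s : R, is_derive s 1 p1 (p2 s)) -> 0 < h ->
  exists2 s, `|s| <= h & p h + p (- h) - 2 * p 0 = h ^+ 2 * p2 s.
Proof.
move=> dp dp1 h0.
have dq (s : R) : is_derive s 1 (fun s => p (s + h) - p s) (p1 (s + h) - p1 s).
  have d1 : is_derive s 1 (fun s => p (s + h)) (p1 (s + h)).
    have H := @is_derive1_comp _ p (fun s : R => s + h) s _ _ (dp (s + h)) (is_derive_shift _ _ _).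
    by apply: (is_derive_eq H); rewrite mulr1.
  exact: (is_deriveB d1 (dp s)).
have [s1 s1h E1] := MVT_any (- h) 0 dq.
have [s2 s2h E2] := MVT_any s1 (s1 + h) dp1.
move: s1h; rewrite min_l ?max_r ?oppr_le0 ?(ltW h0)// => /andP[s1a s1b].
move: s2h; rewrite min_l ?max_r ?lerDl ?(ltW h0)// => /andP[s2a s2b].
exists s2; first by rewrite ler_norml (le_trans s1a s2a)/= (le_trans s2b)// gerDr.
have -> : p h + p (- h) - 2 * p 0 = (p (0 + h) - p 0) - (p (- h + h) - p (- h)).
  by rewrite add0r addNr; ring.
rewrite E1 E2; ring.
Qed.

Lemma is_derive_line_etaD (m : R) (c d : 'rV[R]_n) k i x (s : R) :
  is_derive s 1 (fun s => etaD m c d k (s *: e_ i + x)) (etaD m c d (incr i k) (s *: e_ i + x)).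
Proof.
have H z : derivable (etaD m c d k) z (e_ i) by have [] := is_derive_etaD m c d i k z.
by have := @is_derive_line R n _ i x H s; rewrite pderiv_etaD.
Qed.

Lemma kern_unif k d x e : 0 < d -> 0 < e ->
  exists2 r, 0 < r & forall y z, ball y r z -> `|kern k d x y - kern k d x z| <= e.
Proof.
move=> d0 e0; apply: (@cs_unif R n (kern k d x) (cbox x (const_mx d))) => //.
- exact: cbox_compact.
- exact: kern_continuous.
- by move=> y; apply: etaD_outc => //; exact: const_gt0.
Qed.

(** The second differences fall on the smooth kernel, where they are controlled
    by its second derivative. *)
Lemma moll_sdiff_cvg d f i x : 0 < d -> intg mu f ->
  (fun k : nat => k.+1%:R ^+ 2 * (moll k0 d f (x + k.+1%:R^-1 *: e_ i) +
    moll k0 d f (x - k.+1%:R^-1 *: e_ i) - 2 * moll k0 d f x)) @ \oo --> moll (k2 i) d f x.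
Proof.
move=> d0 fi.
pose h (k : nat) : R := k.+1%:R^-1.
have h0 k : 0 < h k by rewrite invr_gt0.
pose q k y := (h k) ^- 2 * (kern k0 d x (h k *: e_ i + y) + kern k0 d x (- h k *: e_ i + y)
   - 2 * kern k0 d x y).
have qE k y : exists2 s, `|s| <= h k & q k y = kern (k2 i) d x (s *: e_ i + y).
  have [s sh E] := second_diff (@is_derive_line_etaD 1 x (const_mx d) k0 i y)
    (@is_derive_line_etaD 1 x (const_mx d) (k1 i) i y) (h0 k).
  exists s => //; rewrite /q /kern; move: E; rewrite scale0r add0r => ->.
  by rewrite mulKf// expf_neq0// gt_eqF.
have [M M0 kM] := @kern_bounded R n (k2 i) d d0.
have C0 k : measurable_fun setT (fun y => f y * q k y).
  apply: measurable_funM; first exact: intg_measurable fi.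
  have ck (s : R) : measurable_fun setT (fun y => kern k0 d x (s *: e_ i + y)).
    rewrite (_ : (fun y => _) = kern k0 d x \o (fun y => y + s *: e_ i)); last first.
      by apply/funext => y /=; rewrite addrC.
    by apply: measurableT_comp; [exact: kern_measurable|exact: measurable_shift_rV].
  apply: measurable_funM => //; apply: measurable_funB; last first.
    by apply: measurable_funM => //; exact: kern_measurable.
  by apply: measurable_funD; exact: ck.
have C1 y : (fun k => f y * q k y) @ \oo --> f y * kern (k2 i) d x y.
  apply: cvgMr; apply/cvgrPdist_le => e e0.
  have [r r0 H] := kern_unif (k2 i) x d0 e0.
  near=> k; have [s sh ->] := qE k y.
  apply: H; rewrite -ball_normE /= opprD addrCA subrr addr0 normrN.
  rewrite normrZ; apply: (@le_lt_trans _ _ `|s|).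
    rewrite ler_piMr// [leLHS]/Num.norm /= mx_normrE; apply/bigmax_leP; split => // -[a b] _ /=.
    by rewrite mxE ord1 eqxx /=; case: eqP; rewrite ?normr1 ?normr0.
  apply: le_lt_trans sh _; near: k.
  have : h @ \oo --> (0:R) := cvg_harmonic.
  move=> /cvgrPdist_lt/(_ _ r0); apply: filterS => k.
  by rewrite sub0r normrN gtr0_norm.
have C2 k y : `|f y * q k y| <= M * `|f y|.
  by rewrite normrM mulrC ler_wpM2r//; have [s _ ->] := qE k y.
have [_ C] := dctJ C0 C1 C2 (intgZ M (intg_norm fi)).
rewrite [X in X @ _](_ : _ = (fun k => \int[mu]_y (f y * q k y)))//.
apply/funext => k.
have i1 := @intg_moll R n k0 d f (x + h k *: e_ i) d0 fi.
have i2 := @intg_moll R n k0 d f (x - h k *: e_ i) d0 fi.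
have i3 := @intg_moll R n k0 d f x d0 fi.
have i4 := intgZ 2 i3; have i5 := intgB (intgD i1 i2) i4.
have E := JB (intgD i1 i2) i4; rewrite (JD i1 i2) (JZ 2 i3) in E.
rewrite /moll -[k.+1%:R^-1]/(h k) -E -(JZ (k.+1%:R ^+ 2) i5).
apply: eqJ => y; rewrite /q /h -exprVn invrK.
rewrite [kern k0 d (x + _) y]kern_shift [kern k0 d (x - _) y]kern_shift.
rewrite [kern k0 d x (_ + y)]kern_shift [kern k0 d x (- _ *: _ + y)]kern_shift.
have -> : y - (x + k.+1%:R^-1 *: e_ i) = - k.+1%:R^-1 *: e_ i + y - x.
  by rewrite opprD addrA addrAC scaleNr [- _ + y]addrC.
have -> : y - (x - k.+1%:R^-1 *: e_ i) = k.+1%:R^-1 *: e_ i + y - x.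
  by rewrite opprB addrCA addrA.
set a1 := kern _ _ _ _; set a2 := kern _ _ _ _; set a3 := kern _ _ _ _.
by move: (f y) (k.+1%:R) a1 a2 a3 => p c a1 a2 a3; ring.
Unshelve. all: by end_near. Qed.

(** At a local maximum all second differences are nonpositive. The squared
    distance has second differences 2 in each of the n directions, and acts as
    the usual perturbation that moves the maximum to the interior. *)
Lemma moll_local_max d f x a kap r : 0 < d -> intg mu f -> 0 < r ->
  (forall y, ball x r y -> moll k0 d f y + kap * qd a y <= moll k0 d f x + kap * qd a x) ->
  \sum_i moll (k2 i) d f x + 2 * n%:R * kap <= 0.
Proof.
move=> d0 fi r0 H.
suff H1 i : moll (k2 i) d f x + 2 * kap <= 0.
  apply: (@le_trans _ _ (\sum_i (moll (k2 i) d f x + 2 * kap))); last exact: sumr_le0.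
  rewrite big_split /= sumr_const card_ord.
  rewrite [X in _ <= _ + X](_ : _ = 2 * n%:R * kap)//.
  by rewrite -[LHS]mulr_natr mulrAC.
have C := @moll_sdiff_cvg d f i x d0 fi.
rewrite -lerBrDr sub0r -(cvg_lim (@norm_hausdorff _ _) C).
apply: limr_le; first exact: cvgP C.
have h0 (k : nat) : (0:R) < k.+1%:R^-1 by rewrite invr_gt0.
near=> k.
have hr : k.+1%:R^-1 < r.
  near: k; have : (fun k : nat => k.+1%:R^-1) @ \oo --> (0:R) := cvg_harmonic.
  move=> /cvgrPdist_lt/(_ _ r0); apply: filterS => k.
  by rewrite sub0r normrN gtr0_norm.
set h := k.+1%:R^-1 in hr *.
have rat_box (s : R) : `|s| = h -> ball x r (x + s *: e_ i).
  move=> sh; rewrite -ball_normE /= opprD addrA subrr add0r normrN normrZ sh.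
  apply: le_lt_trans hr; rewrite ler_piMr ?(ltW (h0 k))//.
  rewrite [leLHS]/Num.norm /= mx_normrE; apply/bigmax_leP; split => // -[b c] _ /=.
  by rewrite mxE ord1 eqxx /=; case: eqP; rewrite ?normr1 ?normr0.
have := H _ (rat_box h (gtr0_norm (h0 k))).
have := H _ (rat_box (- h) _); rewrite normrN (gtr0_norm (h0 k)) => /(_ erefl).
have qE (s : R) : qd a (x + s *: e_ i) = qd a x + 2 * s * (x ord0 i - a ord0 i) + s ^+ 2.
  rewrite /qd (bigD1 i)//= [in RHS](bigD1 i)//= !mxE !eqxx mulr1.
  rewrite (eq_bigr (fun j => (x ord0 j - a ord0 j) ^+ 2)); first ring.
  by move=> j ji; rewrite !mxE (negbTE ji) mulr0 addr0.
rewrite !qE scaleNr => h1 h2.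
have hh : k.+1%:R = h^-1 :> R by rewrite invrK.
rewrite hh -(ler_pM2l (x := h ^+ 2)) ?exprn_gt0 ?h0// mulrA -exprMn divff ?gt_eqF ?h0// expr1n mul1r.
set F0 := moll k0 d f x in h1 h2 *; set F1 := moll k0 d f (x + _) in h2 *.
set F2 := moll k0 d f (x - _) in h1 *; set Q := qd a x in h1 h2.
set c := x ord0 i - a ord0 i in h1 h2.
nra.
Unshelve. all: by end_near. Qed.

Lemma qd_ge a x (s : R) j : `|x ord0 j - a ord0 j| = s -> s ^+ 2 <= qd a x.
Proof.
move=> <-; rewrite /qd (bigD1 j)//= real_normK ?num_real// lerDl.
by apply: sumr_ge0 => k _; exact: sqr_ge0.
Qed.

Lemma qd_continuous a : continuous (qd a).
Proof.
rewrite /qd; have : forall s : seq 'I_n, continuous (fun x : 'rV[R]_n => \sum_(j <- s) (x ord0 j - a ord0 j) ^+ 2).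
  elim=> [|j s IH] x.
    rewrite [X in continuous_at _ X](_ : _ = cst 0); first exact: cst_continuous.
    by apply/funext => z; rewrite big_nil.
  rewrite [X in continuous_at _ X](_ : _ = fun x : 'rV[R]_n => (x ord0 j - a ord0 j) ^+ 2 + \sum_(j <- s) (x ord0 j - a ord0 j) ^+ 2); last first.
    by apply/funext => z; rewrite big_cons.
  have cj : {for x, continuous (fun y : 'rV[R]_n => y ord0 j)} by exact: coord_continuous.
  have c1 : {for x, continuous (fun y : 'rV[R]_n => y ord0 j - a ord0 j)}.
    by exact: (cvgB cj (cvg_cst _)).
  exact: (cvgD (cvgM c1 c1) (IH x)).
by apply.
Qed.

Lemma moll_ge d f x c : 0 < d -> intg mu f ->
  (forall y, ball x d y -> c <= f y) -> c * km d <= moll k0 d f x.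
Proof.
move=> d0 fi H.
have := @moll_le R n d (fun y => - f y) x (- c) d0 (intgN fi).
have -> : moll k0 d (fun y => - f y) x = - moll k0 d f x.
  by rewrite /moll -JN; [apply: eqJ => y; rewrite mulNr|exact: intg_moll].
by rewrite mulNr lerN2; apply => y /H; rewrite lerN2.
Qed.

Lemma cboxE a (s : R) x : cbox a (const_mx s) x -> forall j, `|x ord0 j - a ord0 j| <= s.
Proof. by move=> h j; have := h j; rewrite mxE. Qed.

Lemma ball_cbox a (s : R) : ball a s `<=` cbox a (const_mx s).
Proof.
move=> x; have [s0|s0] := ltP 0 s; last by case; rewrite ltNge s0.
rewrite ball_rVE// => h j; rewrite mxE distrC ltW//; exact: h.
Qed.

Lemma cbox_ball a (s s' : R) : 0 < s' -> s < s' -> cbox a (const_mx s) `<=` ball a s'.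
Proof.
move=> s0 ss x /cboxE h; rewrite ball_rVE// => j.
by rewrite /ball /= distrC (le_lt_trans (h j)).
Qed.

(** The hypothesis says that the Laplacian of v is at least c > 0 in the sense
    of distributions. If v had a maximum at x0, then subtracting a small
    multiple of the squared distance to x0 from the convolution of v would
    produce an interior maximum at which second differences are positive. *)
Lemma strict_max_principle D v x0 c : (0 < n)%N -> open D -> (forall x, D x -> {for x, continuous v}) ->
  D x0 -> (forall x, D x -> v x <= v x0) -> 0 < c ->
  (forall x d, 0 < d -> cbox x (const_mx d) `<=` D ->
    c * km d <= \sum_i \int[mu]_y (v y * kern (k2 i) d x y)) -> False.
Proof.
move=> n0 oD cv Dx0 vmax c0 H.
have /nbhs_ballP[e /= e0 xe] : nbhs x0 D by exact: open_nbhs_nbhs.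
pose r := e / 3; have r0 : 0 < r by rewrite divr_gt0.
pose K := cbox x0 (const_mx (2 * r) : 'rV[R]_n).
have KD : K `<=` D.
  by move=> y /(@cbox_ball _ _ e e0) h; apply: xe; apply: h; rewrite /r; lra.
have cK : compact K by exact: cbox_compact.
pose f := v \_ K.
have fi : intg mu f by apply: L1loc_restrict (L1loc_continuous oD cv) cK KD.
have fE y : K y -> f y = v y by move=> Ky; rewrite /f patchE ifT// inE.
(* small enough to keep the Laplacian of the perturbed function positive *)
pose kap := c / (2 * n%:R + 1).
have nn0 : (0:R) < 2 * n%:R + 1 by rewrite ltr_wpDl// mulr_ge0.
have kap0 : 0 < kap by rewrite divr_gt0.
have kapc : 2 * n%:R * kap < c.
  by rewrite /kap mulrA ltr_pdivrMr// [_ * c]mulrC ltr_pM2l// ltrDl.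
(* on the boundary of B the perturbation is at least 2 eps, up to the mass of the
   kernel, and convolution changes the value at x0 by less than eps *)
pose eps := kap * r ^+ 2 / 2.
have eps0 : 0 < eps by rewrite divr_gt0// mulr_gt0// exprn_gt0.
have [d1 d10 Hd1] : exists2 d1 : R, 0 < d1 & forall y, ball x0 d1 y -> `|v x0 - v y| < eps.
  have /cvgrPdist_lt/(_ _ eps0) := cv _ Dx0.
  by move=> /nbhs_ballP[d1 /= ? h]; exists d1.
pose d := Num.min r d1 / 2.
have m0 : 0 < Num.min r d1 by rewrite lt_min r0.
have d0 : 0 < d by rewrite divr_gt0.
have : d < Num.min r d1 by rewrite ltr_pdivrMr// ltr_pMr// ltr1n.
rewrite lt_min => /andP[dr dd1].
have N0 := @kmass_gt0 R n d d0.
pose V x := moll k0 d f x - km d * kap * qd x0 x.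
pose B := cbox x0 (const_mx r : 'rV[R]_n).
have Bx0 : B x0 by move=> j; rewrite subrr normr0 mxE ltW.
have inK x y : B x -> ball x d y -> K y.
  move=> /cboxE Bx; rewrite ball_rVE// => xy j; rewrite mxE.
  have := Bx j; have := xy j; rewrite /ball /= => h1 h2.
  rewrite -(subrKA (x ord0 j)) (le_trans (ler_normD _ _))// mulrDl mul1r lerD//.
  by rewrite distrC ltW// (lt_trans h1).
have [||xs /[!inE] Bxs Vmax] := @compact_EVT_max _ R V B _ (cbox_compact (c:=x0) (d:=const_mx r)).
- by exists x0.
- apply: continuous_subspaceT => x.
  have cM : {for x, continuous (moll k0 d f)} by exact: (@moll_continuous R n k0 d f d0 fi x).
  have cQ : {for x, continuous (fun x => km d * kap * qd x0 x)}.
    by apply: continuous_scale; exact: qd_continuous.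
  exact: (cvgB cM cQ).
have Vx0 : km d * (v x0 - eps) <= V x0.
  rewrite /V (_ : qd x0 x0 = 0) ?mulr0 ?subr0; last first.
    by rewrite /qd big1// => j _; rewrite subrr expr0n.
  rewrite mulrC; apply: moll_ge => // y xy; rewrite fE; last exact: inK xy.
  have /Hd1 : ball x0 d1 y by exact: le_ball (ltW dd1) _ xy.
  by rewrite ltr_distlC => /andP[/ltW h _]; move: h; rewrite lerBlDr; lra.
(* the maximum of V on B is not attained on the boundary *)
have inter : ball x0 r xs.
  rewrite ball_rVE// => j; rewrite /ball /= distrC lt_neqAle (cboxE Bxs j) andbT.
  apply/eqP => /qd_ge hq.
  have h1 : moll k0 d f xs <= v x0 * km d.
    apply: moll_le => // y xy; rewrite fE; last exact: inK xy.
    by apply: vmax; apply: KD; exact: inK xy.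
  have h2 : V x0 <= V xs by apply: Vmax; rewrite inE.
  have h3 : km d * kap * r ^+ 2 <= km d * kap * qd x0 xs by rewrite ler_wpM2l// mulr_ge0// ltW.
  have h4 : 0 < km d * eps by rewrite mulr_gt0.
  have h5 : km d * kap * r ^+ 2 = 2 * (km d * eps) by rewrite /eps; field.
  move: h1 h2 h3 Vx0; rewrite /V mulrBr h5 [v x0 * _]mulrC.
  clear - h4; move: (km d * eps) (km d * v x0) (moll k0 d f xs) (km d * kap * qd x0 xs) h4
    (moll k0 d f x0 - km d * kap * qd x0 x0) => p1 p2 p3 p4 h4 p5; lra.
have [r' r'0 Hr'] : exists2 r' : R, 0 < r' & ball xs r' `<=` ball x0 r.
  have : nbhs xs (ball x0 r) by apply: open_nbhs_nbhs; split => //; exact: ball_open.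
  by move=> /nbhs_ballP[r' /= ? h]; exists r'.
have := @moll_local_max d f xs x0 (- (km d * kap)) r' d0 fi r'0.
have HV y : ball xs r' y -> moll k0 d f y + - (km d * kap) * qd x0 y <=
    moll k0 d f xs + - (km d * kap) * qd x0 xs.
  move=> /Hr'/ball_cbox By; rewrite !mulNr; apply: Vmax; rewrite inE; exact: By.
move=> /(_ HV) Hm.
have := H xs d d0 _; rewrite (eq_bigr (fun i => moll (k2 i) d f xs)); last first.
  move=> i _; apply: eqJ => y; have [xy|nxy] := pselect (ball xs d y).
    by rewrite fE//; exact: inK xy.
  by rewrite kern_out// !mulr0.
have bD : cbox xs (const_mx d) `<=` D.
  move=> y /cboxE xy; apply: KD => j; rewrite mxE.
  rewrite -(subrKA (xs ord0 j)) (le_trans (ler_normD _ _))// mulrDl mul1r lerD//.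
    by rewrite (le_trans (xy j))// ltW.
  exact: cboxE Bxs j.
move=> /(_ bD); have : km d * (2 * n%:R * kap) < km d * c by rewrite ltr_pM2l.
move: Hm; rewrite [c * _]mulrC mulrN [2 * _ * (km d * _)]mulrCA; lra.
Qed.

End maxprinciple.

(** * Weak derivatives of products and a bound outside a ball *)

Section products.
Variables (R : realType) (n : nat).
Local Notation mu := (@lebesgue_rV R n).
Local Notation e_ i := (delta_mx ord0 i : 'rV[R]_n).
Local Notation k0 := (fun=> 0%N).
Local Notation k1 i := (incr i k0).
Local Notation k2 i := (incr i (incr i k0)).
Local Notation km := (@kmass R n).
Implicit Types (f g u v w : 'rV[R]_n -> R) (D K : set 'rV[R]_n) (i : 'I_n) (a x y : 'rV[R]_n).

Lemma test_kern D k d x : 0 < d -> cbox x (const_mx d) `<=` D -> test_function D (kern k d x).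
Proof. by move=> d0 bD; apply: test_etaD => //; exact: const_gt0. Qed.

Lemma moll1_C1 G i x d : 0 < d -> C1 G ->
  moll (k1 i) d G x = - moll k0 d (pderiv i G) x.
Proof.
move=> d0 cG; have te : test_function setT (kern k0 d x) by exact: test_kern.
by have := weak_C1_test i cG te; rewrite pderiv_etaD.
Qed.

Lemma ext_C1 D i f g G K : open D -> is_weak_pderiv D i f g -> C1 G -> compact K -> K `<=` D ->
  (forall x, ~ K x -> G x = 0) ->
  \int[mu]_x (f x * pderiv i G x) = - \int[mu]_x (g x * G x).
Proof.
move=> oD wk cG cK KD G0; have [lf lg _] := wk; have [kG dG] := cG.
have dG0 x : ~ K x -> pderiv i G x = 0 by exact: pderiv_out (compact_closed_rV cK) G0.
apply: (@ext_weak R n D i f g G (pderiv i G) K) => //.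
- by apply: cs_integrable cK _ dG0; exact: (dG i).2.
- by move=> x d d0; exact: moll1_C1.
- by left; exact: (dG i).2.
- by apply: L1loc_mul lf cK KD _ dG0; exact: (dG i).2.
- exact: L1loc_mul lg cK KD _ G0.
Qed.

Lemma continuous_cs_mul D K f z : open D -> closed K -> K `<=` D ->
  (forall x, D x -> {for x, continuous f}) -> continuous z -> (forall x, ~ K x -> z x = 0) ->
  continuous (fun x => f x * z x).
Proof.
move=> oD clK KD cf cz z0 x; have [Dx|nDx] := pselect (D x).
  exact: (cvgM (cf _ Dx) (cz x)).
have nK : ~ K x by move/KD.
have nb : nbhs x (~` K) by apply: open_nbhs_nbhs; split => //; exact: closed_openC.
rewrite /continuous_at (z0 _ nK) mulr0.
apply/(@cvgrPdist_le _ _ _ (nbhs x) _ (fun x => f x * z x) 0) => e e0.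
by apply: filterS nb => y /z0 ->; rewrite mulr0 subrr normr0 ltW.
Qed.

(** Test the weak derivative of w against w z. This function is continuous with
    weak derivative g z + w D_i z, so that ext_weak applies with f = w
    continuous. *)
Lemma weak_square D i w g z : open D -> is_weak_pderiv D i w g ->
  (forall x, D x -> {for x, continuous w}) -> test_function D z ->
  \int[mu]_x (w x ^+ 2 * pderiv i z x) = - (2 * \int[mu]_x (w x * g x * z x)).
Proof.
move=> oD wk cw tz; have [lw lg _] := wk.
have [K [cK KD z0 dz0]] := test_supp tz.
have cz := test_C1 tz; have [kz dz] := cz.
have clK := compact_closed_rV cK.
pose G x := w x * z x; pose G' x := g x * z x + w x * pderiv i z x.
have G0 x : ~ K x -> G x = 0 by move=> /z0; rewrite /G => ->; rewrite mulr0.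
have G'0 x : ~ K x -> G' x = 0.
  by move=> nK; rewrite /G' z0// dz0// !mulr0 addr0.
have cG : continuous G by exact: continuous_cs_mul KD cw kz z0.
have cwdz : continuous (fun x => w x * pderiv i z x).
  by apply: continuous_cs_mul KD cw _ (dz0 i) => //; exact: (dz i).2.
have i1 : intg mu (fun x => g x * z x) by exact: L1loc_mul lg cK KD kz z0.
have i2 : intg mu (fun x => w x * pderiv i z x).
  by apply: L1loc_mul lw cK KD _ (dz0 i); exact: (dz i).2.
have i3 : intg mu (fun x => w x * g x * z x).
  apply: (@eq_intg _ _ _ mu (fun x => g x * (w x * z x))).
    by move=> x; rewrite mulrCA mulrA.
  exact: L1loc_mul lg cK KD cG G0.
have i4 : intg mu (fun x => w x ^+ 2 * pderiv i z x).
  apply: (@eq_intg _ _ _ mu (fun x => w x * (w x * pderiv i z x))).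
    by move=> x; rewrite mulrA expr2.
  by apply: L1loc_mul lw cK KD cwdz _ => x /(dz0 i) ->; rewrite mulr0.
have E : \int[mu]_x (w x * G' x) = - \int[mu]_x (g x * G x).
  apply: (@ext_weak R n D i w g G G' K) => //.
  - exact: intgD.
  - move=> x d d0.
    have ck : C1 (kern k0 d x) := C1_etaD 1 x (const_mx d) k0.
    have czk := C1M cz ck.
    have EE : \int[mu]_y (w y * pderiv i (fun y => z y * kern k0 d x y) y)
       = - \int[mu]_y (g y * (z y * kern k0 d x y)).
      by apply: (ext_C1 oD wk czk cK KD) => y /z0 ->; rewrite mul0r.
    rewrite /moll.
    have Ek : \int[mu]_y (w y * (z y * kern (k1 i) d x y + kern k0 d x y * pderiv i z y))
       = - \int[mu]_y (g y * (z y * kern k0 d x y)).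
      by rewrite -EE; apply: eqJ => y; rewrite (is_derive_pderiv (C1M_is i y cz ck)) pderiv_etaD.
    have [M M0 kM] := @kern_bounded R n (k1 i) d d0.
    have [M' M'0 kM'] := @kern_bounded R n k0 d d0.
    have j1 : intg mu (fun y => G y * kern (k1 i) d x y).
      apply: intgMb (kM x); first exact: cs_integrable cK cG G0.
      exact: kern_measurable.
    have j2 : intg mu (fun y => w y * pderiv i z y * kern k0 d x y).
      by apply: intgMb (kM' x) => //; exact: kern_measurable.
    have j3 : intg mu (fun y => g y * z y * kern k0 d x y).
      by apply: intgMb (kM' x) => //; exact: kern_measurable.
    rewrite (@eqJ _ _ _ mu (fun y => G' y * _) (fun y => g y * z y * kern k0 d x y + w y * pderiv i z y * kern k0 d x y)); last first.
      by move=> y; rewrite /G' mulrDl.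
    rewrite JD// opprD.
    rewrite (@eqJ _ _ _ mu (fun y => g y * z y * _) (fun y => g y * (z y * kern k0 d x y))); last first.
      by move=> y; rewrite mulrA.
    rewrite -Ek -JB//; last first.
      apply: eq_intg (intgD j1 j2) => y; rewrite /G; ring.
    apply: eqJ => y; rewrite /G; ring.
  - by right.
  - apply: (@eq_intg _ _ _ mu (fun x => w x * g x * z x + w x ^+ 2 * pderiv i z x)); last exact: intgD.
    by move=> x; rewrite /G'; ring.
  - by apply: eq_intg i3 => x; rewrite /G; ring.
have E1 : \int[mu]_x (w x * G' x) = \int[mu]_x (w x * g x * z x) + \int[mu]_x (w x ^+ 2 * pderiv i z x).
  by rewrite -JD//; apply: eqJ => x; rewrite /G'; ring.
have E2 : \int[mu]_x (g x * G x) = \int[mu]_x (w x * g x * z x).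
  by apply: eqJ => x; rewrite /G; ring.
move: E; rewrite E1 E2; set P := \int[mu]_x (w x * g x * z x); set Q := Rintegral _ _ _; lra.
Qed.

End products.

Section exterior.
Variables (R : realType) (n : nat).
Local Notation mu := (@lebesgue_rV R n).
Local Notation k0 := (fun=> 0%N).
Local Notation k2 i := (incr i (incr i k0)).
Local Notation km := (@kmass R n).

Lemma kern_le1 d (x y : 'rV[R]_n) : 0 < d -> kern k0 d x y <= 1.
Proof. by move=> d0; exact: eta_le1. Qed.

Lemma intg_tail (f : 'rV[R]_n -> R) e : intg mu f -> 0 < e ->
  exists r : R, \int[mu]_y (`|f y| * \1_[set y : 'rV[R]_n | r <= `|y|] y) <= e.
Proof.
move=> fi e0.
have mS (r : R) : measurable [set y : 'rV[R]_n | r <= `|y|].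
  have := measurable_ball_rV (0 : 'rV[R]_n) r => /measurableC.
  congr measurable; apply/seteqP; split => y; rewrite -ball_normE /= sub0r normrN leNgt.
    by move/negP.
  by move/negP.
have C0 (k : nat) : measurable_fun setT (fun y => `|f y| * \1_[set y : 'rV[R]_n | k%:R <= `|y|] y).
  apply: measurable_funM; last exact: measurable_indic.
  by apply: measurableT_comp => //; exact: intg_measurable fi.
have C1 y : (fun k : nat => `|f y| * \1_[set y : 'rV[R]_n | k%:R <= `|y|] y) @ \oo --> (0 : R).
  apply: cvg_near_cst; near=> k; rewrite indicE memNset ?mulr0//=; apply/negP.
  rewrite -ltNge; near: k; exists (Num.trunc `|y|).+1 => // k /= hk.
  by apply: lt_le_trans (truncnS_gt _) _; rewrite ler_nat.
have C2 (k : nat) y : `| `|f y| * \1_[set y : 'rV[R]_n | k%:R <= `|y|] y | <= `|f y|.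
  rewrite normrM normr_id ler_piMr// indicE; case: (_ \in _); by rewrite ?normr1 ?normr0.
have [_ C] := dctJ C0 C1 C2 (intg_norm fi).
rewrite J0 in C; have /cvgrPdist_le/(_ _ e0) [N _ HN] := C.
exists N%:R; have := HN N (leqnn N); rewrite sub0r normrN; apply: le_trans; exact: ler_norm.
Unshelve. all: by end_near. Qed.

(** A function that is integrable and subharmonic outside the unit ball is
    bounded there by its values near the inner boundary: its convolutions tend
    to 0 at infinity because the tails of the integral do, so the maximum
    principle applies on a large annulus. *)
Lemma exterior_bound (f : 'rV[R]_n -> R) M0 : (0 < n)%N -> intg mu f -> 0 <= M0 ->
  (forall x : 'rV[R]_n, 1 < `|x| -> {for x, continuous f}) ->
  (forall x : 'rV[R]_n, 1 <= `|x| -> `|x| <= 3 -> f x <= M0) ->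
  (forall (x : 'rV[R]_n) d, 0 < d -> d < 1 -> 2 <= `|x| -> 0 <= \sum_i moll (k2 i) d f x) ->
  forall x : 'rV[R]_n, 2 <= `|x| -> f x <= M0.
Proof.
move=> n0 fi M00 cf fM fsub x1 x12; rewrite leNgt; apply/negP => fx1.
(* with N the mass of the kernel, the convolution of f exceeds (M0 + 3 tau) N at
   x1, while it is at most M0 N on the inner sphere and tau N far away *)
pose tau := (f x1 - M0) / 4.
have tau0 : 0 < tau by rewrite divr_gt0// subr_gt0.
have fx1E : f x1 = M0 + 4 * tau by rewrite /tau; field.
have [d1 d10 Hd1] : exists2 d1 : R, 0 < d1 & forall y, ball x1 d1 y -> `|f x1 - f y| < tau.
  have c1 := cf x1 (lt_le_trans (ltr1n R 2) x12).
  have /cvgrPdist_lt/(_ _ tau0) := c1.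
  by move=> /nbhs_ballP[d1 /= ? h]; exists d1.
pose d := Num.min 1 d1 / 2.
have m0 : 0 < Num.min 1 d1 by rewrite lt_min ltr01.
have d0 : 0 < d by rewrite divr_gt0.
have : d < Num.min 1 d1 by rewrite ltr_pdivrMr// ltr_pMr// ltr1n.
rewrite lt_min => /andP[d11 dd1].
have N0 := @kmass_gt0 R n d d0; set N := km d in N0.
have ht : 0 < tau * N by rewrite mulr_gt0.
have [r Hr] := intg_tail fi ht.
pose R0 := Num.max (r + 1) (`|x1| + 1).
have x1R : `|x1| < R0 by rewrite lt_max ltrDl ltr01 orbT.
have R00 : 0 < R0 by apply: le_lt_trans x1R.
have far x : R0 <= `|x| -> moll k0 d f x <= tau * N.
  move=> xR; apply: le_trans Hr; apply: le_J.
  - exact: intg_moll.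
  - apply: (@intgMb _ _ _ mu _ _ 1 (intg_norm fi)).
      apply: measurable_indic; have := measurable_ball_rV (0 : 'rV[R]_n) r => /measurableC.
      congr measurable; apply/seteqP; split => y; rewrite -ball_normE /= sub0r normrN leNgt.
        by move/negP.
      by move/negP.
    by move=> y; rewrite indicE; case: (_ \in _); rewrite ?normr1 ?normr0.
  - move=> y; have [xy|nxy] := pselect (ball x d y); last first.
      by rewrite kern_out// mulr0 mulr_ge0.
    rewrite indicE mem_set ?mulr1 /=.
      rewrite (le_trans (ler_norm _))// normrM ler_piMr// ger0_norm ?kern_ge0 ?kern_le1//.
    move: xy; rewrite -ball_normE /= => xy.
    have : `|x| - `|y| <= `|x - y| by rewrite lerB_dist.
    have : r + 1 <= `|x| by apply: le_trans xR; rewrite le_max lexx.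
    move: xy d11; move: `|x| `|y| `|x - y| => p1 p2 p3; lra.
(* the perturbation is at most tau N on the annulus *)
pose kap := tau * N / (n%:R * R0 ^+ 2 + 1).
have nn0 : 0 < n%:R * R0 ^+ 2 + 1 by rewrite ltr_wpDl// mulr_ge0// exprn_ge0// ltW.
have kap0 : 0 < kap by rewrite divr_gt0.
have kq (x : 'rV[R]_n) : `|x| <= R0 -> kap * qd 0 x <= tau * N.
  move=> xR; rewrite /kap mulrAC ler_pdivrMr// ler_wpM2l ?(ltW ht)//.
  apply: (@le_trans _ _ (n%:R * R0 ^+ 2)); last by rewrite lerDl.
  rewrite /qd; apply: (@le_trans _ _ (\sum_(j < n) R0 ^+ 2)); last first.
    by rewrite sumr_const card_ord -[leLHS]mulr_natl.
  apply: ler_sum => j _; rewrite mxE subr0 -real_normK ?num_real// lerXn2r ?nnegrE//.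
    exact: ltW.
  by apply: le_trans xR; exact: coord_le_norm.
pose S := [set x : 'rV[R]_n | 2 <= `|x| /\ `|x| <= R0].
have cS : compact S.
  apply: bounded_closed_compact.
    by exists R0; split; [exact: num_real|move=> z Rz x [_ xR]; exact: le_trans xR (ltW Rz)].
  rewrite (_ : S = (fun x : 'rV[R]_n => `|x|) @^-1` [set s | 2 <= s] `&` (fun x : 'rV[R]_n => `|x|) @^-1` [set s | s <= R0])//.
  apply: closedI; apply: closed_comp; [|exact: closed_ge| |exact: closed_le].
    by move=> x _; exact: norm_continuous.
  by move=> x _; exact: norm_continuous.
pose V x := moll k0 d f x + kap * qd 0 x.
have [||xs /[!inE] Sxs Vmax] := @compact_EVT_max _ R V S _ cS.
- by exists x1; split => //; exact: ltW.
- apply: continuous_subspaceT => x.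
  have cM : {for x, continuous (moll k0 d f)} by exact: (@moll_continuous R n k0 d f d0 fi x).
  have cQ : {for x, continuous (fun x => kap * qd 0 x)}.
    by apply: continuous_scale; exact: qd_continuous.
  exact: (cvgD cM cQ).
have Vx1 : (M0 + 3 * tau) * N <= V x1.
  rewrite /V -[leLHS]addr0 lerD//; last first.
    by rewrite mulr_ge0 ?(ltW kap0)//; apply: sumr_ge0 => j _; exact: sqr_ge0.
  apply: moll_ge => // y xy.
  have /Hd1 : ball x1 d1 y by exact: le_ball (ltW dd1) _ xy.
  by rewrite ltr_distlC fx1E => /andP[/ltW h _]; move: h; lra.
have {}Vx1 : M0 * N + 3 * (tau * N) <= V x1 by move: Vx1; rewrite mulrDl -[3 * tau * N]mulrA.
have VV : V x1 <= V xs by apply: Vmax; rewrite inE; split => //; exact: ltW.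
have VE : V xs = moll k0 d f xs + kap * qd 0 xs by [].
have [xs2 xsR] := Sxs.
have tN : 0 < tau * N by [].
(* the maximum is attained neither on the inner sphere nor on the outer one *)
have i2 : `|xs| != 2.
  apply/eqP => E.
  have h1 : moll k0 d f xs <= M0 * N.
    apply: moll_le => // y; rewrite -ball_normE /= => xy.
    have h2 : `|xs| - `|y| <= `|xs - y| by rewrite lerB_dist.
    have h3 : `|y| - `|xs| <= `|xs - y| by rewrite distrC lerB_dist.
    by apply: fM; move: h2 h3 xy d11; rewrite E; move: `|y| `|xs - y| => p1 p2; lra.
  have h2 := kq _ xsR.
  move: VV Vx1; rewrite VE; move: (V x1) (M0 * N) (moll k0 d f xs) (kap * qd 0 xs) (tau * N) h1 h2 tN
    => p1 p2 p3 p4 p5 h1 h2 tN; lra.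
have iR : `|xs| != R0.
  apply/eqP => E; have h1 := far xs; rewrite E lexx in h1; have {}h1 := h1 isT.
  have h2 := kq _ xsR; have h3 : 0 <= M0 * N by rewrite mulr_ge0// ltW.
  move: VV Vx1; rewrite VE; move: (V x1) (M0 * N) (moll k0 d f xs) (kap * qd 0 xs) (tau * N) h1 h2 h3 tN
    => p1 p2 p3 p4 p5 h1 h2 h3 tN; lra.
have xs2' : 2 < `|xs| by rewrite lt_neqAle eq_sym i2.
have xsR' : `|xs| < R0 by rewrite lt_neqAle iR.
pose r' := Num.min (`|xs| - 2) (R0 - `|xs|).
have r'0 : 0 < r' by rewrite lt_min !subr_gt0 xs2'.
have HV y : ball xs r' y -> moll k0 d f y + kap * qd 0 y <= moll k0 d f xs + kap * qd 0 xs.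
  rewrite -ball_normE /= lt_min => /andP[h1 h2]; apply: Vmax; rewrite inE; split.
    have : `|xs| - `|y| <= `|xs - y| by rewrite lerB_dist.
    by move: h1; move: `|xs| `|y| `|xs - y| => p1 p2 p3; lra.
  have : `|y| - `|xs| <= `|xs - y| by rewrite distrC lerB_dist.
  by move: h2; move: `|xs| `|y| `|xs - y| => p1 p2 p3; lra.
have := moll_local_max d0 fi r'0 HV.
have := fsub xs d d0 d11 (ltW xs2').
have : 0 < 2 * n%:R * kap by rewrite mulr_gt0// mulr_gt0// ltr0n.
lra.
Qed.

End exterior.

(** * The radial profile of the transform *)

Section radial.
Variables (R : realType) (n : nat) (A L : R).
Hypotheses (n2 : (2 <= n)%N) (A0 : 0 < A) (L0 : 0 < L).
Local Notation rho := (@rho R n A L).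
Implicit Types t r s : R.

(** The constant c such that A |x|^(2-n), or A log (1/|x|), has derivative
    - c r^(1-n) with respect to r. *)
Definition cA : R := if n == 2%N then A else A * (n%:R - 2).

(** The radial fundamental solution, up to a constant factor: its derivative
    is - r^(1-n) in every dimension, which treats n = 2 and n >= 3 at once. *)
Definition kap (r : R) : R := if n == 2%N then - ln r else (n%:R - 2)^-1 * r^-1 ^+ (n - 2).

Let n0 : (0 : R) < n%:R. Proof. by rewrite ltr0n (leq_trans _ n2). Qed.

Let nm2 : n != 2%N -> (0 : R) < n%:R - 2.
Proof. by move=> nn; rewrite subr_gt0 ltr_nat ltn_neqAle eq_sym nn. Qed.

Lemma cA_gt0 : 0 < cA.
Proof. by rewrite /cA; case: eqVneq => // /nm2 h; rewrite mulr_gt0. Qed.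

Lemma is_derive_kap (r : R) : 0 < r -> is_derive r 1 kap (- r^-1 ^+ n.-1).
Proof.
move=> r0; rewrite /kap; case: eqVneq => [->|nn].
  by rewrite expr1; exact: (is_deriveN (is_derive1_ln r0)).
have dV : is_derive r 1 (fun y : R => y^-1) (- r^-1 ^+ 2).
  have -> : - r^-1 ^+ 2 = - r ^- 2 *: (1 : R) by rewrite [_ *: _]mulr1 exprVn.
  by apply: is_deriveV; rewrite gt_eqF.
have n3 : (n - 2 = (n - 3).+1)%N.
  by move: nn n2; case: n => [|[|[|k]]]//=; rewrite !subSS !subn0.
have dX : is_derive r 1 (fun y : R => y^-1 ^+ (n - 2)) ((n - 2)%:R * r^-1 ^+ (n - 3) * - r^-1 ^+ 2).
  by have := is_deriveX (n - 2) dV; rewrite exprfctE n3.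
apply: (is_derive_eq (is_deriveZ (n%:R - 2)^-1 dX)).
rewrite /GRing.scale /= natrB//.
transitivity (- (r^-1 ^+ (n - 3) * r^-1 ^+ 2)).
  by move: (r^-1) => p; field; rewrite gt_eqF ?nm2.
rewrite -exprD; congr (- (_ ^+ _)).
by move: nn n2; case: n => [|[|[|k]]]//= _ _; rewrite !subSS subn0 addn2.
Qed.

Lemma kap_le (r s : R) : 0 < r -> r <= s -> kap s <= kap r.
Proof.
move=> r0 rs; have s0 := lt_le_trans r0 rs.
rewrite /kap; case: eqVneq => [_|nn]; first by rewrite lerN2 ler_ln.
rewrite ler_wpM2l ?invr_ge0 ?(ltW (nm2 nn))// lerXn2r ?nnegrE ?invr_ge0 ?(ltW r0) ?(ltW s0)//.
by rewrite lef_pV2.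
Qed.

Lemma rhoE t : rho t = (cA * n%:R / L * t) `^ (n%:R^-1).
Proof.
rewrite /Defs.rho /cA; case: eqVneq => [->|_]; congr (_ `^ _); first by field; rewrite gt_eqF.
by field; rewrite gt_eqF.
Qed.

Let cnL0 : 0 < cA * n%:R / L.
Proof. by rewrite divr_gt0// mulr_gt0// cA_gt0. Qed.

Lemma rho_gt0 t : 0 < t -> 0 < rho t.
Proof. by move=> t0; rewrite rhoE powR_gt0// mulr_gt0. Qed.

Lemma rhoXn t : 0 < t -> rho t ^+ n = cA * n%:R / L * t.
Proof.
move=> t0; rewrite rhoE -powR_mulrn ?powR_ge0// -powRrM mulVf ?gt_eqF// powRr1//.
by rewrite ltW// mulr_gt0.
Qed.

Lemma derivable_rho t : 0 < t -> exists d, is_derive t 1 rho d.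
Proof.
move=> t0; rewrite (_ : rho = (fun s => s `^ n%:R^-1) \o (fun s => cA * n%:R / L * s)); last first.
  by apply/funext => s; rewrite /= rhoE.
have dl : is_derive t 1 (fun s => cA * n%:R / L * s) (cA * n%:R / L).
  have := is_deriveZ (cA * n%:R / L) (is_derive_id t 1) => H.
  by apply: (is_derive_eq H); rewrite [_ *: _]mulr1.
eexists; apply: (@is_derive1_comp _ (fun s => s `^ n%:R^-1) (fun s => cA * n%:R / L * s)) => //.
by apply: is_derive1_powR; rewrite mulr_gt0.
Qed.

Definition Ecst t : R := cA * t * kap (rho t) + L / (2 * n%:R) * rho t ^+ 2.
(** The closed form of the transform inside the free boundary; the constant
    Ecst is the value that makes it vanish at rho t. *)
Definition Eprof t r : R := cA * t * kap r + L / (2 * n%:R) * r ^+ 2 - Ecst t.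
(** The derivative of the profile is - r times this positive part, which
    vanishes exactly outside the free boundary. *)
Definition slope t r : R := Num.max 0 (cA * t * r^-1 ^+ n - L / n%:R).
Definition uprof t r : R := if r < rho t then Eprof t r else 0.

Lemma expSn (x : R) : x ^+ n = x * x ^+ n.-1.
Proof. by rewrite -exprS prednK// (leq_trans _ n2). Qed.

(** The motion of the free boundary does not contribute, because the profile has
    a double zero at rho t. *)
Lemma is_derive_Ecst t : 0 < t -> is_derive t 1 Ecst (cA * kap (rho t)).
Proof.
move=> t0; have [d dr] := derivable_rho t0; have r0 := rho_gt0 t0.
have dk : is_derive t 1 (fun s => kap (rho s)) (- (rho t)^-1 ^+ n.-1 * d).
  by apply: (@is_derive1_comp _ kap rho) => //; exact: is_derive_kap.
have dl : is_derive t 1 (fun s : R => cA * s) cA.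
  by apply: (is_derive_eq (is_deriveZ cA (is_derive_id t 1))); rewrite [_ *: _]mulr1.
have d1 := is_deriveM dl dk; have d2 := is_deriveZ (L / (2 * n%:R)) (is_deriveX 2 dr).
apply: (is_derive_eq (is_deriveD d1 d2)); rewrite /GRing.scale /=.
have H : cA * t * (rho t)^-1 ^+ n.-1 = L / n%:R * rho t.
  have : rho t * rho t ^+ n.-1 = cA * n%:R / L * t by rewrite -expSn rhoXn.
  rewrite exprVn => E; have -> : cA * t = L / n%:R * (rho t * rho t ^+ n.-1).
    by rewrite E; field; rewrite !gt_eqF.
  by rewrite mulrA mulfK// gt_eqF// exprn_gt0.
transitivity (cA * kap (rho t) + d * (L / n%:R * rho t - cA * t * (rho t)^-1 ^+ n.-1)).
  by field; rewrite gt_eqF.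
by rewrite H subrr mulr0 addr0.
Qed.

Lemma is_derive_Eprof_t t r : 0 < t ->
  is_derive t 1 (Eprof ^~ r) (cA * (kap r - kap (rho t))).
Proof.
move=> t0; have dl : is_derive t 1 (fun s : R => cA * kap r * s + L / (2 * n%:R) * r ^+ 2) (cA * kap r).
  have H := is_deriveD (is_deriveZ (cA * kap r) (is_derive_id t 1)) (is_derive_cst (L / (2 * n%:R) * r ^+ 2) t 1).
  by apply: (is_derive_eq H); rewrite [_ *: _]mulr1 addr0.
have -> : Eprof ^~ r = (fun s : R => cA * kap r * s + L / (2 * n%:R) * r ^+ 2) - Ecst.
  by apply/funext => s; rewrite /Eprof mulrAC.
by apply: (is_derive_eq (is_deriveB dl (is_derive_Ecst t0))); rewrite mulrBr.
Qed.

Lemma is_derive_Eprof t r : 0 < r ->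
  is_derive r 1 (Eprof t) (- (r * (cA * t * r^-1 ^+ n - L / n%:R))).
Proof.
move=> r0; have d1 := is_deriveZ (cA * t) (is_derive_kap r0).
have d2 := is_deriveZ (L / (2 * n%:R)) (is_deriveX 2 (is_derive_id r 1)).
have d3 := is_deriveB (is_deriveD d1 d2) (is_derive_cst (Ecst t) r 1).
apply: (is_derive_eq d3); rewrite /GRing.scale /= subr0 expSn.
move: (r^-1 ^+ n.-1) => p; field.
by rewrite !gt_eqF.
Qed.

Lemma slopeE t r : 0 < t -> 0 < r ->
  slope t r = if r < rho t then cA * t * r^-1 ^+ n - L / n%:R else 0.
Proof.
move=> t0 r0; have h0 := rho_gt0 t0.
have K : cA * t = L / n%:R * rho t ^+ n by rewrite rhoXn//; field; rewrite !gt_eqF.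
have -> : cA * t * r^-1 ^+ n - L / n%:R = L / n%:R * ((rho t / r) ^+ n - 1).
  by rewrite K expr_div_n exprVn mulrBr mulr1 mulrA.
rewrite /slope; have Ln : 0 < L / n%:R by rewrite divr_gt0.
have -> : cA * t * r^-1 ^+ n - L / n%:R = L / n%:R * ((rho t / r) ^+ n - 1).
  by rewrite K expr_div_n exprVn mulrBr mulr1 mulrA.
case: ltP => hr; [rewrite max_r//|rewrite max_l//].
  rewrite mulr_ge0 ?(ltW Ln)// subr_ge0 exprn_ege1// ler_pdivlMr// mul1r ltW//.
rewrite pmulr_rle0// subr_le0 exprn_ile1// ?divr_ge0 ?(ltW h0) ?(ltW r0)//.
by rewrite ler_pdivrMr// mul1r.
Qed.

Lemma Eprof_rho t : Eprof t (rho t) = 0.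
Proof. by rewrite /Eprof subrr. Qed.

Lemma is_derive_uprof t r : 0 < t -> 0 < r -> is_derive r 1 (uprof t) (- (r * slope t r)).
Proof.
move=> t0 r0; have h0 := rho_gt0 t0.
rewrite slopeE//; have [hr|hr|hr] := ltgtP r (rho t).
- apply: (@near_eq_is_derive _ _ _ (Eprof t)); last exact: is_derive_Eprof.
  near=> y; rewrite /uprof ifT//; near: y; exact: lt_nbhsl.
- rewrite mulr0 oppr0; apply: (@near_eq_is_derive _ _ _ (cst 0)).
  by near=> y; rewrite /uprof ifF//; apply/negbTE; rewrite -leNgt ltW//; near: y; exact: lt_nbhsr.
- rewrite mulr0 oppr0 hr; rewrite /uprof; apply: is_derive1_glue.
  + exact: Eprof_rho.
  + apply: (is_derive_eq (is_derive_Eprof t h0)).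
    rewrite exprVn rhoXn// [X in - (_ * X)](_ : _ = 0) ?mulr0 ?oppr0//.
    by field; rewrite !gt_eqF// cA_gt0.
Unshelve. all: by end_near. Qed.

Lemma uprof_gt0 t r : 0 < t -> 0 < r -> r < rho t -> 0 < uprof t r.
Proof.
move=> t0 r0 hr; have dE s : s \in `]r, rho t[ -> is_derive s 1 (Eprof t) (- (s * (cA * t * s^-1 ^+ n - L / n%:R))).
  by rewrite in_itv/= => /andP[rs _]; apply: is_derive_Eprof; exact: lt_trans rs.
have cE : {within `[r, rho t], continuous (Eprof t)}.
  apply: continuous_in_subspaceT => s /[!inE] /=; rewrite in_itv/= => /andP[rs _].
  have s0 : 0 < s by exact: lt_le_trans rs.
  apply/differentiable_continuous/derivable1_diffP.
  by have [] := is_derive_Eprof t s0.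
have [s + E] := MVT hr dE cE; rewrite in_itv/= => /andP[rs sr].
have s0 : 0 < s by exact: lt_trans rs.
rewrite /uprof hr; move: E; rewrite Eprof_rho sub0r => /eqP; rewrite eqr_oppLR => /eqP ->.
have Ln : 0 < L / n%:R by rewrite divr_gt0.
rewrite -mulNr opprK mulr_gt0 ?subr_gt0// mulr_gt0//.
have K : cA * t = L / n%:R * rho t ^+ n by rewrite rhoXn//; field; rewrite !gt_eqF.
have -> : cA * t * s^-1 ^+ n - L / n%:R = L / n%:R * ((rho t / s) ^+ n - 1).
  by rewrite K expr_div_n exprVn mulrBr mulr1 mulrA.
have h1 : 1 < rho t / s by rewrite ltr_pdivlMr// mul1r.
have h2 : n != 0%N by rewrite -lt0n (leq_trans _ n2).
by rewrite mulr_gt0// subr_gt0 exprn_egt1.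
Qed.

Lemma V_ALE (x : 'rV[R]_n) (s : R) : 0 < enorm x -> 0 < s ->
  V_AL A L x s = cA * Num.max 0 (kap (enorm x) - kap (rho s)).
Proof.
move=> x0 s0; have h0 := rho_gt0 s0.
rewrite /V_AL gt_eqF// /cA /kap; case: eqVneq => [_|nn].
  by rewrite ln_div ?posrE// opprK addrC.
have -> : (2 - n%:Z)%R = - (n - 2)%:Z by rewrite -opprB -subzn.
rewrite -!exprnN -!exprVn -mulrBr -mulrA; congr (A * _).
by rewrite maxr_pMr ?(ltW (nm2 nn))// mulr0 mulrA mulfV ?mul1r// gt_eqF ?nm2.
Qed.

(** V vanishes until the time tau at which the free boundary reaches |x|, and
    afterwards V is the time derivative of Eprof, which vanishes at time tau. *)
Lemma U_ALE (x : 'rV[R]_n) (t : R) : 0 < enorm x -> 0 < t ->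
  U_AL A L x t = uprof t (enorm x).
Proof.
move=> x0 t0; set r := enorm x in x0 *.
(* the time at which the free boundary reaches r *)
pose tau := L * r ^+ n / (cA * n%:R).
have c0 := cA_gt0.
have tau0 : 0 < tau by rewrite divr_gt0// mulr_gt0// exprn_gt0.
have tauE : cA * n%:R / L * tau = r ^+ n.
  by rewrite /tau; field; rewrite !gt_eqF.
have rle s : 0 < s -> (rho s <= r) = (s <= tau).
  move=> s0; have h0 := rho_gt0 s0.
  rewrite -(@ler_pXn2r _ n) ?nnegrE ?(ltW h0) ?(ltW x0)//; last exact: leq_trans n2.
  by rewrite rhoXn// -tauE ler_pM2l.
have rlt s : 0 < s -> (r < rho s) = (tau < s) by move=> s0; rewrite !ltNge rle.
rewrite /U_AL /uprof rlt//.
have V0 s : 0 <= s -> s <= tau -> V_AL A L x s = 0.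
  move=> s0 st; have [->|sn0] := eqVneq s 0; first by rewrite /V_AL eqxx.
  have {sn0}s0 : 0 < s by rewrite lt_neqAle eq_sym sn0.
  rewrite V_ALE// max_l ?mulr0// subr_le0.
  by apply: kap_le; rewrite ?rho_gt0 ?rle.
case: ltP => tt; last first.
  rewrite (@eq_Rintegral _ _ _ _ _ (fun=> 0)) ?Rintegral0//.
    by rewrite /Rintegral integral0.
  move=> s; rewrite inE/= in_itv/= => /andP[s0 st]; apply: V0 => //; exact: le_trans tt.
have E0 : Eprof tau r = 0.
  have -> : r = rho tau; last exact: Eprof_rho.
  have h0 := rho_gt0 tau0.
  by apply/eqP; rewrite -(@eqrXn2 _ n) ?(ltW h0) ?(ltW x0) ?rhoXn ?tauE// (leq_trans _ n2).
have FTC : (\int[lebesgue_measure]_(s in `[tau, t]) (V_AL A L x s)%:E = (Eprof t r)%:E - (Eprof tau r)%:E)%E.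
  transitivity (\int[lebesgue_measure]_(s in `[tau, t]) (cA * (kap r - kap (rho s)))%:E)%E.
    apply: eq_integral => s; rewrite inE/= in_itv/= => /andP[s0 st]; rewrite V_ALE//; last exact: lt_le_trans s0.
    rewrite max_r// subr_ge0; apply: kap_le => //.
    have s00 : 0 < s by exact: lt_le_trans s0.
    have h0 := rho_gt0 s00.
    rewrite -/r -(@ler_pXn2r _ n) ?nnegrE ?(ltW x0) ?(ltW h0)//; last exact: leq_trans n2.
    by rewrite rhoXn// -tauE ler_pM2l.
  apply: (@continuous_FTC2 R (fun s => cA * (kap r - kap (rho s))) (Eprof ^~ r)) => //.
  - apply: continuous_in_subspaceT => s /[!inE] /=; rewrite in_itv/= => /andP[ts _].
    have s0 : 0 < s by exact: lt_le_trans ts.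
    have [d dr] := derivable_rho s0.
    have dk : is_derive s 1 (fun s => kap (rho s)) (- (rho s)^-1 ^+ n.-1 * d).
      by apply: (@is_derive1_comp _ kap rho) => //; apply: is_derive_kap; exact: rho_gt0.
    have := is_deriveZ cA (is_deriveB (is_derive_cst (kap r) s 1) dk) => -[H _].
    exact/differentiable_continuous/derivable1_diffP.
  - have cE s : 0 < s -> {for s, continuous (Eprof ^~ r)}.
      move=> s0; apply/differentiable_continuous/derivable1_diffP.
      by have [] := is_derive_Eprof_t r s0.
    split.
    + move=> s; rewrite in_itv/= => /andP[ts _].
      by have [] := is_derive_Eprof_t r (lt_trans tau0 ts).
    + by apply: cvg_at_right_filter; exact: cE.
    + by apply: cvg_at_left_filter; exact: cE.
  - move=> s; rewrite in_itv/= => /andP[ts _]; rewrite derive1E.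
    by have [_ ->] := is_derive_Eprof_t r (lt_trans tau0 ts).
transitivity (\int[lebesgue_measure]_(s in `[tau, t]) V_AL A L x s).
  rewrite Rintegral_mkcond [RHS]Rintegral_mkcond; apply: eq_Rintegral => s _.
  rewrite !patchE !mem_setE !in_itv /=; have [st|st] := leP tau s.
    by rewrite (le_trans (ltW tau0) st).
  by case: ifPn => // /andP[s0 _]; apply: V0 => //; exact: ltW.
by rewrite /Rintegral FTC E0 sube0.
Qed.

End radial.

(** * Radial functions and a smoothed positive part *)

Section radial_calculus.
Variables (R : realType) (n : nat).
Local Notation mu := (@lebesgue_rV R n).
Local Notation e_ i := (delta_mx ord0 i : 'rV[R]_n).
Implicit Types (f g : R -> R) (i : 'I_n) (a x y : 'rV[R]_n).

(** Replaces f on the left of b by its tangent at b. Applied to functions of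
    the squared distance, it removes the singularity at the origin and keeps
    the function of class C^1. *)
Definition extlin (b : R) f df (q : R) : R := if q < b then f b + df b * (q - b) else f q.

Lemma is_derive_extlin b f df : 0 < b -> (forall q : R, 0 < q -> is_derive q 1 f (df q)) ->
  forall q : R, is_derive q 1 (extlin b f df) (df (Num.max b q)).
Proof.
move=> b0 fd q.
have dl (z : R) : is_derive z 1 (fun q => f b + df b * (q - b)) (df b).
  have -> : (fun q => f b + df b * (q - b)) = horner ((f b)%:P + df b *: ('X - b%:P)).
    by apply/funext => y; rewrite !hornerE.
  apply: (is_derive_eq (is_derive_poly _ _)).
  by rewrite derivD derivC derivZ derivB derivX derivC subr0 add0r hornerZ -polyC1 hornerC mulr1.
have [qb|bq|qb] := ltgtP q b.
- apply: (@near_eq_is_derive _ _ _ (fun q => f b + df b * (q - b))).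
  near=> y; rewrite /extlin ifT//; near: y; exact: lt_nbhsl.
- apply: (@near_eq_is_derive _ _ _ f); last exact: fd (lt_trans b0 bq).
  by near=> y; rewrite /extlin ifF//; apply/negbTE; rewrite -leNgt ltW//; near: y; exact: lt_nbhsr.
- rewrite qb; apply: is_derive1_glue; first by rewrite subrr mulr0 addr0.
  exact: fd.
Unshelve. all: by end_near. Qed.

Lemma is_derive_coord i j x : is_derive x (e_ i) (fun x : 'rV[R]_n => x ord0 j) (j == i)%:R.
Proof.
apply/is_derive_lineP.
have -> : (fun h : R => (h *: e_ i + x) ord0 j) = horner ((j == i)%:R *: 'X + (x ord0 j)%:P).
  by apply/funext => h; rewrite !mxE !hornerE /= mulrC.
apply: (is_derive_eq (is_derive_poly _ _)).
by rewrite derivD derivZ derivX derivC addr0 hornerZ -polyC1 hornerC mulr1.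
Qed.

Lemma is_derive_qd i a x : is_derive x (e_ i) (qd a) (2 * (x ord0 i - a ord0 i)).
Proof.
apply/is_derive_lineP.
have -> : (fun h : R => qd a (h *: e_ i + x)) =
   horner ((qd a x)%:P + (2 * (x ord0 i - a ord0 i)) *: 'X + 'X^2).
  apply/funext => h; rewrite !hornerE /qd (bigD1 i)//= [in RHS](bigD1 i)//= !mxE !eqxx mulr1.
  rewrite (eq_bigr (fun j => (x ord0 j - a ord0 j) ^+ 2)); first ring.
  by move=> j ji; rewrite !mxE (negbTE ji) mulr0 add0r.
apply: (is_derive_eq (is_derive_poly _ _)).
rewrite !derivD derivC derivZ derivX derivXn add0r !hornerE /=.
by rewrite !addr0.
Qed.

Lemma C1_coord j : C1 (fun x : 'rV[R]_n => x ord0 j).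
Proof.
split; first by move=> x; exact: coord_continuous.
move=> i; split; first by move=> x; have [] := is_derive_coord i j x.
rewrite (_ : pderiv i _ = cst (j == i)%:R); first exact: cst_continuous.
by apply/funext => x; apply: is_derive_pderiv; exact: is_derive_coord.
Qed.

Lemma C1_cst (c : R) : C1 (fun _ : 'rV[R]_n => c).
Proof.
split; first exact: cst_continuous.
move=> i; split; first by move=> x; have [] := is_derive_cst c x (e_ i).
rewrite (_ : pderiv i _ = cst 0); first exact: cst_continuous.
by apply/funext => x; apply: is_derive_pderiv; exact: is_derive_cst.
Qed.

Lemma is_derive_radial i a x g dg : (forall q : R, is_derive q 1 g (dg q)) ->
  is_derive x (e_ i) (fun x => g (qd a x)) (dg (qd a x) * (2 * (x ord0 i - a ord0 i))).
Proof. move=> gd; apply: is_derive_comp1; exact: is_derive_qd. Qed.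

Lemma C1_radial a g dg : (forall q : R, is_derive q 1 g (dg q)) -> continuous dg ->
  C1 (fun x : 'rV[R]_n => g (qd a x)).
Proof.
move=> gd cdg; split.
  move=> x; apply: (@continuous_comp _ _ _ (qd a) g); first exact: qd_continuous.
  exact: is_derive1_continuous gd _.
move=> i; split; first by move=> x; have [] := is_derive_radial i a x gd.
rewrite (_ : pderiv i _ = fun x => dg (qd a x) * (2 * (x ord0 i - a ord0 i))); last first.
  by apply/funext => x; apply: is_derive_pderiv; exact: is_derive_radial.
move=> x.
have c1 : {for x, continuous (fun x => dg (qd a x))}.
  by apply: (@continuous_comp _ _ _ (qd a) dg); [exact: qd_continuous|exact: cdg].
have c2 : {for x, continuous (fun x : 'rV[R]_n => x ord0 i)} by exact: coord_continuous.
have c3 : {for x, continuous (fun x : 'rV[R]_n => 2 * (x ord0 i - a ord0 i))}.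
  by apply: continuous_scale; exact: (cvgB c2 (cvg_cst _)).
exact: (cvgM c1 c3).
Qed.

Lemma enormE x : enorm x = Num.sqrt (qd 0 x).
Proof. by rewrite /enorm /qd; congr Num.sqrt; apply: eq_bigr => j _; rewrite mxE subr0. Qed.

Lemma qd_ge0 a x : 0 <= qd a x.
Proof. by apply: sumr_ge0 => j _; exact: sqr_ge0. Qed.

Lemma enorm_sqr x : enorm x ^+ 2 = qd 0 x.
Proof. by rewrite enormE sqr_sqrtr// qd_ge0. Qed.

Lemma enorm_ge0 x : 0 <= enorm x.
Proof. exact: sqrtr_ge0. Qed.

Lemma norm_le_enorm x : `|x| <= enorm x.
Proof.
rewrite [leLHS]/Num.norm /= mx_normrE; apply/bigmax_leP; split; first exact: enorm_ge0.
move=> [a j] _ /=; rewrite (ord1 a) -(@ler_pXn2r _ 2) ?nnegrE ?enorm_ge0// enorm_sqr.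
by apply: (@qd_ge R n 0 x _ j); rewrite mxE subr0.
Qed.

Lemma enorm_eq0 x : (enorm x == 0) = (x == 0).
Proof.
apply/eqP/eqP => [h|->].
  by apply/eqP; rewrite -normr_eq0 eq_le normr_ge0 andbT -h norm_le_enorm.
rewrite enormE /qd big1 ?sqrtr0// => j _; by rewrite !mxE subrr expr0n.
Qed.

Lemma enorm_gt0 x : (0 < enorm x) = (x != 0).
Proof. by rewrite lt_neqAle enorm_ge0 andbT eq_sym enorm_eq0. Qed.

Lemma enorm_continuous : continuous (@enorm R n).
Proof.
move=> x; rewrite (_ : @enorm R n = Num.sqrt \o qd 0); last by apply/funext => y; rewrite /= enormE.
by apply: continuous_comp; [exact: qd_continuous|exact: sqrt_continuous].
Qed.

Lemma eball_open e : open (eball e : set 'rV[R]_n).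
Proof.
rewrite (_ : eball e = @enorm R n @^-1` [set s | s < e])//.
by apply: open_comp; [move=> x _; exact: enorm_continuous|exact: open_lt].
Qed.

Lemma eball_measurable e : measurable (eball e : set 'rV[R]_n).
Proof. by apply: open_measurable_rV; exact: eball_open. Qed.

End radial_calculus.

Section regularized.
Variables (R : realType).

(** A C^1 approximation of the positive part: s_+^2 / (s_+ + e). *)
Definition Heps (e s : R) : R := if s < 0 then 0 else s ^+ 2 / (s + e).
Definition dHeps (e s : R) : R := if s < 0 then 0 else (s ^+ 2 + 2 * s * e) / (s + e) ^+ 2.

Lemma is_derive_Heps (e s : R) : 0 < e -> is_derive s 1 (Heps e) (dHeps e s).
Proof.
move=> e0.
have dg (z : R) : 0 <= z -> is_derive z 1 (fun s => s ^+ 2 / (s + e)) ((z ^+ 2 + 2 * z * e) / (z + e) ^+ 2).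
  move=> z0; have ze : z + e != 0 by rewrite gt_eqF// ltr_wpDl.
  have d1 : is_derive z 1 (fun s : R => s ^+ 2) (2 * z).
    apply: (is_derive_eq (is_deriveX 2 (is_derive_id z 1))).
    by rewrite [_ *: _]mulr1 expr1.
  have d2 : is_derive z 1 (fun s : R => (s + e)^-1) (- (z + e) ^- 2).
    apply: (is_derive_eq (@is_deriveV _ (fun s : R => s + e) z _ _ ze (is_derive_shift _ _ _))).
    by rewrite [_ *: _]mulr1.
  apply: (is_derive_eq (is_deriveM d1 d2)); rewrite /GRing.scale /=; field.
  exact: ze.
rewrite /dHeps; have [s0|s0|s0] := ltgtP s 0.
- apply: (@near_eq_is_derive _ _ _ (cst 0)).
  near=> y; rewrite /Heps ifT//; near: y; exact: lt_nbhsl.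
- have H := dg s (ltW s0).
  apply: near_eq_is_derive H.
  by near=> y; rewrite /Heps ifF//; apply/negbTE; rewrite -leNgt ltW//; near: y; exact: lt_nbhsr.
- rewrite s0; rewrite expr0n /= mulr0 mul0r add0r mul0r; apply: is_derive1_glue.
  + by rewrite expr0n mul0r.
  + by apply: (is_derive_eq (dg 0 (lexx _))); rewrite expr0n /= mulr0 mul0r add0r mul0r.
Unshelve. all: by end_near. Qed.

Lemma dHeps_continuous (e : R) : 0 < e -> continuous (dHeps e).
Proof.
move=> e0.
have E : dHeps e = (fun s => (Num.max 0 s ^+ 2 + 2 * Num.max 0 s * e) / (Num.max 0 s + e) ^+ 2).
  apply/funext => s; rewrite /dHeps; case: ltP => s0 //.
  by rewrite expr0n /= mulr0 mul0r add0r mul0r.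
rewrite E => s.
have cm : {for s, continuous (fun s : R => Num.max 0 s : R)}.
  by apply: (@continuous_max R R (fun=> 0) id); [exact: cst_continuous|exact: cvg_id].
apply: (@continuous_comp _ _ _ (fun s : R => Num.max 0 s) (fun m => (m ^+ 2 + 2 * m * e) / (m + e) ^+ 2)) => //.
have : 0 <= Num.max 0 s by rewrite le_max lexx.
move: (Num.max 0 s) => m m0; have me : m + e != 0 by rewrite gt_eqF// ltr_wpDl.
have c1 : {for m, continuous (fun m : R => m ^+ 2 + 2 * m * e)}.
  rewrite (_ : (fun m : R => m ^+ 2 + 2 * m * e) = horner ('X^2 + (2 * e) *: 'X)); first exact: continuous_horner.
  by apply/funext => y; rewrite !hornerE mulrAC.
have c2 : {for m, continuous (fun m : R => (m + e) ^+ 2)}.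
  rewrite (_ : (fun m : R => (m + e) ^+ 2) = horner (('X + e%:P) ^+ 2)); first exact: continuous_horner.
  by apply/funext => y; rewrite !hornerE.
have c3 : {for m, continuous (fun m : R => ((m + e) ^+ 2)^-1)} by apply: cvgV => //; rewrite expf_neq0.
exact: (cvgM c1 c3).
Qed.

Lemma HepsE (e s : R) : 0 < e -> Heps e s = Num.max 0 s ^+ 2 / (Num.max 0 s + e).
Proof. by move=> e0; rewrite /Heps; case: ltP => s0 //; rewrite expr0n mul0r. Qed.

Lemma Heps_ge0 (e s : R) : 0 < e -> 0 <= Heps e s.
Proof.
move=> e0; rewrite HepsE//; have : 0 <= Num.max 0 s by rewrite le_max lexx.
by move: (Num.max 0 s) => m m0; rewrite divr_ge0 ?sqr_ge0 ?addr_ge0 ?(ltW e0).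
Qed.

Lemma Heps_le (e s : R) : 0 < e -> Heps e s <= Num.max 0 s.
Proof.
move=> e0; rewrite HepsE//; have : 0 <= Num.max 0 s by rewrite le_max lexx.
move: (Num.max 0 s) => m m0; rewrite ler_pdivrMr ?ltr_wpDl// expr2.
by rewrite ler_wpM2l// lerDl ltW.
Qed.

Lemma Heps_close (e s : R) : 0 < e -> `|Num.max 0 s - Heps e s| <= e.
Proof.
move=> e0; rewrite ger0_norm ?subr_ge0 ?Heps_le// HepsE//.
have : 0 <= Num.max 0 s by rewrite le_max lexx.
move: (Num.max 0 s) => m m0; have me : 0 < m + e by rewrite ltr_wpDl.
rewrite lerBlDr -lerBlDl ler_pdivlMr// mulrBl.
have := mulr_ge0 (ltW e0) (ltW e0); lra.
Qed.

Lemma dHeps_ge0 (e s : R) : 0 < e -> 0 <= dHeps e s.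
Proof.
move=> e0; rewrite /dHeps; case: ltP => // s0.
by rewrite divr_ge0 ?sqr_ge0// addr_ge0 ?sqr_ge0// !mulr_ge0// ltW.
Qed.

Lemma dHeps_le1 (e s : R) : 0 < e -> dHeps e s <= 1.
Proof.
move=> e0; rewrite /dHeps; case: ltP => // s0; have me : 0 < s + e by rewrite ltr_wpDl.
rewrite ler_pdivrMr ?exprn_gt0// mul1r.
have := mulr_ge0 (ltW e0) (ltW e0); lra.
Qed.

(** Both sides vanish for s < 0; otherwise the difference is e s^2 / (s + e)^2. *)
(** Both terms vanish for s < 0; otherwise the difference is e s^2 / (s + e)^2. *)
Lemma sdHeps_close (e s : R) : 0 < e -> `|s * dHeps e s - Heps e s| <= e.
Proof.
move=> e0; rewrite /dHeps /Heps; case: ltP => s0; first by rewrite mulr0 subrr normr0 ltW.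
have me : 0 < s + e by rewrite ltr_wpDl.
have -> : s * ((s ^+ 2 + 2 * s * e) / (s + e) ^+ 2) - s ^+ 2 / (s + e) = e * (s / (s + e)) ^+ 2.
  by field; rewrite gt_eqF.
rewrite normrM (gtr0_norm e0) ger0_norm ?sqr_ge0// ger_pMr// exprn_ile1//.
  by rewrite divr_ge0// ltW.
by rewrite ler_pdivrMr// mul1r lerDl ltW.
Qed.

Lemma dHeps_cvg (s : R) : (fun k : nat => dHeps k.+1%:R^-1 s) @ \oo --> ((0 < s)%R%:R : R).
Proof.
have k0 (k : nat) : 0 < k.+1%:R^-1 :> R by rewrite invr_gt0 ltr0n.
have [s0|s0] := ltP 0 s; last first.
  rewrite (_ : (fun k : nat => dHeps k.+1%:R^-1 s) = cst 0); first exact: cvg_cst.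
  apply/funext => k; rewrite /dHeps; case: ltP => // s0'.
  have -> : s = 0 by apply/eqP; rewrite eq_le s0 s0'.
  by rewrite expr0n mulr0 mul0r add0r mul0r.
have h : (fun k : nat => s^-1 ^+ 2 * k.+1%:R^-1) @ \oo --> (s^-1 ^+ 2 * 0 : R).
  by apply: cvgM; [exact: cvg_cst|exact: cvg_harmonic].
rewrite mulr0 in h.
apply/cvgrPdist_le => e e0; near=> k.
have H : `|0 - s^-1 ^+ 2 * k.+1%:R^-1| <= e.
  by near: k; move/cvgrPdist_le : h; exact.
apply: le_trans H; rewrite sub0r normrN /dHeps ltNge (ltW s0) /=.
have me : 0 < s + k.+1%:R^-1 by rewrite ltr_wpDl ?(ltW s0).
have -> : 1%:R - (s ^+ 2 + 2 * s * k.+1%:R^-1) / (s + k.+1%:R^-1) ^+ 2 = (k.+1%:R^-1 / (s + k.+1%:R^-1)) ^+ 2 :> R.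
  by move: (k.+1%:R^-1) me => d me; field; rewrite gt_eqF.
rewrite (ger0_norm (sqr_ge0 _)) ger0_norm; last by rewrite mulr_ge0 ?sqr_ge0 ?invr_ge0.
have d0 := k0 k; rewrite expr_div_n mulrC.
apply: ler_pM; rewrite ?invr_ge0 ?sqr_ge0//.
- by rewrite exprVn lef_pV2 ?posrE ?exprn_gt0// ler_pXn2r ?nnegrE ?(ltW s0) ?(ltW me)// lerDl ltW.
- rewrite expr2 ger_pMr// invf_le1 ?ltr0n// ler1n//.
Unshelve. all: by end_near. Qed.

End regularized.

(** * The flux identity *)

Section flux.
Variables (R : realType) (n : nat) (A L : R).
Hypotheses (n2 : (2 <= n)%N) (A0 : 0 < A) (L0 : 0 < L).
Variables (t : R) (e : R).
Hypotheses (t0 : 0 < t) (e0 : 0 < e).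
Local Notation mu := (@lebesgue_rV R n).
Local Notation e_ i := (delta_mx ord0 i : 'rV[R]_n).
Local Notation rho := (@rho R n A L t).
Local Notation cA := (@cA R n A).
Implicit Types (i : 'I_n) (x y : 'rV[R]_n).

Let ngt0 : (0 : R) < n%:R. Proof. by rewrite ltr0n (leq_trans _ n2). Qed.
Let ee : 0 < e ^+ 2. Proof. exact: exprn_gt0. Qed.

Lemma is_derive_sqrt_comp (f : R -> R) df (q : R) : 0 < q ->
  is_derive (Num.sqrt q) 1 f df -> is_derive q 1 (fun q => f (Num.sqrt q)) (df / (2 * Num.sqrt q)).
Proof.
move=> q0 fd; apply: (is_derive_eq (@is_derive1_comp _ f Num.sqrt q _ _ fd (is_derive1_sqrt q0))).
done.
Qed.

(** The function r^(-n) in terms of q = r^2. *)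
Definition Jq (q : R) : R := (Num.sqrt q)^-1 ^+ n.
Definition dJq (q : R) : R := - (n%:R / 2) * (Num.sqrt q)^-1 ^+ n.+2.

Lemma is_derive_Jq (q : R) : 0 < q -> is_derive q 1 Jq (dJq q).
Proof.
move=> q0; have s0 : 0 < Num.sqrt q by rewrite sqrtr_gt0.
have dV : is_derive (Num.sqrt q) 1 (fun y : R => y^-1) (- (Num.sqrt q)^-1 ^+ 2).
  have -> : - (Num.sqrt q)^-1 ^+ 2 = - (Num.sqrt q) ^- 2 *: (1 : R) by rewrite [_ *: _]mulr1 exprVn.
  by apply: is_deriveV; rewrite gt_eqF.
have dX : is_derive (Num.sqrt q) 1 (fun y : R => y^-1 ^+ n) (n%:R * (Num.sqrt q)^-1 ^+ n.-1 * - (Num.sqrt q)^-1 ^+ 2).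
  have := is_deriveX n dV; rewrite exprfctE => H; apply: (is_derive_eq H).
  by rewrite /GRing.scale /= mulr_natl.
apply: (is_derive_eq (is_derive_sqrt_comp q0 dX)); rewrite /dJq.
have -> : n.+2 = (n.-1 + 3)%N by move: n2; case: (n) => // m _; rewrite addn3.
rewrite exprD; move: (_ ^+ n.-1) => p; field; rewrite gt_eqF//.
Qed.

(** The profile in terms of q = r^2. *)
Definition Phi (q : R) : R := uprof n A L t (Num.sqrt q).
Definition dPhi (q : R) : R := - (2^-1 * slope n A L t (Num.sqrt q)).

Lemma is_derive_Phi (q : R) : 0 < q -> is_derive q 1 Phi (dPhi q).
Proof.
move=> q0; have s0 : 0 < Num.sqrt q by rewrite sqrtr_gt0.
apply: (is_derive_eq (is_derive_sqrt_comp q0 (is_derive_uprof n2 A0 L0 t0 s0))).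
by rewrite /dPhi; field; rewrite gt_eqF.
Qed.

(** The transform modified inside the ball of radius e so as to be of class C^1
    on the whole space. *)
Definition Uext x : R := extlin (e ^+ 2) Phi dPhi (qd 0 x).

Lemma Jq_cont (q : R) : {for q, continuous (fun q => (Num.sqrt (Num.max (e ^+ 2) q))^-1)}.
Proof.
have m0 : 0 < Num.max (e ^+ 2) q by rewrite lt_max ee.
apply: cvgV; first by rewrite gt_eqF// sqrtr_gt0.
apply: (@continuous_comp _ _ _ (fun q : R => Num.max (e ^+ 2) q) Num.sqrt); last exact: sqrt_continuous.
by apply: (@continuous_max R R (fun=> e ^+ 2) id); [exact: cst_continuous|exact: cvg_id].
Qed.

Lemma Jq_contX k (q : R) : {for q, continuous (fun q => (Num.sqrt (Num.max (e ^+ 2) q))^-1 ^+ k)}.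
Proof.
apply: (@continuous_comp _ _ _ (fun q : R => (Num.sqrt (Num.max (e ^+ 2) q))^-1) (fun z : R => z ^+ k)).
  exact: Jq_cont.
exact: exprn_continuous.
Qed.

Lemma continuous_scale1 (f : R -> R) (c q : R) : {for q, continuous f} -> {for q, continuous (fun y : R => c * f y : R)}.
Proof. by move=> cf; exact: (cvgM (cvg_cst c) cf). Qed.

Lemma dPhi_cont : continuous (fun q => dPhi (Num.max (e ^+ 2) q)).
Proof.
move=> q; rewrite /dPhi /slope.
have c1 := continuous_scale1 (c := cA * t) (@Jq_contX n q).
have c2 : {for q, continuous (fun q => cA * t * (Num.sqrt (Num.max (e ^+ 2) q))^-1 ^+ n - L / n%:R)}.
  exact: (cvgB c1 (cvg_cst _)).
have c3 : {for q, continuous (fun q => Num.max 0 (cA * t * (Num.sqrt (Num.max (e ^+ 2) q))^-1 ^+ n - L / n%:R))}.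
  by apply: (@continuous_max R R (fun=> 0)); [exact: cst_continuous|exact: c2].
have c4 := continuous_scale1 (c := 2^-1) c3.
exact: (cvgN c4).
Qed.

Lemma C1_Uext : C1 Uext.
Proof.
apply: (@C1_radial R n 0 (extlin (e ^+ 2) Phi dPhi)); last exact: dPhi_cont.
by apply: is_derive_extlin => //; exact: is_derive_Phi.
Qed.

Lemma pderiv_Uext i x : pderiv i Uext x = - (x ord0 i * slope n A L t (Num.sqrt (Num.max (e ^+ 2) (qd 0 x)))).
Proof.
have d := is_derive_extlin ee is_derive_Phi.
rewrite (is_derive_pderiv (is_derive_radial i 0 x d)) /dPhi mxE subr0.
by move: (slope _ _ _ _ _) => p; field.
Qed.

Lemma eballNE x : ~ eball e x -> e <= enorm x /\ e ^+ 2 <= qd 0 x.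
Proof.
rewrite /eball /= => /negP; rewrite -leNgt => h; split => //.
by rewrite -enorm_sqr ler_pXn2r// nnegrE ?enorm_ge0// ltW.
Qed.

Lemma UextE x : ~ eball e x -> Uext x = uprof n A L t (enorm x).
Proof. by move=> /eballNE[_ h]; rewrite /Uext /extlin ltNge h /= /Phi -enormE. Qed.

Lemma pderiv_UextE i x : ~ eball e x -> pderiv i Uext x = - (x ord0 i * slope n A L t (enorm x)).
Proof. by move=> /eballNE[_ h]; rewrite pderiv_Uext max_r// -enormE. Qed.

(** The quantity c t r^(-n) - L / n, modified inside the ball of radius e; its
    positive part is the slope. *)
Definition sJ x : R := cA * t * extlin (e ^+ 2) Jq dJq (qd 0 x) - L / n%:R.

(** A C^1 approximation of the gradient of Uext outside the ball of radius e. *)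
Definition Freg (d : R) i x : R := - (x ord0 i * Heps d (sJ x)).

Let dsJ (q : R) := cA * t * dJq (Num.max (e ^+ 2) q).

Lemma is_derive_sJ (q : R) : is_derive q 1 (fun q => cA * t * extlin (e ^+ 2) Jq dJq q - L / n%:R) (dsJ q).
Proof.
have d1 := is_deriveZ (cA * t) (is_derive_extlin ee is_derive_Jq q).
by apply: (is_derive_eq (is_deriveB d1 (is_derive_cst (L / n%:R) q 1))); rewrite subr0.
Qed.

Lemma is_derive_HsJ (d q : R) : 0 < d ->
  is_derive q 1 (fun q => Heps d (cA * t * extlin (e ^+ 2) Jq dJq q - L / n%:R))
    (dHeps d (cA * t * extlin (e ^+ 2) Jq dJq q - L / n%:R) * dsJ q).
Proof.
move=> d0; exact: (@is_derive1_comp _ (Heps d) _ q _ _ (is_derive_Heps _ d0) (is_derive_sJ q)).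
Qed.

Lemma C1_HsJ d : 0 < d -> C1 (fun x => Heps d (sJ x)).
Proof.
move=> d0; apply: (@C1_radial R n 0 _ _ (fun q => is_derive_HsJ q d0)) => q.
have c1 : {for q, continuous (fun q => dHeps d (cA * t * extlin (e ^+ 2) Jq dJq q - L / n%:R))}.
  apply: (@continuous_comp _ _ _ _ (dHeps d)); last exact: dHeps_continuous.
  exact: is_derive1_continuous is_derive_sJ _.
have c2 : {for q, continuous dsJ}.
  exact: (continuous_scale1 (continuous_scale1 (@Jq_contX n.+2 q))).
exact: (cvgM c1 c2).
Qed.

Lemma C1N (f : 'rV[R]_n -> R) : C1 f -> C1 (fun x => - f x).
Proof.
move=> fC; have := C1M (C1_cst n (-1)) fC.
by rewrite (_ : (fun x => -1 * f x) = (fun x => - f x))//; apply/funext => x; rewrite mulN1r.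
Qed.

Lemma C1_Freg d i : 0 < d -> C1 (Freg d i).
Proof. by move=> d0; apply: C1N; apply: C1M; [exact: C1_coord|exact: C1_HsJ]. Qed.

Lemma pderiv_Freg d i x : 0 < d -> ~ eball e x ->
  pderiv i (Freg d i) x = n%:R * (x ord0 i ^+ 2 / qd 0 x) * ((sJ x + L / n%:R) * dHeps d (sJ x)) - Heps d (sJ x).
Proof.
move=> d0 /eballNE[ex h].
have := @C1M_is _ _ _ _ i x (C1_coord R i) (C1_HsJ d0) => H.
rewrite (is_derive_pderiv (is_deriveN H)).
rewrite (is_derive_pderiv (is_derive_coord i i x)) eqxx.
have := is_derive_radial i 0 x (fun q => is_derive_HsJ q d0) => /is_derive_pderiv.
rewrite -/(sJ x) => ->; rewrite /dsJ max_r//.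
have q0 : 0 < qd 0 x by exact: lt_le_trans h.
have sE : sJ x + L / n%:R = cA * t * Jq (qd 0 x).
  by rewrite /sJ /extlin ltNge h /= subrK.
have qE : x ord0 i ^+ 2 / qd 0 x = x ord0 i ^+ 2 / Num.sqrt (qd 0 x) ^+ 2 by rewrite sqr_sqrtr// ltW.
have s0 : 0 < Num.sqrt (qd 0 x) by rewrite sqrtr_gt0.
rewrite sE /dJq /Jq mxE subr0 -[n.+2]addn2 exprD mulr1.
move: (Heps _ _) (dHeps _ _) => H1 H2; rewrite qE.
move: (Num.sqrt _) s0 => s s0; move: (s^-1 ^+ n) => p.
by field; rewrite gt_eqF.
Qed.

(** Since r d/dr (c t r^(-n)) = - n (s + L / n) with s = c t r^(-n) - L / n, the
    divergence of - x H(s) is n (s H'(s) - H(s)) + L H'(s). As H tends to the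
    positive part, the first term tends to 0 and H'(s) to the indicator
    function of s > 0. *)
Lemma div_Freg d x : 0 < d -> ~ eball e x ->
  \sum_i pderiv i (Freg d i) x = n%:R * (sJ x * dHeps d (sJ x) - Heps d (sJ x)) + L * dHeps d (sJ x).
Proof.
move=> d0 ex; have [h1 h] := eballNE ex; have q0 : 0 < qd 0 x by exact: lt_le_trans h.
rewrite (eq_bigr _ (fun i _ => pderiv_Freg i d0 ex)) big_split /= sumr_const card_ord -mulr_suml -mulr_sumr -mulr_suml.
have -> : \sum_i x ord0 i ^+ 2 = qd 0 x by apply: eq_bigr => j _; rewrite mxE subr0.
rewrite -mulr_natl mulfV ?gt_eqF//.
by field; rewrite gt_eqF.
Qed.

Lemma max_sJ x : ~ eball e x -> Num.max 0 (sJ x) = slope n A L t (enorm x).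
Proof. by move=> /eballNE[_ h]; rewrite /sJ /extlin ltNge h /= /Jq -enormE. Qed.

Lemma enorm_gt0_out x : ~ eball e x -> 0 < enorm x.
Proof. by move=> /eballNE[h _]; exact: lt_le_trans h. Qed.

Lemma sJ_gt0 x : ~ eball e x -> (0 < sJ x) = (enorm x < rho).
Proof.
move=> ex; have x0 := enorm_gt0_out ex.
have -> : (0 < sJ x) = (0 < Num.max 0 (sJ x)) by rewrite lt_max ltxx.
rewrite max_sJ// slopeE//; case: ifPn => h; last by rewrite ltxx.
have K : cA * t = L / n%:R * rho ^+ n by rewrite rhoXn//; field; rewrite !gt_eqF.
rewrite K subr_gt0 -mulrA ltr_pMr ?divr_gt0// -exprMn exprn_egt1 ?ltr_pdivlMr ?mul1r//.
by rewrite -lt0n (leq_trans _ n2).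
Qed.

Definition Kflux : set 'rV[R]_n := cbox 0 (const_mx (Num.max rho e)).

Lemma Kflux_out x : ~ Kflux x -> rho <= enorm x /\ ~ eball e x.
Proof.
move=> nK; have : Num.max rho e < `|x|.
  rewrite ltNge; apply/negP => h; apply: nK => j; rewrite !mxE subr0.
  exact: le_trans (coord_le_norm x j) h.
move=> h; have := lt_le_trans h (norm_le_enorm x); rewrite gt_max => /andP[h1 h2].
by split; [exact: ltW|rewrite /eball /=; apply/negP; rewrite -leNgt ltW].
Qed.

Lemma Freg_out d i x : 0 < d -> ~ Kflux x -> Freg d i x = 0.
Proof.
move=> d0 /Kflux_out[h1 h2]; rewrite /Freg HepsE// max_sJ// slopeE ?enorm_gt0_out//.
by rewrite ltNge h1 /= expr0n mul0r mulr0 oppr0.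
Qed.

Lemma Uext_out x : ~ Kflux x -> Uext x = 0.
Proof. by move=> /Kflux_out[h1 h2]; rewrite UextE// /uprof ltNge h1. Qed.

Lemma pderiv_Uext_out i x : ~ Kflux x -> pderiv i Uext x = 0.
Proof.
apply: pderiv_out; last exact: Uext_out.
by apply: compact_closed_rV; exact: cbox_compact.
Qed.

Lemma ae_all (I : finType) (P : I -> 'rV[R]_n -> Prop) :
  (forall j, {ae mu, forall x, P j x}) -> {ae mu, forall x, forall j, P j x}.
Proof. by move=> h; apply: filter_forall. Qed.

Lemma near_inv_le (d : R) : 0 < d -> \forall k \near \oo, k.+1%:R^-1 <= d.
Proof.
move=> d0; have := @cvg_harmonic R; move=> /cvgrPdist_le/(_ _ d0); apply: filterS => k /=.
by rewrite sub0r normrN gtr0_norm ?harmonic_gt0.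
Qed.

(** The weak form of Laplacian U = L 1_(|x| < rho), for functions that vanish
    near the origin. The gradient of Uext is only continuous, so the identity
    is first proved for the C^1 fields Freg, and then d tends to 0. *)
Lemma flux (phi : 'rV[R]_n -> R) (g : 'I_n -> 'rV[R]_n -> R) :
  (forall i, is_weak_pderiv setT i phi (g i)) ->
  {ae mu, forall x, eball e x -> phi x = 0} ->
  [/\ intg mu (fun x => \sum_i pderiv i Uext x * g i x),
      intg mu (fun x => phi x * \1_[set x | enorm x < rho] x) &
      \int[mu]_x (\sum_i pderiv i Uext x * g i x) =
        - (L * \int[mu]_x (phi x * \1_[set x | enorm x < rho] x))].
Proof.
move=> wg phi0.
have Kc : compact Kflux by exact: cbox_compact.
have mK : measurable Kflux by exact: compact_measurable_rV.
have mB : measurable (~` eball e : set 'rV[R]_n) by apply: measurableC; exact: eball_measurable.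
pose S := Kflux `&` ~` eball e.
have mS : measurable S by exact: measurableI.
have i0 : 'I_n by exact: Ordinal (ltnW n2).
have [lphi _ _] := wg i0.
have intS f : L1loc setT f -> intg mu (f \_ S).
  move=> lf; have := intg_restrict mB (L1loc_restrict lf Kc (subsetT _)).
  apply: eq_intg => x; rewrite !patchE /S in_setI.
  by case: (x \in Kflux); case: (x \in ~` eball e).
have mT f : L1loc setT f -> measurable_fun setT f by case.
pose phi1 := phi \_ S; pose g1 i := g i \_ S.
have ip : intg mu phi1 by exact: intS.
have ig i : intg mu (g1 i) by apply: intS; have [] := wg i.
have outS f x : ~ S x -> (f \_ S : 'rV[R]_n -> R) x = 0.
  by move=> nS; rewrite patchE memNset.
have inS f x : S x -> (f \_ S : 'rV[R]_n -> R) x = f x.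
  by move=> nS; rewrite patchE mem_set.
have g0 : {ae mu, forall x, forall i, eball e x -> g i x = 0}.
  apply: ae_all => i; apply: (@weak_ae0 R n (eball e) i phi (g i)) => //; first exact: eball_open.
  by apply: (@weak_sub R n setT) => //; [exact: eball_open|exact: openT].
(* cutting off to S changes nothing: z vanishes outside Kflux and f in the ball *)
have aeS (f z : 'rV[R]_n -> R) : {ae mu, forall x, eball e x -> f x = 0} -> (forall x, ~ Kflux x -> z x = 0) ->
    {ae mu, forall x, (f \_ S) x * z x = f x * z x}.
  move=> f0 z0; apply: filterS f0 => x fx.
  have [xS|xS] := pselect (S x); first by rewrite inS.
  have [xK|xK] := pselect (Kflux x); last by rewrite z0// !mulr0.
  have [xe|xe] := pselect (eball e x); last by case: xS.
  by rewrite fx// outS.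
have dk (k : nat) : 0 < k.+1%:R^-1 :> R by rewrite invr_gt0 ltr0n.
have bF k i : exists2 M, 0 <= M & forall x, `|pderiv i (Freg k.+1%:R^-1 i) x| <= M.
  apply: (cs_bounded Kc); first by have [_ /(_ i)[]] := C1_Freg i (dk k).
  by move=> x xK; apply: (@pderiv_out _ _ Kflux) => //; [exact: compact_closed_rV|move=> y yK; exact: Freg_out].
have mF k i : measurable_fun setT (Freg k.+1%:R^-1 i).
  by apply: continuous_measurableT; have [] := C1_Freg i (dk k).
have mdF k i : measurable_fun setT (pderiv i (Freg k.+1%:R^-1 i)).
  by apply: continuous_measurableT; have [_ /(_ i)[]] := C1_Freg i (dk k).
have bU i : exists2 M, 0 <= M & forall x, `|pderiv i Uext x| <= M.
  apply: (cs_bounded Kc); first by have [_ /(_ i)[]] := C1_Uext.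
  by move=> x xK; exact: pderiv_Uext_out.
have FU k i x : S x -> `|Freg k.+1%:R^-1 i x| <= `|pderiv i Uext x|.
  move=> [xK xe]; rewrite pderiv_UextE// -max_sJ// !normrN !normrM.
  rewrite ler_wpM2l// (ger0_norm (Heps_ge0 _ (dk k))) ger0_norm ?Heps_le//.
  by rewrite le_max lexx.
pose P k x := phi1 x * (n%:R * (sJ x * dHeps k.+1%:R^-1 (sJ x) - Heps k.+1%:R^-1 (sJ x)) + L * dHeps k.+1%:R^-1 (sJ x)).
pose Q k x := \sum_i g1 i x * Freg k.+1%:R^-1 i x.
have ipF k i : intg mu (fun x => phi1 x * pderiv i (Freg k.+1%:R^-1 i) x).
  by have [M _ hM] := bF k i; exact: intgMb hM.
have igF k i : intg mu (fun x => g1 i x * Freg k.+1%:R^-1 i x).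
  have [M _ hM] := bU i; apply: (@le_intg _ _ _ _ _ (fun x => M * `|g1 i x|)).
  - by apply: measurable_funM => //; exact: intg_measurable (ig i).
  - move=> x; rewrite normrM mulrC; have [xS|xS] := pselect (S x); last first.
      by rewrite /g1 outS// normr0 !mulr0.
    by rewrite ler_wpM2r// (le_trans (FU k i x xS)).
  - by apply: intgZ; exact: intg_norm.
have PE k : P k =1 fun x => \sum_i phi1 x * pderiv i (Freg k.+1%:R^-1 i) x.
  move=> x; rewrite /P -mulr_sumr; have [xS|xS] := pselect (S x); last by rewrite /phi1 outS// !mul0r.
  by rewrite div_Freg//; case: xS.
have step k : \int[mu]_x P k x = - \int[mu]_x Q k x.
  rewrite (@eqJ _ _ _ mu _ _ (PE k)) J_sum//.
  rewrite /Q J_sum// -sumrN; apply: eq_bigr => i _.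
  have := @ext_C1 R n setT i phi (g i) (Freg k.+1%:R^-1 i) Kflux openT (wg i) (C1_Freg i (dk k)) Kc (subsetT _).
  move=> /(_ (fun x => @Freg_out _ i x (dk k))) E.
  transitivity (\int[mu]_x (phi x * pderiv i (Freg k.+1%:R^-1 i) x)).
    apply: ae_eqJ; first (apply: aeS => //).
    - by move=> x xK; apply: (@pderiv_out _ _ Kflux) => //; [exact: compact_closed_rV|move=> y yK; exact: Freg_out].
    - exact: intg_measurable (ipF k i).
    - by apply: measurable_funM => //; exact: mT.
  rewrite E; congr (- _); apply/esym; apply: ae_eqJ; first (apply: aeS).
  - by apply: filterS g0 => x; exact.
  - by move=> x xK; exact: Freg_out.
  - exact: intg_measurable (igF k i).
  - by apply: measurable_funM => //; apply: mT; have [] := wg i.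
have [iP cP] : intg mu (fun x => phi1 x * (L * (0 < sJ x)%R%:R)) /\
   (fun k => \int[mu]_x P k x) @ \oo --> \int[mu]_x (phi1 x * (L * (0 < sJ x)%R%:R)).
  apply: (@dctJ _ _ _ _ _ _ (fun x => (n%:R + L) * `|phi1 x|)).
  - move=> k; have := @intg_sum _ _ _ mu _ (index_enum 'I_n) _ (ipF k) => /intg_measurable.
    by apply: eq_measurable_fun => x _; rewrite PE.
  - move=> x; apply: cvgM; first exact: cvg_cst.
    have c1 := @dHeps_cvg R (sJ x).
    have c2 : (fun k : nat => sJ x * dHeps k.+1%:R^-1 (sJ x) - Heps k.+1%:R^-1 (sJ x)) @ \oo --> (0 : R).
      apply/cvgrPdist_le => d d0; near=> k; rewrite sub0r normrN (le_trans (sdHeps_close _ (dk k)))//.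
      by near: k; exact: near_inv_le.
    have -> : L * (0 < sJ x)%R%:R = n%:R * 0 + L * (0 < sJ x)%R%:R by rewrite mulr0 add0r.
    apply: cvgD; (apply: cvgM; first exact: cvg_cst).
      exact: c2.
    exact: c1.
  - move=> k x; rewrite normrM mulrC ler_wpM2r//.
    apply: (le_trans (ler_normD _ _)); rewrite !normrM (gtr0_norm ngt0) (gtr0_norm L0).
    rewrite lerD//; last by rewrite ger_pMr// ger0_norm ?dHeps_ge0 ?dHeps_le1.
    rewrite ger_pMr// (le_trans (sdHeps_close _ (dk k)))// invf_le1 ?ltr0n// ler1n//.
  - by apply: intgZ; exact: intg_norm.
have [iQ cQ] : intg mu (fun x => \sum_i g1 i x * pderiv i Uext x) /\
   (fun k => \int[mu]_x Q k x) @ \oo --> \int[mu]_x (\sum_i g1 i x * pderiv i Uext x).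
  apply: (@dctJ _ _ _ _ _ _ (fun x => \sum_i `|g1 i x * pderiv i Uext x|)).
  - by move=> k; apply: intg_measurable; apply: intg_sum => i; exact: igF.
  - move=> x; apply: cvg_big => [|i _]; first exact: add_continuous.
    have [xS|xS] := pselect (S x); last first.
      rewrite /g1 outS// mul0r (_ : (fun k : nat => _) = cst 0); first exact: cvg_cst.
      by apply/funext => k; rewrite mul0r.
    apply: cvgM; first exact: cvg_cst.
    rewrite pderiv_UextE; last by case: xS.
    rewrite -max_sJ; last by case: xS.
    apply: cvgN; apply: cvgM; first exact: cvg_cst.
    apply/cvgrPdist_le => d d0; near=> k; rewrite (le_trans (Heps_close _ (dk k)))//.
      by near: k; exact: near_inv_le.
  - move=> k x; apply: (le_trans (ler_norm_sum _ _ _)); apply: ler_sum => i _.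
    have [xS|xS] := pselect (S x); last by rewrite /g1 outS// !mul0r.
    by rewrite !normrM ler_wpM2l// FU.
  - apply: intg_sum => i; apply: intg_norm; have [M _ hM] := bU i.
    apply: (@intgMb _ _ _ _ _ _ M) => //; apply: continuous_measurableT.
    by have [_ /(_ i)[]] := C1_Uext.
have mdU i : measurable_fun setT (pderiv i Uext).
  by apply: continuous_measurableT; have [_ /(_ i)[]] := C1_Uext.
have mg i : measurable_fun setT (g i) by apply: mT; have [] := wg i.
have mU : measurable_fun setT (fun x => \sum_i pderiv i Uext x * g i x).
  by apply: measurable_sum => i; exact: measurable_funM.
have aeQ : {ae mu, forall x, \sum_i g1 i x * pderiv i Uext x = \sum_i pderiv i Uext x * g i x}.
  have : {ae mu, forall x, forall i, g1 i x * pderiv i Uext x = g i x * pderiv i Uext x}.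
    apply: ae_all => i; apply: aeS; first by apply: filterS g0 => x; exact.
    by move=> x; exact: pderiv_Uext_out.
  by apply: filterS => x hx; apply: eq_bigr => i _; rewrite hx mulrC.
have mi : measurable_fun setT (\1_[set x : 'rV[R]_n | enorm x < rho] : 'rV[R]_n -> R).
  by apply: measurable_indic; exact: eball_measurable.
have bi : intg mu (fun x => phi1 x * \1_[set x | enorm x < rho] x).
  apply: (@intgMb _ _ _ _ _ _ 1) => // x; rewrite indicE.
  by case: (_ \in _); rewrite ?normr1 ?normr0.
have aeP : {ae mu, forall x, phi1 x * \1_[set x | enorm x < rho] x = phi x * \1_[set x | enorm x < rho] x}.
  apply: aeS => // x /Kflux_out[h _].
  by rewrite indicE memNset//= => h'; move: (lt_le_trans h' h); rewrite ltxx.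
have mP : measurable_fun setT (fun x => phi x * \1_[set x | enorm x < rho] x).
  by apply: measurable_funM => //; exact: mT.
split; [exact: ae_intg aeQ mU iQ|exact: ae_intg aeP mP bi|].
transitivity (\int[mu]_x (\sum_i g1 i x * pderiv i Uext x)).
  by apply/esym; apply: ae_eqJ aeQ _ mU; exact: intg_measurable iQ.
have <- : \int[mu]_x (phi1 x * (L * (0 < sJ x)%R%:R)) = L * \int[mu]_x (phi x * \1_[set x | enorm x < rho] x).
  have -> : \int[mu]_x (phi x * \1_[set x | enorm x < rho] x) = \int[mu]_x (phi1 x * \1_[set x | enorm x < rho] x).
    by apply/esym; apply: ae_eqJ aeP _ mP; exact: intg_measurable bi.
  rewrite -JZ//; apply: eqJ => x; have [xS|xS] := pselect (S x); last by rewrite /phi1 outS// !mul0r mulr0.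
  rewrite indicE sJ_gt0; last by case: xS.
  rewrite (_ : (x \in [set x : 'rV[R]_n | enorm x < rho]) = (enorm x < rho)); first by rewrite mulrCA.
  by apply/idP/idP; rewrite inE.
have h : (fun k => - \int[mu]_x Q k x) @ \oo --> - \int[mu]_x (\sum_i g1 i x * pderiv i Uext x).
  by apply: cvgN; exact: cQ.
have E : (fun k => \int[mu]_x P k x) = (fun k => - \int[mu]_x Q k x).
  by apply/funext => k; exact: step.
rewrite E in cP.
by rewrite (cvg_unique (@norm_hausdorff _ R) cP h) opprK.
Unshelve. all: by end_near. Qed.

End flux.

(** * The transform solves the limit problem *)

Section punctured.
Variables (R : realType) (n : nat).
Local Notation mu := (@lebesgue_rV R n).
Implicit Types (f g : 'rV[R]_n -> R) (D K : set 'rV[R]_n) (i : 'I_n) (x y : 'rV[R]_n).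
Local Notation D0 := [set x : 'rV[R]_n | x != 0].

Lemma punctured_open : open D0.
Proof.
rewrite (_ : D0 = @enorm R n @^-1` [set s | 0 < s]); last first.
  by apply/seteqP; split => x /=; rewrite enorm_gt0.
by apply: open_comp; [move=> x _; exact: enorm_continuous|exact: open_gt].
Qed.

Lemma gt_enorm_open (e : R) : open [set x : 'rV[R]_n | e < enorm x].
Proof.
rewrite (_ : [set x | _] = @enorm R n @^-1` [set s | e < s])//.
by apply: open_comp; [move=> x _; exact: enorm_continuous|exact: open_gt].
Qed.

Lemma eballC_interior (e : R) : [set x : 'rV[R]_n | e < enorm x] `<=` (~` eball e)°.
Proof.
move=> x /= ex; have : nbhs x [set x : 'rV[R]_n | e < enorm x].
  by apply: open_nbhs_nbhs; split; [exact: gt_enorm_open|].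
by apply: filterS => y /= ey; apply/negP; rewrite -leNgt ltW.
Qed.

Lemma compact_away K : compact K -> K `<=` D0 -> exists2 e, 0 < e & forall x, K x -> e < enorm x.
Proof.
move=> cK KD; have cl := compact_closed_rV cK.
have : nbhs (0 : 'rV[R]_n) (~` K).
  apply: open_nbhs_nbhs; split; first exact: closed_openC.
  by move=> /KD /=; rewrite eqxx.
move=> /nbhs_ballP[e /= e0 be]; exists (e / 2); first by rewrite divr_gt0.
move=> x Kx; rewrite ltNge; apply/negP => h; apply: (be x) Kx.
rewrite -ball_normE /= sub0r normrN (le_lt_trans (norm_le_enorm x))// (le_lt_trans h)//.
by rewrite ltr_pdivrMr// ltr_pMr// ltr1n.
Qed.

Lemma measurable_punctured f : measurable_fun D0 f -> measurable_fun setT f.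
Proof.
move=> mf; have mD : measurable D0 by apply: open_measurable_rV; exact: punctured_open.
have m0 : measurable (~` D0) by exact: measurableC.
rewrite -(setUv D0); apply/measurable_funU => //; split => //.
apply: (@eq_measurable_fun _ _ _ _ _ (fun=> f 0)); last exact: measurable_cst.
by move=> x; rewrite inE /= => /negP; rewrite negbK => /eqP ->.
Qed.

(** Nonempty open sets have positive measure. *)
Lemma ae0_continuous D f : open D -> (forall x, D x -> {for x, continuous f}) ->
  {ae mu, forall x, D x -> f x = 0} -> forall x, D x -> f x = 0.
Proof.
move=> oD cf [N [mN N0 hN]] x Dx; apply/eqP; apply: contrapT => /negP fx.
have : nbhs x (D `&` [set y | f y != 0]).
  apply: filterI; first exact: open_nbhs_nbhs.
  have : nbhs (f x) [set s : R | s != 0] by apply: open_nbhs_nbhs; split => //; exact: open_neq.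
  by move=> /(cf _ Dx).
move=> /nbhs_ballP[r /= r0 br].
have : (mu (ball x r) <= mu N)%E.
  apply: le_measure; rewrite ?inE//; first exact: measurable_ball_rV.
  by move=> y /br[Dy fy]; apply: hN => h; move: fy => /=; rewrite h// eqxx.
rewrite N0 lebesgue_rV_ball//.
by rewrite lee_fin leNgt exprn_gt0// mulr_gt0.
Qed.

Lemma L2_cs D f K : measurable D -> compact K -> continuous f -> (forall x, ~ K x -> f x = 0) -> L2 D f.
Proof.
move=> mD cK cf f0; split; first by apply: measurable_funTS; exact: continuous_measurableT.
apply: (@integrableS _ _ _ _ setT) => //.
apply: (cs_integrable cK); last by move=> x /f0 ->; rewrite expr0n.
by move=> x; apply: (cvgM (cf x) (cf x)).
Qed.

Lemma L2_ext D f g : measurable D -> (forall x, D x -> f x = g x) -> L2 D f -> L2 D g.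
Proof.
move=> mD fg [mf If]; split.
  by apply: eq_measurable_fun mf => x; rewrite inE => /fg.
by move: If; apply: eq_integrable => // x; rewrite inE => /fg ->.
Qed.

End punctured.

Lemma near_eq_continuous (R : realType) n (f g : 'rV[R]_n -> R) x :
  (\forall y \near x, f y = g y) -> {for x, continuous g} -> {for x, continuous f}.
Proof.
move=> fg cg; have E := nbhs_singleton fg; rewrite /prop_for /continuous_at E.
move/(@cvgrPdist_le _ _ _ (nbhs x) _ g (g x)) : cg => H.
apply/(@cvgrPdist_le _ _ _ (nbhs x) _ f (g x)) => e e0.
by apply: filterS2 fg (H e e0) => y ->.
Qed.

Section U_solution.
Variables (R : realType) (n : nat) (A L : R).
Hypotheses (n2 : (2 <= n)%N) (A0 : 0 < A) (L0 : 0 < L).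
Variables (t : R).
Hypotheses (t0 : 0 < t).
Local Notation mu := (@lebesgue_rV R n).
Local Notation rho := (@rho R n A L t).
Local Notation Uext := (@Uext R n A L t).
Local Notation D0 := [set x : 'rV[R]_n | x != 0].
Local Notation k0 := (fun=> 0%N).
Local Notation k1 i := (incr i k0).
Local Notation k2 i := (incr i (incr i k0)).
Implicit Types (i : 'I_n) (x y : 'rV[R]_n).

Definition baiocchi x := U_AL A L x t.
Definition grad_baiocchi i x := - (x ord0 i * slope n A L t (enorm x)).

Lemma baiocchi_Uext e x : 0 < e -> ~ eball e x -> baiocchi x = Uext e x.
Proof.
move=> e0 ex; rewrite (UextE _ _ _ e0)//.
by apply: U_ALE => //; exact: enorm_gt0_out ex.
Qed.

Lemma grad_baiocchi_Uext e i x : 0 < e -> ~ eball e x -> grad_baiocchi i x = pderiv i (Uext e) x.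
Proof. by move=> e0 ex; rewrite (pderiv_UextE n2 A0 L0). Qed.

Lemma near_Uext x : x != 0 -> exists2 e, 0 < e & \forall y \near x, ~ eball e y.
Proof.
move=> x0; have x0' : 0 < enorm x by rewrite enorm_gt0.
exists (enorm x / 2); first by rewrite divr_gt0.
have : enorm x / 2 < enorm x by rewrite ltr_pdivrMr// ltr_pMr// ltr1n.
by move=> /(@eballC_interior R n).
Qed.

Lemma baiocchi_continuous x : x != 0 -> {for x, continuous baiocchi}.
Proof.
move=> /near_Uext[e e0 ne].
apply: (@near_eq_continuous _ _ _ (Uext e)); last exact: (C1_Uext n2 A0 L0 t0 e0).1 x.
by move: ne; apply: filterS => y ye; exact: baiocchi_Uext.
Qed.

Lemma grad_baiocchi_continuous i x : x != 0 -> {for x, continuous (grad_baiocchi i)}.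
Proof.
move=> /near_Uext[e e0 ne].
apply: (@near_eq_continuous _ _ _ (pderiv i (Uext e))); last exact: ((C1_Uext n2 A0 L0 t0 e0).2 i).2 x.
by move: ne; apply: filterS => y ye; exact: grad_baiocchi_Uext.
Qed.

(** A test function that avoids the origin does not distinguish the transform
    from its C^1 modification in a small ball. *)
Lemma weak_baiocchi i : is_weak_pderiv D0 i baiocchi (grad_baiocchi i).
Proof.
apply: weakI.
- by apply: L1loc_continuous; [exact: punctured_open|exact: baiocchi_continuous].
- by apply: L1loc_continuous; [exact: punctured_open|exact: grad_baiocchi_continuous].
move=> phi tphi; have [K [cK KD p0 dp0]] := test_supp tphi.
have [e e0 eK] := compact_away cK KD.
have Ke x : K x -> ~ eball e x by move=> /eK h; apply/negP; rewrite -leNgt ltW.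
have := weak_C1_test i (C1_Uext n2 A0 L0 t0 e0) tphi.
rewrite (@eqJ _ _ _ mu _ (fun x => baiocchi x * pderiv i phi x)); last first.
  by move=> x; have [/Ke/(baiocchi_Uext e0) <-//|xK] := pselect (K x); rewrite dp0// !mulr0.
move=> ->; congr (- _); apply: eqJ => x.
by have [/Ke/(grad_baiocchi_Uext i e0) <-//|xK] := pselect (K x); rewrite p0// !mulr0.
Qed.

Lemma xget_weak D i f g : is_weak_pderiv D i f g -> is_weak_pderiv D i f (@wpderiv R n D i f).
Proof. by move=> wg; exact: (@xgetPex _ (fun=> 0) [set g | is_weak_pderiv D i f g]) (ex_intro _ g wg). Qed.

Lemma gradw_baiocchi i : {ae mu, forall x, x != 0 -> gradw baiocchi i x = grad_baiocchi i x}.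
Proof.
apply: (weak_unique (@punctured_open R n) (xget_weak (weak_baiocchi i)) (weak_baiocchi i)).
exact: aeW.
Qed.

Lemma baiocchi_ge0 x : x != 0 -> 0 <= baiocchi x.
Proof.
rewrite -enorm_gt0 => x0; rewrite /baiocchi U_ALE//.
have [h|h] := ltP (enorm x) rho; first by rewrite ltW// uprof_gt0.
by rewrite /uprof ltNge h.
Qed.

Lemma baiocchi_Kt : Kt A L t baiocchi.
Proof.
split; last 2 first.
- exact: baiocchi_ge0.
- apply/cvgrPdist_le => d d0.
  have : \forall x \near (0 : 'rV[R]_n), enorm x < rho.
    apply: open_nbhs_nbhs; split; first exact: eball_open.
    by rewrite /= (_ : enorm 0 = 0) ?rho_gt0//; apply/eqP; rewrite enorm_eq0.
  move=> h; rewrite near_withinE; apply: filterS h => x xr x0.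
  have x1 : 0 < enorm x by rewrite enorm_gt0.
  rewrite mulfV ?subrr ?normr0 ?ltW// gt_eqF//.
  by rewrite /baiocchi U_ALE// uprof_gt0.
move=> e e0.
have mB : measurable (~` eball e : set 'rV[R]_n) by apply: measurableC; exact: eball_measurable.
have Kc : compact (@Kflux R n A L t e) by exact: cbox_compact.
have [cU dU] := C1_Uext n2 A0 L0 t0 e0.
split; last first.
  apply: continuous_in_subspaceT => x; rewrite inE => xe; apply: baiocchi_continuous.
  by rewrite -enorm_gt0; exact: enorm_gt0_out xe.
split.
  apply: (@L2_ext _ _ _ (Uext e)) => //; first by move=> x /(baiocchi_Uext e0) ->.
  by apply: (L2_cs mB Kc cU) => x; exact: Uext_out.
move=> i; exists (pderiv i (Uext e)); last first.
  apply: (L2_cs mB Kc); first exact: (dU i).2.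
  by move=> x; exact: pderiv_Uext_out.
have oD : open (~` eball e : set 'rV[R]_n)° by exact: open_interior.
apply: (weak_ext oD (C1_weak i oD (C1_Uext n2 A0 L0 t0 e0))) => // x /interior_subset xe.
by rewrite (baiocchi_Uext e0).
Qed.

(** Both representatives of gradients are only known almost everywhere; inside
    the ball of radius e the gradient of phi vanishes. *)
Lemma flux_baiocchi (phi : 'rV[R]_n -> R) (g : 'I_n -> 'rV[R]_n -> R) e : 0 < e ->
  (forall i, is_weak_pderiv setT i phi (g i)) ->
  {ae mu, forall x, eball e x -> phi x = 0} ->
  intg mu (fun x => phi x * \1_[set x | enorm x < rho] x) /\
  (\int[mu]_x (\sum_i gradw baiocchi i x * grad phi i x)%:E =
    (- (L * \int[mu]_x (phi x * \1_[set x | enorm x < rho] x)))%:E)%E.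
Proof.
move=> e0 wg phi0.
have wG i : is_weak_pderiv setT i phi (grad phi i) by exact: xget_weak (wg i).
have [i1 i2 E] := flux n2 A0 L0 t0 e0 wG phi0.
split => //; rewrite -E -EFinJ//.
have g0 i : {ae mu, forall x, eball e x -> grad phi i x = 0}.
  apply: (@weak_ae0 R n (eball e) i phi) => //; first exact: eball_open.
  by apply: (@weak_sub R n setT) => //; [exact: eball_open|exact: openT].
have mU i : measurable_fun setT (gradw baiocchi i).
  by apply: measurable_punctured; have [_ []] := xget_weak (weak_baiocchi i).
have mG i : measurable_fun setT (grad phi i) by have [_ []] := wG i.
apply: ae_eq_integral => //.
- by apply/measurable_EFinP; apply: measurable_sum => i; exact: measurable_funM.
- by apply/measurable_EFinP; exact: intg_measurable i1.
have : {ae mu, forall x, forall i, gradw baiocchi i x * grad phi i x = pderiv i (Uext e) x * grad phi i x}.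
  apply: ae_all => i; apply: filterS2 (gradw_baiocchi i) (g0 i) => x h1 h2.
  have [/h2 ->|xe] := pselect (eball e x); first by rewrite !mulr0.
  by rewrite h1 ?(grad_baiocchi_Uext i e0)// -enorm_gt0; exact: enorm_gt0_out xe.
by apply: filterS => x hx _; congr EFin; apply: eq_bigr => i _.
Qed.

Lemma baiocchi_limit_solution : limit_solution A L t baiocchi.
Proof.
split; first exact: baiocchi_Kt.
- move=> phi [[[mphi _] hphi] phi_ge0 [e e0 phi0]].
  have wg i : {g | is_weak_pderiv setT i phi g}.
    by apply: cid; have [g] := hphi i; rewrite interiorT; exists g.
  have [i1 ->] := flux_baiocchi e0 (fun i => svalP (wg i)) phi0.
  rewrite EFinN leeN2 EFinM lee_pmul2l ?lte_fin// -EFinJ//.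
  have mp : measurable_fun setT (fun x => Num.max 0 (phi x)) by apply: measurable_maxr.
  have mi : measurable_fun setT (\1_[set x : 'rV[R]_n | enorm x < rho] : 'rV[R]_n -> R).
    by apply: measurable_indic; exact: eball_measurable.
  have -> : (\int[mu]_x (phi x)%:E = \int[mu]_x (Num.max 0 (phi x))%:E)%E.
    apply: ae_eq_integral => //; [exact/measurable_EFinP|exact/measurable_EFinP|].
    by apply: filterS phi_ge0 => x px _ /=; rewrite max_r.
  have -> : (\int[mu]_x (phi x * \1_[set x | enorm x < rho] x)%:E =
      \int[mu]_x (Num.max 0 (phi x) * \1_[set x | enorm x < rho] x)%:E)%E.
    apply: ae_eq_integral => //.
    - by apply/measurable_EFinP; exact: intg_measurable i1.
    - by apply/measurable_EFinP; exact: measurable_funM.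
    - by apply: filterS phi_ge0 => x px _ /=; rewrite max_r.
  apply: ge0_le_integral => //.
  + by move=> x _ /=; rewrite lee_fin mulr_ge0// ?le_max ?lexx// indicE ler0n.
  + by apply/measurable_EFinP; exact: measurable_funM.
  + exact/measurable_EFinP.
  + move=> x _; by rewrite lee_fin ler_piMr ?le_max ?lexx// indicE lern1 leq_b1.
- move=> psi [[_ _ [e e0 psi0]] psiC].
  have psiB x : eball e x -> psi x = 0.
    by apply: (ae0_continuous (@eball_open R n e)) => // y _; exact: psiC.1.
  have pE : psi \* baiocchi = fun x => psi x * Uext e x.
    apply/funext => x /=; have [xe|xe] := pselect (eball e x); first by rewrite psiB// !mul0r.
    by rewrite (baiocchi_Uext e0).
  have pC : C1 (psi \* baiocchi) by rewrite pE; apply: C1M => //; exact: C1_Uext.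
  have p0 : {ae mu, forall x, eball e x -> (psi \* baiocchi) x = 0}.
    by apply: aeW => x xe; rewrite pE psiB// mul0r.
  have [i1 ->] := flux_baiocchi e0 (fun i => C1_weak i openT pC) p0.
  have E : (fun x => (psi \* baiocchi) x * \1_[set x | enorm x < rho] x) = psi \* baiocchi.
    apply/funext => x; rewrite indicE; have [h|h] := pselect (enorm x < rho).
      by rewrite mem_set// mulr1.
    rewrite memNset// mulr0 pE; have [xe|xe] := pselect (eball e x).
      by rewrite psiB// mul0r.
    have hf : (enorm x < rho) = false by apply/negbTE/negP.
    by rewrite -(baiocchi_Uext e0)// /baiocchi U_ALE ?(enorm_gt0_out e0 xe)// /uprof hf mulr0.
  rewrite E in i1; rewrite E EFinN EFinM; congr (- (_ * _))%E.
  by rewrite -EFinJ.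
Qed.

Lemma kern_baiocchi x d : 0 < d -> cbox x (const_mx d) `<=` D0 ->
  \sum_i \int[mu]_y (baiocchi y * kern (k2 i) d x y) = L * \int[mu]_y (kern k0 d x y * \1_[set x | enorm x < rho] y).
Proof.
move=> d0 bD.
have [e e0 eK] := compact_away (@cbox_compact R n x (const_mx d)) bD.
have Ke y : cbox x (const_mx d) y -> ~ eball e y by move=> /eK h; apply/negP; rewrite -leNgt ltW.
have kout k y : ~ cbox x (const_mx d) y -> kern k d x y = 0.
  by move=> h; apply: etaD_outc => //; exact: const_gt0.
have wk i : is_weak_pderiv setT i (kern k0 d x) (kern (k1 i) d x).
  have := C1_weak i openT (C1_etaD 1 x (const_mx d) k0).
  by rewrite pderiv_etaD.
have k_0 : {ae mu, forall y, eball e y -> kern k0 d x y = 0}.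
  by apply: aeW => y ye; apply: kout => /Ke.
have [_ _ E] := flux n2 A0 L0 t0 e0 wk k_0.
rewrite -[RHS]opprK -E J_sum; last first.
  move=> i; apply: (@L1loc_mul R n setT _ _ (cbox x (const_mx d))) => //.
  - apply: L1loc_continuous; first exact: openT.
    by move=> y _; have [_ /(_ i)[_]] := C1_Uext n2 A0 L0 t0 e0; exact.
  - exact: cbox_compact.
  - exact: kern_continuous.
  - by move=> y; exact: kout.
rewrite -sumrN; apply: eq_bigr => i _.
have tk : test_function setT (kern (k1 i) d x) by exact: test_kern.
have := weak_C1_test i (C1_Uext n2 A0 L0 t0 e0) tk; rewrite pderiv_etaD => <-.
apply: eqJ => y; have [/Ke/(baiocchi_Uext e0) ->//|yK] := pselect (cbox x (const_mx d) y).
by rewrite [kern _ _ _ _]kout// [etaD _ _ _ _ _](kout (k2 i))// !mulr0.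
Qed.

End U_solution.

(** * Gluing and cutting off weak derivatives *)

Section glue.
Variables (R : realType) (n : nat).
Local Notation mu := (@lebesgue_rV R n).
Implicit Types (f g phi : 'rV[R]_n -> R) (D K : set 'rV[R]_n) (i : 'I_n) (x y : 'rV[R]_n).
Local Notation D0 := [set x : 'rV[R]_n | x != 0].

(** Weak derivatives on an increasing sequence of open sets agree almost
    everywhere where they overlap, so they may be glued along the disjoint
    differences O_k - O_(k-1). *)
Lemma weak_glue (O : nat -> set 'rV[R]_n) f i :
  (forall k, open (O k)) -> {homo O : j k / (j <= k)%N >-> j `<=` k} ->
  (forall k, exists h, is_weak_pderiv (O k) i f h) ->
  (forall K, compact K -> K `<=` \bigcup_k O k -> exists k, K `<=` O k) ->
  exists g, is_weak_pderiv (\bigcup_k O k) i f g.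
Proof.
move=> oO O_mono hw hK.
have [h wh] := choice hw.
have oU : open (\bigcup_k O k) by exact: bigcup_open.
have mO k : measurable (O k) by exact: open_measurable_rV.
pose S := seqDU O.
have mS k : measurable (S k) by apply: measurableD => //; exact: bigsetU_measurable.
pose G x : R := xget 0 [set s | exists2 k, S k x & s = h k x].
have GE k x : S k x -> G x = h k x.
  move=> Sx; apply: xget_unique; first by exists k.
  move=> s [j Sj ->]; have [->//|jk] := eqVneq j k.
  have /trivIsetP/(_ j k I I jk) E := @trivIset_seqDU _ O.
  have : (seqDU O j `&` seqDU O k) x by [].
  by rewrite E.
have aeG k : {ae mu, forall x, O k x -> G x = h k x}.
  have : {ae mu, forall x, forall j, (j <= k)%N -> O j x -> h j x = h k x}.
    apply/ae_foralln => j; have [jk|jk] := leqP j k; last first.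
      by apply: aeW => x.
    have wk : is_weak_pderiv (O j) i f (h k) by apply: weak_sub (wh k) => //; exact: O_mono.
    have : {ae mu, forall x, O j x -> f x = f x} by exact: aeW.
    move=> /(weak_unique (oO j) (wh j) wk).
    by apply: filterS => x hx _; exact: hx.
  apply: filterS => x hx Ox.
  have [j _ Sj] : (\bigcup_k S k) x by rewrite -seqDU_bigcup_eq; exists k.
  have jk : (j <= k)%N.
    rewrite leqNgt; apply/negP => kj; case: Sj => _; apply.
    by rewrite -bigcup_mkord; exists k.
  by rewrite (GE j)// hx//; case: Sj.
have mG : measurable_fun (\bigcup_k O k) G.
  rewrite seqDU_bigcup_eq; apply/measurable_fun_bigcup => // k.
  apply: (@eq_measurable_fun _ _ _ _ _ (h k)); first by move=> x; rewrite inE => /GE.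
  have [_ [mh _] _] := wh k; apply: measurable_funS mh => // x; exact: subset_seqDU.
have lG : L1loc (\bigcup_k O k) G.
  split => // K cK KU; have [k Kk] := hK _ cK KU.
  have mK := compact_measurable_rV cK.
  have [_ [mh ih] _] := wh k.
  have mGK : measurable_fun K (EFin \o G).
    by apply/measurable_EFinP; apply: measurable_funS mG => //; exact: bigcup_measurable.
  have /integrableP[mhK iK] := ih K cK Kk; apply/integrableP; split => //.
  move: iK; congr (_ < _)%E; apply: ae_eq_integral => //.
  - exact: measurableT_comp.
  - exact: measurableT_comp.
  - by apply: filterS (aeG k) => x hx Kx /=; rewrite hx//; exact: Kk.
exists G; apply: weakI => //.
  have lf k : L1loc (O k) f by have [] := wh k.
  split.
    by apply/measurable_fun_bigcup => // k; have [] := lf k.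
  move=> K cK KU; have [k Kk] := hK _ cK KU; have [_] := lf k; exact.
move=> phi tphi.
have [sphi cphi sub] := tphi.
have [k Kk] := hK _ cphi sub.
have tk : test_function (O k) phi by split.
have [i1 i2 E] := weakR (wh k) tk.
rewrite E; congr (- _).
have [i3 _ _] : [/\ intg mu (fun x => G x * phi x), True & True].
  split => //; have [phic _] := test_C1 tphi.
  apply: (L1loc_mul lG cphi sub phic) => x xK; apply/eqP; apply: contrapT => /negP px.
  by apply: xK; exact: subset_closure.
apply: ae_eqJ; [|exact: intg_measurable i2|exact: intg_measurable i3].
apply: filterS (aeG k) => x hx; have [Ox|Ox] := pselect (O k x); first by rewrite hx.
rewrite (_ : phi x = 0) ?mulr0//; apply/eqP; apply: contrapT => /negP px.
by apply: Ox; apply: Kk; exact: subset_closure.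
Qed.

(** Product with a C^1 cutoff extends the weak derivative by 0 to the whole
    space, because psi phi is an admissible C^1 test function on D for every
    test function phi. *)
Lemma weakM_test D K i f g psi : open D -> is_weak_pderiv D i f g -> C1 psi ->
  compact K -> K `<=` D -> (forall x, ~ K x -> psi x = 0) ->
  is_weak_pderiv setT i (fun x => psi x * f x) (fun x => psi x * g x + f x * pderiv i psi x).
Proof.
move=> oD wf psiC cK KD psi0.
have [lf lg _] := wf.
have cl := compact_closed_rV cK.
have dpsi0 x : ~ K x -> pderiv i psi x = 0 by exact: pderiv_out.
have cpsi := psiC.1; have cdpsi := (psiC.2 i).2.
have i1 := L1loc_mul lf cK KD cpsi psi0.
have i2 := L1loc_mul lg cK KD cpsi psi0.
have i3 := L1loc_mul lf cK KD cdpsi dpsi0.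
have intg_L1 u : intg mu u -> L1loc setT u.
  move=> iu; split; first exact: intg_measurable iu.
  by move=> K' cK' _; apply: integrableS iu => //; exact: compact_measurable_rV.
apply: weakI.
- by apply: intg_L1; apply: eq_intg i1 => x; rewrite mulrC.
- by apply: intg_L1; apply: eq_intg (intgD i2 i3) => x; rewrite mulrC.
move=> phi tphi; have phiC := test_C1 tphi.
have [M M0 hM] : exists2 M, 0 <= M & forall x, `|phi x| <= M.
  have [K' [cK' _ p0 _]] := test_supp tphi; exact: cs_bounded cK' phiC.1 p0.
have mphi : measurable_fun setT phi by apply: continuous_measurableT; exact: phiC.1.
have GC := C1M psiC phiC.
have h0 x : ~ K x -> psi x * phi x = 0 by move=> /psi0 ->; rewrite mul0r.
have E := ext_C1 oD wf GC cK KD h0.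
have dE x : pderiv i (fun x => psi x * phi x) x = psi x * pderiv i phi x + phi x * pderiv i psi x.
  by apply: is_derive_pderiv; exact: C1M_is.
have i4 : intg mu (fun x => f x * (psi x * pderiv i phi x)).
  apply: (L1loc_mul lf cK KD) => [x|x /psi0 ->]; last by rewrite mul0r.
  exact: (cvgM (cpsi x) ((phiC.2 i).2 x)).
have i5 := intgMb i3 mphi hM.
have i6 := intgMb i2 mphi hM.
rewrite (@eqJ _ _ _ mu _ (fun x => f x * (psi x * pderiv i phi x))); last by move=> x; ring.
rewrite (@eqJ _ _ _ mu (fun x => f x * _) (fun x => f x * pderiv i (fun x => psi x * phi x) x - f x * pderiv i psi x * phi x)); last first.
  by move=> x; rewrite dE; ring.
have i7 : intg mu (fun x => f x * pderiv i (fun x => psi x * phi x) x).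
  by apply: eq_intg (intgD i4 i5) => x; rewrite dE; ring.
rewrite JB// E.
rewrite (@eqJ _ _ _ mu (fun x => (psi x * g x + _) * _) (fun x => g x * psi x * phi x + f x * pderiv i psi x * phi x)); last first.
  by move=> x; ring.
rewrite JD// opprD; congr (- _ - _); apply: eqJ => x; ring.
Qed.

End glue.

(** * Distributional consequences of the limit problem *)

Section limit_sol.
Variables (R : realType) (n : nat) (A L : R).
Hypotheses (n2 : (2 <= n)%N) (A0 : 0 < A) (L0 : 0 < L).
Variables (t : R).
Hypotheses (t0 : 0 < t).
Variable w : 'rV[R]_n -> R.
Hypothesis sol : limit_solution A L t w.
Local Notation mu := (@lebesgue_rV R n).
Local Notation D0 := [set x : 'rV[R]_n | x != 0].
Local Notation k0 := (fun=> 0%N).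
Local Notation k1 i := (incr i k0).
Local Notation k2 i := (incr i (incr i k0)).
Local Notation km := (@kmass R n).
Local Notation gw := (gradw w).
Implicit Types (i : 'I_n) (x y : 'rV[R]_n) (d : R).

Let oD0 : open D0. Proof. exact: punctured_open. Qed.

Lemma w_ge0 x : x != 0 -> 0 <= w x.
Proof. by case: sol => -[_ h _] _ _; exact: h. Qed.

Lemma w_continuous x : x != 0 -> {for x, continuous w}.
Proof.
rewrite -enorm_gt0 => x0; case: sol => -[h _ _] _ _.
have [_ cw] := h _ (divr_gt0 x0 (ltr0n R 2)).
have := cw x; rewrite /prop_for /continuous_at -nbhs_subspace_interior//.
by apply: eballC_interior => /=; rewrite ltr_pdivrMr// ltr_pMr// ltr1n.
Qed.

(** Only derivatives on complements of balls are given; they are glued to a weak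
    derivative on the punctured space in gw_weak. *)
Lemma w_weak_out e i : 0 < e -> exists2 h, is_weak_pderiv [set x | e < enorm x] i w h & L2 (~` eball e) h.
Proof.
move=> e0; case: sol => -[h _ _] _ _; have [[_ /(_ i)[g wg Lg]] _] := h _ e0.
exists g => //; apply: weak_sub wg; [exact: eballC_interior|exact: gt_enorm_open|exact: open_interior].
Qed.

Lemma gw_weak i : is_weak_pderiv D0 i w (gw i).
Proof.
pose O (k : nat) := [set x : 'rV[R]_n | k.+1%:R^-1 < enorm x].
have UO : \bigcup_k O k = D0.
  apply/seteqP; split => x.
    by move=> [k _] /= h; rewrite -enorm_gt0 (le_lt_trans _ h)// invr_ge0.
  rewrite /= -enorm_gt0 => x0; have := near_inv_le (divr_gt0 x0 (ltr0n R 2)).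
  move=> [k _ /(_ k (leqnn k)) hk]; exists k => //=; apply: le_lt_trans hk _.
  by rewrite ltr_pdivrMr// ltr_pMr// ltr1n.
have [g] : exists g, is_weak_pderiv (\bigcup_k O k) i w g.
  apply: weak_glue.
  - by move=> k; exact: gt_enorm_open.
  - move=> j k jk x /=; apply: le_lt_trans; rewrite lef_pV2 ?posrE ?ltr0n//.
    by rewrite ler_nat.
  - by move=> k; have [h wh _] := @w_weak_out k.+1%:R^-1 i (ltac:(by rewrite invr_gt0 ltr0n)); exists h.
  - rewrite UO => K cK KD; have [e e0 eK] := compact_away cK KD.
    have [k _ /(_ k (leqnn k)) hk] := near_inv_le e0.
    by exists k => x /eK; exact: le_lt_trans.
rewrite UO; exact: xget_weak.
Qed.

Lemma gw_measurable i : measurable_fun setT (gw i).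
Proof. by apply: measurable_punctured; have [_ []] := gw_weak i. Qed.

Lemma gw_L2 i K : compact K -> K `<=` D0 -> intg mu ((fun x => gw i x ^+ 2) \_ K).
Proof.
move=> cK KD; have mK := compact_measurable_rV cK.
have [e e0 eK] := compact_away cK KD.
have [h wh [mh ih]] := w_weak_out i e0.
have Ksub : K `<=` ~` eball e by move=> x /eK h1; apply/negP; rewrite -leNgt ltW.
have aeh : {ae mu, forall x, [set x | e < enorm x] x -> h x = gw i x}.
  apply: (@weak_unique R n _ i w w h (gw i) (@gt_enorm_open R n e) wh); last exact: aeW.
  apply: weak_sub (gw_weak i) => //; last exact: gt_enorm_open.
  by move=> x /= ex; rewrite -enorm_gt0; exact: lt_trans ex.
have ihK : intg mu ((fun x => h x ^+ 2) \_ K).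
  have : mu.-integrable K (fun x => (h x ^+ 2)%:E) by apply: integrableS ih => //; apply: measurableC; exact: eball_measurable.
  rewrite (integrable_mkcond _ mK) /intg -(restrict_EFin _ K).
  exact.
apply: ae_intg ihK.
- apply: filterS aeh => x hx; rewrite !patchE; case: ifPn => //; rewrite inE => /eK xe.
  by rewrite hx.
- apply/(measurable_restrictT _ mK); apply: measurable_funTS.
  by apply: measurable_funX; exact: gw_measurable.
Qed.

(** The inequality of the limit problem with an explicit weak gradient in place
    of the chosen representative, and with finite integrals. *)
Lemma variational_ineq (phi : 'rV[R]_n -> R) (g : 'I_n -> 'rV[R]_n -> R) e : 0 < e ->
  (forall i, is_weak_pderiv setT i phi (g i)) -> L2 setT phi -> (forall i, L2 setT (g i)) ->
  (forall x, 0 <= phi x) -> (forall x, eball e x -> phi x = 0) -> intg mu phi ->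
  (forall i, intg mu (fun x => gw i x * g i x)) ->
  - (L * \int[mu]_x phi x) <= \sum_i \int[mu]_x (gw i x * g i x).
Proof.
move=> e0 wg L2p L2g p0 pe ip igg.
have Vphi : VV phi.
  split; last 2 first.
  - exact: aeW.
  - by exists e => //; exact: aeW.
  by split => // i; exists (g i) => //; rewrite interiorT.
case: sol => _ h _; have := h _ Vphi.
rewrite EFinJ// -EFinM -EFinN.
have aeG i : {ae mu, forall x, grad phi i x = g i x}.
  have : {ae mu, forall x, setT x -> phi x = phi x} by exact: aeW.
  by move=> /(weak_unique openT (xget_weak (wg i)) (wg i)); apply: filterS => x; exact.
have mG i : measurable_fun setT (grad phi i) by have [_ []] := xget_weak (wg i).
have iS : intg mu (fun x => \sum_i gw i x * g i x) by exact: intg_sum.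
rewrite (_ : (\int[mu]_x (\sum_i gw i x * grad phi i x)%:E = \int[mu]_x (\sum_i gw i x * g i x)%:E)%E).
  by rewrite EFinJ// lee_fin J_sum.
apply: ae_eq_integral => //.
- by apply/measurable_EFinP; apply: measurable_sum => i; apply: measurable_funM => //; exact: gw_measurable.
- by apply/measurable_EFinP; exact: intg_measurable iS.
by apply: filterS (ae_all aeG) => x hx _; congr EFin; apply: eq_bigr => i _; rewrite hx.
Qed.

Section cutoff.
Variables (K : set 'rV[R]_n) (psi : 'rV[R]_n -> R).
Hypotheses (cK : compact K) (KD : K `<=` D0) (psiC : C1 psi).
Hypothesis psi0 : forall x, ~ K x -> psi x = 0.

Let dpsi0 i x : ~ K x -> pderiv i psi x = 0.
Proof. by apply: pderiv_out => //; exact: compact_closed_rV. Qed.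

Lemma cutoff_mul_continuous (z : 'rV[R]_n -> R) : continuous z -> (forall x, ~ K x -> z x = 0) -> continuous (fun x => w x * z x).
Proof.
move=> cz z0; apply: (@continuous_cs_mul R n D0 K) => //; first exact: compact_closed_rV.
by move=> x; exact: w_continuous.
Qed.

Lemma gw2_intg i (z : 'rV[R]_n -> R) : continuous z -> (forall x, ~ K x -> z x = 0) -> intg mu (fun x => gw i x * (z x * gw i x)).
Proof.
move=> cz z0; have [M _ hM] := cs_bounded cK cz z0.
apply: eq_intg (intgMb (gw_L2 i cK KD) (continuous_measurableT cz) hM) => x.
rewrite patchE; case: ifPn => [_|]; first by ring.
by move=> /negP; rewrite inE => /z0 ->; rewrite !mul0r !mulr0.
Qed.

Lemma gw_intg i (z : 'rV[R]_n -> R) : continuous z -> (forall x, ~ K x -> z x = 0) -> intg mu (fun x => gw i x * z x).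
Proof.
by move=> cz z0; have [_ lg _] := gw_weak i; exact: (L1loc_mul lg cK KD cz z0).
Qed.

Lemma gw_wd_intg i : intg mu (fun x => gw i x * (w x * pderiv i psi x)).
Proof.
apply: gw_intg; first by apply: cutoff_mul_continuous => [|x]; [exact: (psiC.2 i).2|exact: dpsi0].
by move=> x /(dpsi0 i) ->; rewrite mulr0.
Qed.

Lemma psiw_intg : intg mu (fun x => psi x * w x).
Proof.
have := cs_integrable cK (cutoff_mul_continuous psiC.1 psi0) => h.
have : intg mu (fun x => w x * psi x) by apply: h => x /psi0 ->; rewrite mulr0.
by apply: eq_intg => x; rewrite mulrC.
Qed.

(** The equality of the limit problem; the gradient of psi w is given by the
    product rule. *)
Lemma variational_eq : (forall x, 0 <= psi x) ->
  \sum_i \int[mu]_x (gw i x * (psi x * gw i x + w x * pderiv i psi x)) = - (L * \int[mu]_x (psi x * w x)).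
Proof.
move=> psi_ge0.
have [e e0 eK] := compact_away cK KD.
have Wpsi : WW psi.
  split => //; split.
  - split; first exact: L2_cs cK psiC.1 psi0.
    move=> i; exists (pderiv i psi); first by apply: C1_weak => //; exact: open_interior.
    by apply: (L2_cs measurableT cK (psiC.2 i).2) => x; exact: dpsi0.
  - exact: aeW.
  - exists e => //; apply: aeW => x /= xe; apply: psi0 => /eK.
    by apply/negP; rewrite -leNgt ltW.
case: sol => _ _ h; have := h _ Wpsi.
have wg i := weakM_test oD0 (gw_weak i) psiC cK KD psi0.
have aeG i : {ae mu, forall x, grad (psi \* w) i x = psi x * gw i x + w x * pderiv i psi x}.
  have : {ae mu, forall x, setT x -> psi x * w x = psi x * w x} by exact: aeW.
  by move=> /(weak_unique openT (xget_weak (wg i)) (wg i)); apply: filterS => x; exact.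
have mG i : measurable_fun setT (grad (psi \* w) i) by have [_ []] := xget_weak (wg i).
have ig i : intg mu (fun x => gw i x * (psi x * gw i x + w x * pderiv i psi x)).
  apply: eq_intg (intgD (gw2_intg i psiC.1 psi0) (gw_wd_intg i)) => x; by rewrite mulrDr.
have iS : intg mu (fun x => \sum_i gw i x * (psi x * gw i x + w x * pderiv i psi x)) by exact: intg_sum.
rewrite (_ : (\int[mu]_x (\sum_i gw i x * grad (psi \* w) i x)%:E =
   \int[mu]_x (\sum_i gw i x * (psi x * gw i x + w x * pderiv i psi x))%:E)%E).
  by rewrite !EFinJ//; [rewrite J_sum// -EFinM -EFinN => -[->]|exact: psiw_intg].
apply: ae_eq_integral => //.
- by apply/measurable_EFinP; apply: measurable_sum => i; apply: measurable_funM => //; exact: gw_measurable.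
- by apply/measurable_EFinP; exact: intg_measurable iS.
by apply: filterS (ae_all aeG) => x hx _; congr EFin; apply: eq_bigr => i _; rewrite hx.
Qed.

End cutoff.

Section box.
Variables (x : 'rV[R]_n) (d : R).
Hypotheses (d0 : 0 < d) (bD : cbox x (const_mx d) `<=` D0).
Local Notation B := (cbox x (const_mx d)).
Local Notation kd := (kern k0 d x).

Let cB : compact B. Proof. exact: cbox_compact. Qed.
Let kC : C1 kd. Proof. exact: C1_etaD. Qed.
Let kout k y : ~ B y -> kern k d x y = 0.
Proof. by move=> h; apply: etaD_outc => //; exact: const_gt0. Qed.
Let kcont k : continuous (kern k d x). Proof. exact: kern_continuous. Qed.

Lemma w_kern2 i : \int[mu]_y (w y * kern (k2 i) d x y) = - \int[mu]_y (gw i y * kern (k1 i) d x y).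
Proof.
have tk : test_function D0 (kern (k1 i) d x) by exact: test_kern.
have [_ _] := weakR (gw_weak i) tk; by rewrite pderiv_etaD.
Qed.

(** The inequality tested with the kernel itself, which is nonnegative. *)
Lemma kern_w_le : \sum_i \int[mu]_y (w y * kern (k2 i) d x y) <= L * km d.
Proof.
have [e e0 eB] := compact_away cB bD.
have wk i : is_weak_pderiv setT i kd (kern (k1 i) d x).
  by have := C1_weak i openT kC; rewrite pderiv_etaD.
have := variational_ineq e0 wk.
move=> /(_ (L2_cs measurableT cB (@kcont k0) (@kout k0))) H.
have {H} := H (fun i => L2_cs measurableT cB (@kcont (k1 i)) (@kout (k1 i))) (kern_ge0 d x).
have z y : eball e y -> kd y = 0.
  by move=> ye; apply: kout => /eB; apply/negP; rewrite -leNgt ltW.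
move=> /(_ z (integrable_kern k0 x d0)) H.
have {H} := H (fun i => gw_intg cB bD i (@kcont (k1 i)) (@kout (k1 i))).
rewrite int_kern// lerNl -sumrN => h.
by apply: le_trans h; apply: ler_sum => i _; rewrite w_kern2.
Qed.

(** The equality with psi = eta reads
    int eta |Dw|^2 + int w Dw . Deta = - L int eta w <= 0, and its second term
    is - 1/2 int w^2 Laplacian eta. *)
Lemma kern_w2_ge0 : 0 <= \sum_i \int[mu]_y (w y ^+ 2 * kern (k2 i) d x y).
Proof.
have E i : \int[mu]_y (w y ^+ 2 * kern (k2 i) d x y) = - (2 * \int[mu]_y (gw i y * (w y * pderiv i kd y))).
  have tk : test_function D0 (kern (k1 i) d x) by exact: test_kern.
  have := weak_square oD0 (gw_weak i) w_continuous tk; rewrite pderiv_etaD => ->.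
  by congr (- (2 * _)); apply: eqJ => y; rewrite pderiv_etaD mulrAC [RHS]mulrC.
under eq_bigr do rewrite E.
rewrite sumrN oppr_ge0 -mulr_sumr pmulr_rle0//.
have := variational_eq cB bD kC (@kout k0) (kern_ge0 d x).
have i1 i := gw2_intg cB bD i (@kcont k0) (@kout k0).
have i2 i := gw_wd_intg cB bD kC (@kout k0) i.
under eq_bigr => i _ do rewrite (@eqJ _ _ _ mu _ (fun y => gw i y * (kd y * gw i y) + gw i y * (w y * pderiv i kd y)) (fun y => mulrDr _ _ _)) (JD (i1 i) (i2 i)).
rewrite big_split /= => h.
have s0 : 0 <= \sum_i \int[mu]_y (gw i y * (kd y * gw i y)).
  by apply: sumr_ge0 => i _; apply: J_ge0 => y; rewrite mulrCA -expr2 mulr_ge0 ?sqr_ge0// kern_ge0.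
have p0 : 0 <= \int[mu]_y (kd y * w y).
  apply: J_ge0 => y; have [/bD h1|/(@kout k0) ->] := pselect (B y); last by rewrite mul0r.
  by rewrite mulr_ge0 ?kern_ge0 ?w_ge0.
have := mulr_ge0 (ltW L0) p0; move: h s0; lra.
Qed.

(** With m the minimum of w on the box, phi = eta w / m - eta is nonnegative. The
    inequality for phi and the equality for psi = eta add up to the bound
    opposite to kern_w_le. *)
Lemma kern_w_eq : (forall y, B y -> 0 < w y) ->
  \sum_i \int[mu]_y (w y * kern (k2 i) d x y) = L * km d.
Proof.
move=> wpos; apply/eqP; rewrite eq_le kern_w_le /=.
have [e e0 eB] := compact_away cB bD.
have [c cBx cmin] : exists2 c, c \in B & forall y, y \in B -> w c <= w y.
  apply: (@EVT_min_rV R n) => //.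
    by exists x => j; rewrite subrr normr0 mxE ltW.
  apply: continuous_in_subspaceT => y; rewrite inE => /bD; exact: w_continuous.
have m0 : 0 < w c by apply: wpos; move: cBx; rewrite inE.
set m := w c in cmin m0.
pose phi y := m^-1 * (kd y * w y) - kd y.
pose g i y := m^-1 * (kd y * gw i y + w y * pderiv i kd y) - kern (k1 i) d x y.
have wg i : is_weak_pderiv setT i phi (g i).
  apply: weakB; first by apply: weakZ; exact: weakM_test (gw_weak i) kC cB bD (@kout k0).
  by have := C1_weak i openT kC; rewrite pderiv_etaD.
have cwk : continuous (fun y => w y * kd y) by apply: (cutoff_mul_continuous cB bD); [exact: kcont|exact: kout].
have phiE y : phi y = m^-1 * (w y * kd y) - kd y by rewrite /phi [kd y * _]mulrC.
have phi_out y : ~ B y -> phi y = 0 by move=> /(@kout k0) h; rewrite /phi h mul0r mulr0 subrr.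
have cphi : continuous phi.
  move=> y; rewrite (_ : phi = fun y => m^-1 * (w y * kd y) - kd y); last by apply/funext.
  have h1 : {for y, continuous (fun y => m^-1 * (w y * kd y))} by apply: continuous_scale; exact: cwk.
  exact: (cvgB h1 (@kcont k0 y)).
have phi_ge y : 0 <= phi y.
  have [By|/phi_out ->//] := pselect (B y).
  rewrite /phi mulrCA -[X in _ - X]mulr1 -mulrBr mulr_ge0 ?kern_ge0// subr_ge0.
  by rewrite mulrC ler_pdivlMr// mul1r cmin// inE.
have phi_e y : eball e y -> phi y = 0.
  by move=> ye; apply: phi_out => /eB; apply/negP; rewrite -leNgt ltW.
have iphi : intg mu phi by exact: cs_integrable cB cphi phi_out.
have i1 i := gw2_intg cB bD i (@kcont k0) (@kout k0).
have i2 i := gw_wd_intg cB bD kC (@kout k0) i.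
have i3 i := gw_intg cB bD i (@kcont (k1 i)) (@kout (k1 i)).
have igg i : intg mu (fun y => gw i y * g i y).
  apply: eq_intg (intgB (intgZ m^-1 (intgD (i1 i) (i2 i))) (i3 i)) => y.
  by rewrite /g; ring.
have L2g i : L2 setT (g i).
  have mg : measurable_fun setT (g i) by have [_ []] := wg i.
  split => //.
  (* the continuous part of the gradient of phi *)
  pose b y := m^-1 * (w y * pderiv i kd y) - kern (k1 i) d x y.
  have db y : ~ B y -> pderiv i kd y = 0 by move=> h; rewrite pderiv_etaD; exact: kout.
  have cb : continuous b.
    have h1 : continuous (fun y => w y * pderiv i kd y).
      by apply: (cutoff_mul_continuous cB bD) => //; exact: (kC.2 i).2.
    move=> y; have h2 : {for y, continuous (fun y => m^-1 * (w y * pderiv i kd y))} by apply: continuous_scale; exact: h1.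
    exact: (cvgB h2 (@kcont (k1 i) y)).
  have b_out y : ~ B y -> b y = 0 by move=> h; rewrite /b db// kout// !mulr0 subrr.
  have ib : intg mu (fun y => b y ^+ 2).
    apply: (cs_integrable cB); last by move=> y /b_out ->; rewrite expr0n.
    by move=> y; exact: (cvgM (cb y) (cb y)).
  have ia : intg mu (fun y => gw i y * (kd y ^+ 2 * gw i y)).
    apply: (gw2_intg cB bD i); last by move=> y /(@kout k0) ->; rewrite expr0n.
    by move=> y; exact: (cvgM (@kcont k0 y) (@kcont k0 y)).
  apply: (@le_intg _ _ _ _ _ (fun y => 2 * m^-1 ^+ 2 * (gw i y * (kd y ^+ 2 * gw i y)) + 2 * b y ^+ 2)).
  - exact: measurable_funX.
  - move=> y; rewrite ger0_norm ?sqr_ge0//.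
    have -> : g i y = m^-1 * (kd y * gw i y) + b y by rewrite /g /b; ring.
    have := sqr_ge0 (m^-1 * (kd y * gw i y) - b y); move: (m^-1) (kd y) (gw i y) (b y) => p q r s; nra.
  - by apply: intgD; apply: intgZ.
have := variational_ineq e0 wg (L2_cs measurableT cB cphi phi_out) L2g phi_ge phi_e iphi igg.
have E i : \int[mu]_y (gw i y * g i y) =
   m^-1 * \int[mu]_y (gw i y * (kd y * gw i y + w y * pderiv i kd y)) + \int[mu]_y (w y * kern (k2 i) d x y).
  rewrite w_kern2 -JZ; last by apply: eq_intg (intgD (i1 i) (i2 i)) => y; rewrite mulrDr.
  rewrite -JB//; last by apply: intgZ; apply: eq_intg (intgD (i1 i) (i2 i)) => y; rewrite mulrDr.
  by apply: eqJ => y; rewrite /g; ring.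
rewrite (eq_bigr _ (fun i _ => E i)).
rewrite big_split /= -mulr_sumr (variational_eq cB bD kC (@kout k0) (kern_ge0 d x)).
have ik := integrable_kern k0 x d0.
have ikw := psiw_intg cB bD kC (@kout k0).
rewrite /phi JB//; last exact: intgZ.
rewrite JZ// int_kern// -/(km d).
move: (\int[mu]_y (kd y * w y)) (\sum_i _) (km d) (m^-1) => p s q r; lra.
Qed.

End box.
End limit_sol.

(** * Solutions are bounded at infinity *)

Section bounded.
Variables (R : realType) (n : nat) (A L : R).
Hypotheses (n2 : (2 <= n)%N) (A0 : 0 < A) (L0 : 0 < L).
Variables (t : R).
Hypotheses (t0 : 0 < t).
Variable w : 'rV[R]_n -> R.
Hypothesis sol : limit_solution A L t w.
Local Notation mu := (@lebesgue_rV R n).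
Local Notation D0 := [set x : 'rV[R]_n | x != 0].
Local Notation k2 i := (incr i (incr i (fun=> 0%N))).
Implicit Types (i : 'I_n) (x y : 'rV[R]_n) (d : R).

Lemma norm_eball x : 1 <= `|x| -> ~ eball 1 x.
Proof. by move=> h; apply/negP; rewrite -leNgt (le_trans h)// norm_le_enorm. Qed.

Lemma norm_D0 x : 1 <= `|x| -> x != 0.
Proof. by move=> h; rewrite -normr_gt0 (lt_le_trans _ h). Qed.

(** The function w^2 is integrable at infinity and subharmonic. *)
Lemma w_bounded_out : exists2 M, 0 <= M & forall x, 2 <= `|x| -> w x <= M.
Proof.
pose f := (fun x => w x ^+ 2) \_ (~` eball 1).
have mB : measurable (~` eball 1 : set 'rV[R]_n) by apply: measurableC; exact: eball_measurable.
have fE x : 1 <= `|x| -> f x = w x ^+ 2.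
  by move=> /norm_eball h; rewrite /f patchE mem_set.
have intf : intg mu f.
  case: sol => -[h _ _] _ _; have [[[_ iw] _] _] := h _ (@ltr01 R).
  by move: iw; rewrite (integrable_mkcond _ mB) /intg -(restrict_EFin _ _).
have cf x : 1 < `|x| -> {for x, continuous f}.
  move=> x1; apply: (@near_eq_continuous _ _ _ (fun x => w x ^+ 2)).
    have : nbhs x [set y : 'rV[R]_n | 1 < `|y|].
      by apply: open_nbhs_nbhs; split => //; apply: (open_comp _ (@open_gt R 1)) => y _; exact: norm_continuous.
    by apply: filterS => y /ltW /fE.
  have cw := w_continuous sol (norm_D0 (ltW x1)).
  exact: (cvgM cw cw).
pose S := cbox 0 (const_mx 3) `&` [set x : 'rV[R]_n | 1 <= `|x|].
have Sc : compact S.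
  apply: compact_closedI; first exact: cbox_compact.
  by apply: (closed_comp _ (@closed_ge R 1)) => y _; exact: norm_continuous.
have [M0 M00 hM0] : exists2 M0, 0 <= M0 & forall x, 1 <= `|x| -> `|x| <= 3 -> f x <= M0.
  have inS x : 1 <= `|x| -> `|x| <= 3 -> S x.
    move=> h1 h3; split => // j; rewrite !mxE subr0.
    exact: le_trans (coord_le_norm x j) h3.
  have [SN|SN] := pselect (S !=set0); last first.
    by exists 0 => // x h1 h3; case: SN; exists x; exact: inS.
  have [c cS cmax] : exists2 c, c \in S & forall y, y \in S -> w y ^+ 2 <= w c ^+ 2.
    apply: (@EVT_max_rV R n (fun x => w x ^+ 2)) => //.
    apply: continuous_in_subspaceT => y; rewrite inE => -[_ /= y1].
    have cw := w_continuous sol (norm_D0 y1); exact: (cvgM cw cw).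
  exists (w c ^+ 2); first exact: sqr_ge0.
  by move=> x h1 h3; rewrite fE// cmax// inE; exact: inS.
have n0 : (0 < n)%N by exact: ltnW.
have H := exterior_bound n0 intf M00 cf hM0.
exists (1 + M0); first by rewrite addr_ge0.
move=> x x2; have x1 : 1 <= `|x| by rewrite (le_trans _ x2)// ler1n.
have : f x <= M0.
  apply: H => // y d d0 d1 y2.
  have yd z : cbox y (const_mx d) z -> 1 <= `|z|.
    move=> /(cbox_ball ltr01 d1); rewrite -ball_normE /= => h.
    have := lerB_dist y z; move: h y2; lra.
  have bD : cbox y (const_mx d) `<=` D0 by move=> z /yd /norm_D0.
  apply: le_trans (kern_w2_ge0 L0 sol d0 bD) _; apply: ler_sum => i _.
  rewrite /moll le_eqVlt; apply/orP; left; apply/eqP; apply: eqJ => z.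
  have [/yd/fE ->//|h] := pselect (cbox y (const_mx d) z).
  by rewrite /kern etaD_outc ?mulr0// => j; rewrite mxE.
rewrite fE//; have := sqr_ge0 (w x - 1); rewrite sqrrB1; nra.
Qed.

End bounded.

(** * Comparison and uniqueness *)

Section near_origin.
Variables (R : realType) (n : nat).
Hypotheses (n2 : (2 <= n)%N).
Implicit Types (A L t r s M : R) (x y : 'rV[R]_n).

Let n0 : (0 : R) < n%:R. Proof. by rewrite ltr0n (leq_trans _ n2). Qed.

Lemma kap_big M : exists2 r : R, 0 < r & forall s, 0 < s -> s < r -> M <= kap n s.
Proof.
have [E|nn] := eqVneq n 2%N.
  exists (expR (- M)); first exact: expR_gt0.
  by move=> s s0 sr; rewrite /kap E eqxx lerNr -ler_expR lnK ?posrE// ltW.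
have n3 : (3 <= n)%N by rewrite ltn_neqAle eq_sym nn.
have m0 : (0 : R) < n%:R - 2 by rewrite subr_gt0 ltr_nat.
pose q := (n%:R - 2) * `|M| + 1.
have q1 : 1 <= q by rewrite lerDr mulr_ge0// ltW.
have q0 : 0 < q by exact: lt_le_trans q1.
exists q^-1; first by rewrite invr_gt0.
move=> s s0 sr; rewrite /kap (negbTE nn).
have qs : q <= s^-1 by rewrite -[q]invrK lef_pV2 ?posrE ?invr_gt0// ltW.
have s1 : 1 <= s^-1 by exact: le_trans qs.
have : s^-1 <= s^-1 ^+ (n - 2) by rewrite -[leLHS]expr1 ler_weXn2l// subn_gt0.
move=> /(le_trans qs) h; rewrite mulrC ler_pdivlMr//.
have hM : M * (n%:R - 2) <= (n%:R - 2) * `|M| by rewrite mulrC ler_wpM2l ?ler_norm// ltW.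
by rewrite (le_trans hM)// (le_trans _ h)// /q lerDl.
Qed.

Lemma cAZ A a : cA n (A * a) = cA n A * a.
Proof. by rewrite /cA; case: ifP => // _; rewrite mulrAC. Qed.

Lemma baiocchi_Eprof A L t x : 0 < A -> 0 < L -> 0 < t -> x != 0 -> enorm x < rho n A L t ->
  baiocchi A L t x = Eprof n A L t (enorm x).
Proof.
move=> A0 L0 t0 x0 xr; rewrite /baiocchi U_ALE ?enorm_gt0//.
by rewrite /uprof xr.
Qed.

Lemma baiocchi_far A L t x : 0 < A -> 0 < L -> 0 < t -> x != 0 -> rho n A L t <= enorm x -> baiocchi A L t x = 0.
Proof.
move=> A0 L0 t0 x0 xr; rewrite /baiocchi U_ALE ?enorm_gt0//.
by rewrite /uprof ltNge xr.
Qed.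

Lemma baiocchi_big A L t M : 0 < A -> 0 < L -> 0 < t ->
  exists2 r : R, 0 < r & forall x, x != 0 -> enorm x < r -> M <= baiocchi A L t x.
Proof.
move=> A0 L0 t0; have c0 : 0 < cA n A * t by rewrite mulr_gt0// cA_gt0.
have [r r0 hr] := kap_big ((M + Ecst n A L t) / (cA n A * t)).
exists (Num.min r (rho n A L t)); first by rewrite lt_min r0 rho_gt0.
move=> x x0; rewrite lt_min => /andP[xr xrho]; rewrite baiocchi_Eprof//.
have := hr _ (ltac:(by rewrite enorm_gt0) : 0 < enorm x) xr.
rewrite ler_pdivrMr// mulrC => h; rewrite /Eprof lerBrDr (le_trans h)// lerDl.
by rewrite mulr_ge0 ?sqr_ge0// divr_ge0 ?ltW// mulr_gt0.
Qed.

(** The singular parts of both transforms are multiples of kap by c t; all the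
    other terms are bounded near the origin. *)
Lemma baiocchi_ratio A L L' a t : 0 < A -> 0 < L -> 0 < L' -> 0 < a -> 0 < t ->
  exists r C : R, [/\ 0 < r, 0 <= C & forall x, x != 0 -> enorm x < r ->
    `|baiocchi (A * a) L' t x - a * baiocchi A L t x| <= C].
Proof.
move=> A0 L0 L'0 a0 t0; have Aa0 : 0 < A * a by exact: mulr_gt0.
pose c1 := L' / (2 * n%:R) - a * (L / (2 * n%:R)).
pose c2 := Ecst n (A * a) L' t - a * Ecst n A L t.
exists (Num.min 1 (Num.min (rho n A L t) (rho n (A * a) L' t))), (`|c1| + `|c2|); split.
- by rewrite !lt_min ltr01 !rho_gt0.
- by rewrite addr_ge0.
move=> x x0; rewrite !lt_min => /and3P[x1 xr xr']; rewrite !baiocchi_Eprof// /Eprof cAZ.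
rewrite (_ : _ - _ = c1 * enorm x ^+ 2 - c2); last by rewrite /c1 /c2; ring.
rewrite (le_trans (ler_normB _ _))// lerD2r normrM ler_piMr//.
by rewrite ger0_norm ?sqr_ge0// exprn_ile1 ?enorm_ge0// ltW.
Qed.

Lemma enorm_le x : enorm x <= n%:R * `|x|.
Proof.
rewrite -(@ler_pXn2r _ 2) ?nnegrE ?enorm_ge0 ?mulr_ge0 ?(ltW n0)// enorm_sqr /qd.
apply: (@le_trans _ _ (\sum_(j < n) `|x| ^+ 2)).
  apply: ler_sum => j _; rewrite mxE subr0 -real_normK ?num_real//.
  by rewrite ler_pXn2r ?nnegrE// coord_le_norm.
rewrite sumr_const card_ord -(mulr_natl (`|x| ^+ 2) n) exprMn ler_wpM2r ?sqr_ge0//.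
by rewrite expr2 ler_peMl ?(ltW n0)// ler1n (leq_trans _ n2).
Qed.

End near_origin.

Section comparison.
Variables (R : realType) (n : nat).
Hypotheses (n2 : (2 <= n)%N).
Local Notation mu := (@lebesgue_rV R n).
Local Notation D0 := [set x : 'rV[R]_n | x != 0].
Local Notation k0 := (fun=> 0%N).
Local Notation k1 i := (incr i k0).
Local Notation k2 i := (incr i (incr i k0)).
Local Notation km := (@kmass R n).
Implicit Types (A L t r s M : R) (x y : 'rV[R]_n) (i : 'I_n).

Let n0 : (0 : R) < n%:R. Proof. by rewrite ltr0n (leq_trans _ n2). Qed.

(** A function that is nonpositive near the origin and near infinity attains a
    positive value only if it has a positive maximum on some compact annulus. *)
Lemma max_comparison (v : 'rV[R]_n -> R) D c r1 r2 :
  (forall x, x != 0 -> {for x, continuous v}) ->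
  0 < r1 -> (forall x, x != 0 -> enorm x < r1 -> v x <= 0) ->
  (forall x, r2 <= enorm x -> x != 0 -> v x <= 0) ->
  open D -> D `<=` D0 -> (forall x, x != 0 -> 0 < v x -> D x) ->
  0 < c -> (forall x d, 0 < d -> cbox x (const_mx d) `<=` D ->
    c * km d <= \sum_i \int[mu]_y (v y * kern (k2 i) d x y)) ->
  forall x, x != 0 -> v x <= 0.
Proof.
move=> cv r10 vnear vfar oD DD0 vD c0 hbox x x0; rewrite leNgt; apply/negP => vx.
(* a compact annulus outside which v is nonpositive *)
pose S := cbox 0 (const_mx r2) `&` ((@enorm R n) @^-1` [set s | r1 <= s]).
have Sc : compact S.
  apply: compact_closedI; first exact: cbox_compact.
  by apply: (closed_comp _ (@closed_ge R r1)) => y _; exact: enorm_continuous.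
have S0 y : S y -> y != 0 by move=> [_ /= h]; rewrite -enorm_gt0 (lt_le_trans r10).
have inS y : y != 0 -> 0 < v y -> S y.
  move=> y0 vy; split.
    move=> j; rewrite !mxE subr0 (le_trans (coord_le_norm y j))// (le_trans (norm_le_enorm y))//.
    by rewrite leNgt; apply/negP => h; move: vy; rewrite ltNge vfar// ltW.
  by rewrite /= leNgt; apply/negP => h; move: vy; rewrite ltNge vnear.
have [z zS zmax] : exists2 z, z \in S & forall y, y \in S -> v y <= v z.
  apply: (@EVT_max_rV R n v S) => //; first by exists x; exact: inS.
  by apply: continuous_in_subspaceT => y; rewrite inE => /S0; exact: cv.
have vz : 0 < v z by apply: (lt_le_trans vx); apply: zmax; rewrite inE; exact: inS.
have z0 : z != 0 by apply: S0; move: zS; rewrite inE.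
apply: (@strict_max_principle R n D v z c (ltnW n2) oD _ (vD _ z0 vz) _ c0 hbox).
  by move=> y /DD0; exact: cv.
move=> y /DD0 y0; have [vy|vy] := ltP 0 (v y); first by rewrite zmax// inE; exact: inS.
exact: le_trans vy (ltW vz).
Qed.

Lemma kern_intg (f : 'rV[R]_n -> R) k x d : 0 < d -> cbox x (const_mx d) `<=` D0 ->
  (forall x, x != 0 -> {for x, continuous f}) -> intg mu (fun y => f y * kern k d x y).
Proof.
move=> d0 bD cf; have kout y : ~ cbox x (const_mx d) y -> kern k d x y = 0.
  by move=> h; apply: etaD_outc => //; exact: const_gt0.
apply: (cs_integrable (@cbox_compact R n x (const_mx d))).
  apply: (@continuous_cs_mul R n D0 (cbox x (const_mx d))) => //.
  - exact: punctured_open.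
  - by apply: compact_closed_rV; exact: cbox_compact.
  - exact: kern_continuous.
by move=> y /kout ->; rewrite mulr0.
Qed.

Lemma kern_qd x d : 0 < d -> \sum_i \int[mu]_y (qd 0 y * kern (k2 i) d x y) = 2 * n%:R * km d.
Proof.
move=> d0; have qC : C1 (qd (0 : 'rV[R]_n)).
  by apply: (@C1_radial R n 0 id (fun=> 1)); exact: cst_continuous.
have E i : \int[mu]_y (qd 0 y * kern (k2 i) d x y) = 2 * km d.
  have tk : test_function setT (kern (k1 i) d x) by exact: test_kern.
  have tk0 : test_function setT (kern k0 d x) by exact: test_kern.
  have := weak_C1_test i qC tk; rewrite pderiv_etaD => ->.
  rewrite (@eqJ _ _ _ mu _ (fun y => 2 * (y ord0 i * pderiv i (kern k0 d x) y))); last first.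
    by move=> y; rewrite (is_derive_pderiv (is_derive_qd i 0 y)) mxE subr0 pderiv_etaD mulrA.
  have ic : intg mu (fun y => y ord0 i * pderiv i (kern k0 d x) y).
    rewrite pderiv_etaD; apply: (cs_integrable (@cbox_compact R n x (const_mx d))).
      move=> y; have c1 : {for y, continuous (fun x : 'rV[R]_n => x ord0 i)} by exact: coord_continuous.
      exact: (cvgM c1 (@kern_continuous R n (k1 i) d x y)).
    by move=> y h; rewrite etaD_outc ?mulr0//; exact: const_gt0.
  rewrite JZ// (weak_C1_test i (@C1_coord R n i) tk0) mulrN opprK; congr (2 * _).
  rewrite /kmass -(@int_kern R n k0 d x d0); apply: eqJ => y.
  by rewrite (is_derive_pderiv (is_derive_coord i i y)) eqxx mul1r.
by rewrite (eq_bigr _ (fun i _ => E i)) sumr_const card_ord -(mulr_natl (2 * km d) n) mulrCA mulrA.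
Qed.

Lemma kern_ind_le A L t x d : 0 < d ->
  \int[mu]_y (kern k0 d x y * \1_[set x | enorm x < rho n A L t] y) <= km d.
Proof.
move=> d0; rewrite /kmass -(@int_kern R n k0 d x d0).
have ik := integrable_kern k0 x d0.
apply: le_J => //.
  apply: (@intgMb _ _ _ _ _ _ 1) => //.
    by apply: measurable_indic; exact: eball_measurable.
  by move=> y; rewrite indicE; case: (_ \in _); rewrite ?normr1 ?normr0.
by move=> y; rewrite ler_piMr ?kern_ge0// indicE lern1 leq_b1.
Qed.

Variables (A L t : R).
Hypotheses (A0 : 0 < A) (L0 : 0 < L) (t0 : 0 < t).
Variable w : 'rV[R]_n -> R.
Hypothesis sol : limit_solution A L t w.

Lemma w_ratio e : 0 < e -> exists2 r : R, 0 < r & forall x, x != 0 -> enorm x < r ->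
  (1 - e) * baiocchi A L t x <= w x /\ w x <= (1 + e) * baiocchi A L t x.
Proof.
move=> e0; case: sol => -[_ _ h] _ _.
move/cvgrPdist_le : h => /(_ _ e0); rewrite near_withinE => /nbhs_ballP[r /= r0 hr].
exists (Num.min r (rho n A L t)); first by rewrite lt_min r0 rho_gt0.
move=> x x0; rewrite lt_min => /andP[xr xrho].
have xb : ball (0 : 'rV[R]_n) r x.
  by rewrite -ball_normE /= sub0r normrN (le_lt_trans (norm_le_enorm x)).
have U0 : 0 < baiocchi A L t x.
  by rewrite /baiocchi U_ALE// ?uprof_gt0// enorm_gt0.
have := hr x xb x0; rewrite ler_norml -/(baiocchi A L t x) => /andP[h1 h2].
split.
  by rewrite -ler_pdivlMr//; move: h2; lra.
by rewrite -ler_pdivrMr//; move: h1; lra.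
Qed.

(** For v = U' - w, with U' the perturbed transform: near the origin
    v <= - (s / 2) U + C, outside the support of U' it is nonpositive, and on
    this support Laplacian v >= L (1 + s) - L. *)
Lemma w_ge_baiocchi s x : 0 < s -> s < 1 -> x != 0 -> baiocchi (A * (1 - s)) (L * (1 + s)) t x <= w x.
Proof.
move=> s0 s1 x0; have s1' : 0 < 1 - s by rewrite subr_gt0.
have A'0 : 0 < A * (1 - s) by exact: mulr_gt0.
have L'0 : 0 < L * (1 + s) by rewrite mulr_gt0// addr_gt0.
pose U' := baiocchi (A * (1 - s)) (L * (1 + s)) t : 'rV[R]_n -> R.
have s20 : 0 < s / 2 by rewrite divr_gt0.
have [ra [C [ra0 C0 hC]]] := baiocchi_ratio n2 A0 L0 L'0 s1' t0.
have [rb rb0 hb] := w_ratio s20.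
have [rc rc0 hc] := baiocchi_big n2 (C / (s / 2)) A0 L0 t0.
pose D := [set y : 'rV[R]_n | y != 0] `&` eball (rho n (A * (1 - s)) (L * (1 + s)) t).
rewrite -/U' -subr_le0.
have cU' y : y != 0 -> {for y, continuous U'} by exact: baiocchi_continuous.
have cw y : y != 0 -> {for y, continuous w} by move=> y0; exact: (w_continuous sol y0).
apply: (@max_comparison (fun x => U' x - w x) D (L * s)
  (Num.min ra (Num.min rb rc)) (rho n (A * (1 - s)) (L * (1 + s)) t)) => //.
- by move=> y y0; exact: (cvgB (cU' y y0) (cw y y0)).
- by rewrite !lt_min ra0 rb0 rc0.
- move=> y y0; rewrite !lt_min => /and3P[ya yb yc].
  have := hC y y0 ya; rewrite ler_norml => /andP[_ h1].
  have [h2 _] := hb y y0 yb; have := hc y y0 yc; rewrite ler_pdivrMr// => h3.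
  rewrite /U'; move: h1 h2 h3; move: (baiocchi _ _ _ _) (baiocchi A L t y) (w y) => u' u w'; lra.
- by move=> y hy y0; rewrite /U' (baiocchi_far n2)// sub0r oppr_le0; exact: (w_ge0 sol y0).
- by apply: openI; [exact: punctured_open|exact: eball_open].
- by move=> y [].
- move=> y y0; rewrite subr_gt0 => wy; split => //; rewrite /eball /= ltNge; apply/negP => h.
  by move: wy; rewrite /U' (baiocchi_far n2)// ltNge (w_ge0 sol).
- exact: mulr_gt0.
move=> y d d0 bD; have bD0 : cbox y (const_mx d) `<=` D0 by move=> z /bD[].
have E i : \int[mu]_z ((U' z - w z) * kern (k2 i) d y z) =
    \int[mu]_z (U' z * kern (k2 i) d y z) - \int[mu]_z (w z * kern (k2 i) d y z).
  by rewrite -JB; [apply: eqJ => z; rewrite mulrBl|exact: kern_intg|exact: kern_intg].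
rewrite (eq_bigr _ (fun i _ => E i)) sumrB (kern_baiocchi n2 A'0 L'0 t0 d0 bD0).
rewrite (@eqJ _ _ _ mu _ (kern k0 d y)); last first.
  move=> z; have [/bD[_ zr]|h] := pselect (cbox y (const_mx d) z).
    by rewrite indicE mem_set// mulr1.
  by rewrite /kern etaD_outc ?mul0r//; exact: const_gt0.
rewrite int_kern// -/(km d).
have := kern_w_le sol d0 bD0; move: (\sum_i _) (km d) => p q; lra.
Qed.

(** For v = w - U' - kp |x|^2, with U' the perturbed transform: near the origin
    v <= - (s / 2) U + C, far away the last term beats the bound on w, and where
    w > 0 one has Laplacian v >= L - L (1 - s) - 2 n kp. Then kp tends to 0. *)
Lemma w_le_baiocchi s x : 0 < s -> s < 1 -> x != 0 -> w x <= baiocchi (A * (1 + s)) (L * (1 - s)) t x.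
Proof.
move=> s0 s1 x0; have s1' : 0 < 1 + s by rewrite addr_gt0.
have A'0 : 0 < A * (1 + s) by exact: mulr_gt0.
have L'0 : 0 < L * (1 - s) by rewrite mulr_gt0// subr_gt0.
pose U' := baiocchi (A * (1 + s)) (L * (1 - s)) t : 'rV[R]_n -> R.
have s20 : 0 < s / 2 by rewrite divr_gt0.
have [ra [C [ra0 C0 hC]]] := baiocchi_ratio n2 A0 L0 L'0 s1' t0.
have [rb rb0 hb] := w_ratio s20.
have [rc rc0 hc] := baiocchi_big n2 (C / (s / 2)) A0 L0 t0.
have [M M0 hM] := w_bounded_out n2 L0 sol.
have cU' y : y != 0 -> {for y, continuous U'} by exact: baiocchi_continuous.
have U'0 y : y != 0 -> 0 <= U' y by exact: baiocchi_ge0.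
have cw y : y != 0 -> {for y, continuous w} by move=> y0; exact: (w_continuous sol y0).
pose D := [set y : 'rV[R]_n | y != 0 /\ 0 < w y].
have oD : open D.
  rewrite openE => y [y0 wy].
  have h1 : nbhs y [set y : 'rV[R]_n | y != 0] by apply: open_nbhs_nbhs; split => //; exact: punctured_open.
  have h2 : nbhs (w y) [set s : R | 0 < s] by apply: open_nbhs_nbhs; split => //; exact: open_gt.
  by apply: filterS2 h1 (cw y y0 _ h2) => z.
apply/ler_addgt0Pr => e e0.
have q0 : 0 < qd 0 x + 1 by rewrite ltr_wpDl// qd_ge0.
(* half of the margin L s is left for the Laplacian, and the perturbation is at
   most e at the point x *)
pose kp := Num.min (L * s / (4 * n%:R)) (e / (qd 0 x + 1)).
have kp0 : 0 < kp.
  by rewrite lt_min !divr_gt0 ?mulr_gt0.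
have kp1 : 2 * n%:R * kp <= L * s / 2.
  have : kp <= L * s / (4 * n%:R) by rewrite ge_min lexx.
  by rewrite ler_pdivlMr ?mulr_gt0//; lra.
have kp2 : kp * qd 0 x <= e.
  apply: (@le_trans _ _ (kp * (qd 0 x + 1))); first by rewrite ler_wpM2l ?(ltW kp0)// lerDl.
  by rewrite -ler_pdivlMr// ge_min lexx orbT.
suff h : w x - U' x - kp * qd 0 x <= 0.
  by move: h kp2; rewrite /U'; move: (w x) (baiocchi _ _ _ _) => a b; lra.
have cq y : {for y, continuous (fun y : 'rV[R]_n => kp * qd 0 y)}.
  by apply: continuous_scale; exact: qd_continuous.
apply: (@max_comparison (fun x => w x - U' x - kp * qd 0 x) D (L * s / 2)
  (Num.min ra (Num.min rb rc)) (2 * n%:R + 1 + M / kp)) => //.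
- move=> y y0; have c1 : {for y, continuous (fun y => w y - U' y)} by exact: (cvgB (cw y y0) (cU' y y0)).
  exact: (cvgB c1 (cq y)).
- by rewrite !lt_min ra0 rb0 rc0.
- move=> y y0; rewrite !lt_min => /and3P[ya yb yc].
  have := hC y y0 ya; rewrite ler_norml => /andP[h1 _].
  have [_ h2] := hb y y0 yb; have := hc y y0 yc; rewrite ler_pdivrMr// => h3.
  have h4 : 0 <= kp * qd 0 y by rewrite mulr_ge0 ?(ltW kp0)// qd_ge0.
  rewrite /U'; move: h1 h2 h3 h4; move: (baiocchi _ _ _ _) (baiocchi A L t y) (w y) (kp * _) => u' u w' k; lra.
- move=> y hy y0.
  have Mk : 0 <= M / kp by rewrite divr_ge0 ?(ltW kp0).
  have y2 : 2 <= `|y|.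
    have := le_trans hy (enorm_le n2 y) => h.
    have : n%:R * 2 <= n%:R * `|y| by move: h n0 Mk; move: (M / kp) (_ * `|y|) => a b; lra.
    by rewrite ler_pM2l.
  have h1 : M <= kp * qd 0 y.
    rewrite -ler_pdivrMl// mulrC -enorm_sqr.
    have e1 : 1 <= enorm y by move: hy n0 Mk; lra.
    apply: (@le_trans _ _ (enorm y)); first by move: hy n0; lra.
    by rewrite expr2 ler_peMl// enorm_ge0.
  have := U'0 y y0; have := hM y y2; move: h1; lra.
- by move=> y [].
- move=> y y0 vy; split => //.
  have h4 : 0 <= kp * qd 0 y by rewrite mulr_ge0 ?(ltW kp0)// qd_ge0.
  have := U'0 y y0; move: h4 vy; lra.
- by rewrite divr_gt0// mulr_gt0.
move=> y d d0 bD; have bD0 : cbox y (const_mx d) `<=` D0 by move=> z /bD[].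
have wp z : cbox y (const_mx d) z -> 0 < w z by move=> /bD[].
have i1 i := kern_intg (k2 i) d0 bD0 cw.
have i2 i := kern_intg (k2 i) d0 bD0 cU'.
have i3 i : intg mu (fun z => qd 0 z * kern (k2 i) d y z).
  by apply: kern_intg => // z _; exact: qd_continuous.
have E i : \int[mu]_z ((w z - U' z - kp * qd 0 z) * kern (k2 i) d y z) =
    \int[mu]_z (w z * kern (k2 i) d y z) - \int[mu]_z (U' z * kern (k2 i) d y z)
      - kp * \int[mu]_z (qd 0 z * kern (k2 i) d y z).
  rewrite -JZ// -JB// -JB; [|exact: intgB|exact: intgZ].
  by apply: eqJ => z; ring.
rewrite (eq_bigr _ (fun i _ => E i)) !sumrB -mulr_sumr (kern_baiocchi n2 A'0 L'0 t0 d0 bD0).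
rewrite (kern_w_eq sol d0 bD0 wp) kern_qd//.
have := @kern_ind_le (A * (1 + s)) (L * (1 - s)) t y d d0.
have kmd := kmass_gt0 n d0; have := ler_wpM2r (ltW kmd) kp1.
move=> h1 h2; have := ler_wpM2l (ltW L'0) h2.
move: h1; rewrite !(mulrA kp); move: (\int[mu]_z _) => p; move: (kmass n d) => q; lra.
Qed.

(** Eprof vanishes at rho; this form has no case distinction and is visibly
    continuous in the parameters. *)
Lemma uprof_min a b r : uprof n a b t r = Eprof n a b t (Num.min r (rho n a b t)).
Proof.
by rewrite /uprof; case: ltP => // _; rewrite Eprof_rho.
Qed.

Lemma baiocchi_param_cvg (a b : nat -> R) x : x != 0 -> (forall k, 0 < a k) -> (forall k, 0 < b k) ->
  a @ \oo --> A -> b @ \oo --> L -> (fun k => baiocchi (a k) (b k) t x) @ \oo --> baiocchi A L t x.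
Proof.
move=> x0 a0 b0 ca cb; have x0' : 0 < enorm x by rewrite enorm_gt0.
have UE A' L' : 0 < A' -> 0 < L' -> baiocchi A' L' t x = Eprof n A' L' t (Num.min (enorm x) (rho n A' L' t)).
  by move=> h1 h2; rewrite /baiocchi U_ALE// uprof_min.
rewrite UE// (_ : (fun k => _) = (fun k => Eprof n (a k) (b k) t (Num.min (enorm x) (rho n (a k) (b k) t)))); last first.
  by apply/funext => k; rewrite UE.
have cAE A' : cA n A' = A' * cA n 1 by rewrite -{1}[A']mul1r cAZ mulrC.
have cc : (fun k => cA n (a k)) @ \oo --> cA n A.
  rewrite cAE (_ : (fun k => _) = (fun k => a k * cA n 1)); last by apply/funext => k; rewrite cAE.
  by apply: cvgM => //; exact: cvg_cst.
have crho : (fun k => rho n (a k) (b k) t) @ \oo --> rho n A L t.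
  rewrite rhoE// (_ : (fun k => _) = (fun k => (cA n (a k) * n%:R / b k * t) `^ n%:R^-1)); last first.
    by apply/funext => k; rewrite rhoE.
  have c1 : (fun k => cA n (a k) * n%:R / b k * t) @ \oo --> cA n A * n%:R / L * t.
    apply: cvgM; last exact: cvg_cst.
    apply: cvgM; first by apply: cvgM => //; exact: cvg_cst.
    by apply: cvgV => //; rewrite gt_eqF.
  have p0 : 0 < cA n A * n%:R / L * t by rewrite mulr_gt0// divr_gt0// mulr_gt0// cA_gt0.
  have cpow : {for cA n A * n%:R / L * t, continuous (fun s : R => s `^ n%:R^-1)}.
    apply/differentiable_continuous/derivable1_diffP.
    by have [] := is_derive1_powR n%:R^-1 p0.
  exact: (continuous_cvg _ cpow c1).
have ckap (m : nat -> R) (l : R) : 0 < l -> m @ \oo --> l -> (fun k => kap n (m k)) @ \oo --> kap n l.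
  move=> l0 cm; have ck : {for l, continuous (@kap R n)}.
    by apply/differentiable_continuous/derivable1_diffP; have [] := is_derive_kap n2 l0.
  exact: (continuous_cvg _ ck cm).
have rho0 := rho_gt0 n2 A0 L0 t0.
pose P A' L' m := cA n A' * t * kap n m + L' / (2 * n%:R) * m ^+ 2.
have cP (m : nat -> R) (l : R) : 0 < l -> m @ \oo --> l -> (fun k => P (a k) (b k) (m k)) @ \oo --> P A L l.
  move=> l0 cm; apply: cvgD.
    by apply: cvgM; [apply: cvgM => //; exact: cvg_cst|exact: ckap].
  apply: cvgM; first by apply: cvgM => //; exact: cvg_cst.
  exact: (cvgM cm cm).
apply: (@cvgB _ _ _ _ _ (fun k => P (a k) (b k) (Num.min (enorm x) (rho n (a k) (b k) t))) (fun k => P (a k) (b k) (rho n (a k) (b k) t))).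
  apply: cP; first by rewrite lt_min x0'.
  have cm : {for rho n A L t, continuous (fun s : R => Num.min (enorm x) s : R)}.
    by apply: (@continuous_min R R (fun=> enorm x) id); [exact: cst_continuous|exact: cvg_id].
  exact: (continuous_cvg _ cm crho).
exact: cP.
Qed.

Lemma limit_solution_unique x : x != 0 -> w x = baiocchi A L t x.
Proof.
move=> x0; pose s (k : nat) : R := k.+2%:R^-1.
have s0 k : 0 < s k by rewrite invr_gt0 ltr0n.
have s1 k : s k < 1 by rewrite invf_lt1 ?ltr0n// ltr1n.
have cs : s @ \oo --> (0 : R).
  by have := @cvg_harmonic R; rewrite -cvg_shiftS; exact.
have c1 c : (fun k => c * (1 - s k)) @ \oo --> c.
  have {2}-> : c = c * (1 - 0) by rewrite subr0 mulr1.
  by apply: cvgM; [exact: cvg_cst|apply: cvgB => //; exact: cvg_cst].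
have c2 c : (fun k => c * (1 + s k)) @ \oo --> c.
  have {2}-> : c = c * (1 + 0) by rewrite addr0 mulr1.
  by apply: cvgM; [exact: cvg_cst|apply: cvgD => //; exact: cvg_cst].
have p1 c : 0 < c -> forall k, 0 < c * (1 - s k) by move=> h k; rewrite mulr_gt0// subr_gt0.
have p2 c : 0 < c -> forall k, 0 < c * (1 + s k) by move=> h k; rewrite mulr_gt0// addr_gt0.
apply/eqP; rewrite eq_le; apply/andP; split.
  apply: (ler_cvg_to (cvg_cst (w x)) (baiocchi_param_cvg x0 (p2 _ A0) (p1 _ L0) (c2 A) (c1 L))).
  by apply: nearW => k; exact: w_le_baiocchi.
apply: (ler_cvg_to (baiocchi_param_cvg x0 (p1 _ A0) (p2 _ L0) (c1 A) (c2 L)) (cvg_cst (w x))).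
by apply: nearW => k; exact: w_ge_baiocchi.
Qed.

End comparison.

Theorem theorem5p1 (R : realType) (n : nat) (A L : R)
    (hn : (2 <= n)%N) (hA : 0 < A) (hL : 0 < L) (t : R) (ht : 0 < t) :
  limit_solution A L t (fun x : 'rV[R]_n => U_AL A L x t) /\
  forall w : 'rV[R]_n -> R, limit_solution A L t w ->
    forall x : 'rV[R]_n, x != 0 -> w x = U_AL A L x t.
Proof.
split; first exact: baiocchi_limit_solution.
by move=> w sol x; exact: limit_solution_unique.
Qed.
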